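(* Let $f=e^{-u}\in\mathcal{A}'$, and assume that $\varphi:=u^*$ is uniformly strictly convex, namely there exists $c>0$ such that $\nabla^2\varphi(y)\ge c\,\mathrm{Id}$ for all $y\in\mathbb{R}^n$. Then $$P(f)=\frac12\int_{\mathbb{R}^n}\frac{\|\nabla f\|^2}{f}\,dx+(\log c_n)\,J(f)\ \ge\ n\,J(f)+\mathrm{Ent}(f),$$ with equality sign (in the inequality) if and only if there exists $x_0\in\mathbb{R}^n$ such that $f(x)=\gamma_n(x-x_0)$ for all $x\in\mathbb{R}^n$.
   Context: Fix $n\ge 1$. For a convex function $u:\mathbb{R}^n\to\mathbb{R}\cup\{+\infty\}$, $\mathrm{dom}(u)=\{x: u(x)\in\mathbb{R}\}$, $u$ is proper if $\mathrm{dom}(u)\ne\emptyset$, and $u^*(y)=\sup_{x\in\mathbb{R}^n}(\langle x,y\rangle-u(x))$ is its Fenchel conjugate. $\mathcal{L}$ is the set of proper convex $u:\mathbb{R}^n\to\mathbb{R}\cup\{+\infty\}$ with $\lim_{\|x\|\to+\infty}u(x)=+\infty$, and $\mathcal{A}=\{e^{-u}: u\in\mathcal{L}\}$ (with $e^{-\infty}=0$). $\mathcal{L}'$ is the set of $u\in\mathcal{L}$ such that $\mathrm{dom}(u)=\mathbb{R}^n$, $u\in C^2(\mathbb{R}^n)$ with positive definite Hessian at every point, and $\lim_{\|x\|\to+\infty}u(x)/\|x\|=+\infty$. $\mathcal{A}'=\{e^{-u}:u\in\mathcal{L}'\}$. Operations: $u\Box v(x)=\inf_{y\in\mathbb{R}^n}\{u(x-y)+v(y)\}$;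 $(u\alpha)(x)=\alpha u(x/\alpha)$ for $\alpha>0$, and $u0=I_{\{0\}}$ (equal to $0$ at the origin and $+\infty$ elsewhere). For $f=e^{-u}$, $g=e^{-v}$ in $\mathcal{A}$ and $t\ge0$, $f\oplus t\cdot g=e^{-[u\Box(vt)]}$. $J(f)=\int_{\mathbb{R}^n}f\,dx$, $\delta J(f,g)=\lim_{t\to0^+}\frac{J(f\oplus t\cdot g)-J(f)}{t}$, and $\mathrm{Ent}(f)=\int_{\mathbb{R}^n}f\log f\,dx-J(f)\log J(f)$. $\gamma_n(x)=c_n e^{-\|x\|^2/2}$ with $c_n=(2\pi)^{-n/2}$. The perimeter of $f\in\mathcal{A}'$ with $J(f)>0$ is $P(f):=\delta J(f,\gamma_n)$.
   Formalization: The equality case is corrected: equality holds iff f(x) = λ γ_n(x − x_0) for some x_0 and some λ > 0, since both sides are 1-homogeneous in f and f = λγ_n with λ ≠ 1 gives equality without being a translate of γ_n. *)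

(* Defs.v *)
From HB Require Import structures.
From mathcomp Require Import all_boot all_order all_algebra.
From mathcomp Require Import all_classical all_reals all_analysis.
Set Implicit Arguments.
Unset Strict Implicit.
Unset Printing Implicit Defensive.
Import Order.TTheory GRing.Theory Num.Theory.
Import numFieldNormedType.Exports.
Local Open Scope classical_set_scope.
Local Open Scope ring_scope.

(* R^n is 'rV[R]_n. Its library norm is the sup norm (same topology), hence
   the Euclidean norm enorm below. *)

Section euclidean.
Context {R : realType} {n : nat}.
Implicit Types x y : 'rV[R]_n.

Definition dotp x y : R := (x *m y^T) 0 0.

Definition enorm x : R := Num.sqrt (dotp x x).

(* neighborhoods of infinity: the filter of "||x|| -> +oo" *)
Definition norm_infty : set_system 'rV[R]_n :=
  [set A | \forall M \near +oo, forall x, M < enorm x -> A x].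

End euclidean.

Section calculus.
Context {R : realType} {n : nat}.
Implicit Types (w : 'rV[R]_n -> R) (x : 'rV[R]_n).

Definition partial (i : 'I_n) w x : R := 'D_(delta_mx 0 i) w x.

Definition grad w x : 'rV[R]_n := \row_i partial i w x.

Definition hessian w x : 'M[R]_n := \matrix_(i, j) partial i (partial j w) x.

Definition C1 w : Prop :=
  continuous w /\
  forall i, (forall x, derivable w x (delta_mx 0 i)) /\ continuous (partial i w).

Definition C2 w : Prop := C1 w /\ forall i, C1 (partial i w).

Definition positive_definite (A : 'M[R]_n) : Prop :=
  forall v : 'rV[R]_n, v != 0 -> 0 < (v *m A *m v^T) 0 0.

Definition loewner_le (A B : 'M[R]_n) : Prop :=
  forall v : 'rV[R]_n, (v *m A *m v^T) 0 0 <= (v *m B *m v^T) 0 0.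

(* Applied to fine \o conjugate u with u in classL': this conjugate is then
   automatically finite and of class C^2, so the Hessian is a genuine one. *)
Definition uniformly_strictly_convex w : Prop :=
  exists2 c : R, 0 < c & forall y, loewner_le c%:M (hessian w y).

End calculus.

(* Lebesgue measure on R^n, as a measure on n-tuples of reals (equipped by the
   library with the product sigma-algebra), by recursion on n: the image of
   lebesgue_measure \x lebesgue_tuple n under (x, t) |-> x :: t. *)
Section lebesgue_measure_tuple.
Context {R : realType}.
Let mR := measurableTypeR R.

Definition cons_pair n (p : mR * n.-tuple mR) : n.+1.-tuple mR :=
  [the n.+1.-tuple mR of p.1 :: p.2].

Lemma measurable_cons_pair n : measurable_fun setT (@cons_pair n).
Proof. exact: measurable_cons. Qed.

Definition uncons_pair n (t : n.+1.-tuple mR) : mR * n.-tuple mR :=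
  (thead t, [tuple of behead t]).

Lemma measurable_uncons_pair n : measurable_fun setT (@uncons_pair n).
Proof.
apply/measurable_fun_pairP; split; first exact: measurable_tnth.
exact: measurable_behead.
Qed.

Lemma cons_pairK n : cancel (@cons_pair n) (@uncons_pair n).
Proof. by case=> x t; congr (_, _); apply: val_inj. Qed.

Section step.
Context n (mu : {sigma_finite_measure set (n.-tuple mR) -> \bar R}).

Definition lebesgue_step : set (n.+1.-tuple mR) -> \bar R :=
  pushforward (@lebesgue_measure R \x mu)%E (@cons_pair n).

Let lebesgue_step0 : lebesgue_step set0 = 0%E.
Proof. by rewrite /lebesgue_step /pushforward preimage_set0 measure0. Qed.

Let lebesgue_step_ge0 A : (0 <= lebesgue_step A)%E.
Proof. by rewrite /lebesgue_step /pushforward measure_ge0. Qed.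

Let lebesgue_step_sigma_additive : semi_sigma_additive lebesgue_step.
Proof.
move=> F mF tF mUF; rewrite /lebesgue_step /pushforward preimage_bigcup.
apply: measure_semi_sigma_additive.
- by move=> k; rewrite -[X in measurable X]setTI; exact: measurable_cons_pair.
- apply/trivIsetP => i j _ _ ij; rewrite -preimage_setI.
  by move/trivIsetP : tF => /(_ _ _ _ _ ij) ->//; rewrite preimage_set0.
- rewrite -preimage_bigcup -[X in measurable X]setTI.
  exact: measurable_cons_pair.
Qed.

HB.instance Definition _ := isMeasure.Build _ _ _ lebesgue_step
  lebesgue_step0 lebesgue_step_ge0 lebesgue_step_sigma_additive.

Lemma sigma_finite_lebesgue_step : sigma_finite setT lebesgue_step.
Proof.
have /sigma_finiteP[G [TG ndG mG]] := sigma_finiteT mu.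
have /sigma_finiteP[F [TF ndF mF]] := sigma_finiteT (@lebesgue_measure R).
exists (fun k => @uncons_pair n @^-1` (F k `*` G k)).
  rewrite -preimage_bigcup; apply/esym/seteqP; split => // t _.
  have [i _ Fi] : (\bigcup_i F i) (uncons_pair t).1 by rewrite -TF.
  have [j _ Gj] : (\bigcup_i G i) (uncons_pair t).2 by rewrite -TG.
  exists (maxn i j) => //; split.
    by move: Fi; exact/subsetPset/ndF/leq_maxl.
  by move: Gj; exact/subsetPset/ndG/leq_maxr.
move=> k; have [mFk Fk] := mF k; have [mGk Gk] := mG k; split.
  rewrite -[X in measurable X]setTI; apply: measurable_uncons_pair => //.
  exact: measurableX.
rewrite /lebesgue_step /pushforward -comp_preimage.
rewrite (_ : _ \o _ = id); last by apply/funext => p; rewrite /= cons_pairK.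
by rewrite preimage_id product_measure1E// lte_mul_pinfty// ge0_fin_numE.
Qed.

HB.instance Definition _ :=
  Measure_isSigmaFinite.Build _ _ _ lebesgue_step sigma_finite_lebesgue_step.

End step.

Fixpoint lebesgue_tuple n : {sigma_finite_measure set (n.-tuple mR) -> \bar R} :=
  match n with
  | 0%N => [the {sigma_finite_measure set _ -> \bar R} of \d_ [tuple]]
  | n'.+1 => [the {sigma_finite_measure set _ -> \bar R}
                of lebesgue_step (lebesgue_tuple n')]
  end.

End lebesgue_measure_tuple.

Section functions.
Context {R : realType} {n : nat}.
Implicit Types (u v : 'rV[R]_n -> \bar R) (f g : 'rV[R]_n -> R).

(* The measurable structure is the one on tuples, which are turned into row
   vectors. *)
Definition int_Rn (F : 'rV[R]_n -> \bar R) : \bar R :=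
  (\int[@lebesgue_tuple R n]_t F (\row_i tnth t i))%E.

Definition dom u : set 'rV[R]_n := [set x | u x \is a fin_num].

Definition convex_ereal u : Prop :=
  forall (x y : 'rV[R]_n) (t : R), 0 <= t <= 1 ->
    (u (t *: x + (1 - t) *: y)%R <= t%:E * u x + (1 - t)%:E * u y)%E.

Definition conjugate u (y : 'rV[R]_n) : \bar R :=
  ereal_sup (range (fun x => (dotp x y)%:E - u x)%E).

Definition classL u : Prop :=
  [/\ forall x, u x != -oo%E, dom u !=set0, convex_ereal u
    & u @ norm_infty --> +oo%E].

Definition classL' u : Prop :=
  [/\ classL u, dom u = setT, C2 (fine \o u),
      forall x, positive_definite (hessian (fine \o u) x)
    & (fun x => u x * ((enorm x)^-1)%:E)%E @ norm_infty --> +oo%E].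

(* real-valued because u never takes the value -oo; e^{-oo} = 0 *)
Definition exp_neg u (x : 'rV[R]_n) : R := fine (expeR (- u x)%E).

(* inverse of exp_neg; the value is +oo where f vanishes *)
Definition neg_log f (x : 'rV[R]_n) : \bar R := (- lne (f x)%:E)%E.

(* inf-convolution; functions of classL omit -oo, so +oo - oo never occurs *)
Definition infconv u v (x : 'rV[R]_n) : \bar R :=
  ereal_inf (range (fun y => u (x - y)%R + v y)%E).

(* right multiplication u a, with u 0 the indicator function of {0} *)
Definition rscale u (a : R) (x : 'rV[R]_n) : \bar R :=
  if a == 0 then (if x == 0 then 0%E else +oo%E) else
  (a%:E * u (a^-1 *: x)%R)%E.

(* f (+) t . g, on the level of f = e^{-u} and g = e^{-v} *)
Definition asplund f (t : R) g : 'rV[R]_n -> R :=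
  exp_neg (infconv (neg_log f) (rscale (neg_log g) t)).

Definition total_mass f : \bar R := int_Rn (fun x => (f x)%:E).

Definition quotJ f g (t : R) : \bar R :=
  ((total_mass (asplund f t g) - total_mass f) * (t^-1)%:E)%E.

(* meaningful when quotJ f g converges in \bar R as t decreases to 0 *)
Definition deltaJ f g : \bar R := lim (quotJ f g t @[t --> 0^'+]).

Definition Ent f : \bar R :=
  (int_Rn (fun x => (f x * ln (f x))%:E) - total_mass f * lne (total_mass f))%E.

End functions.

Definition gauss_cst (R : realType) (n : nat) : R := (2 * pi) `^ (- (n%:R / 2)).

Definition gauss {R : realType} {n : nat} (x : 'rV[R]_n) : R :=
  gauss_cst R n * expR (- (enorm x ^+ 2 / 2)).

Definition perimeter {R : realType} {n : nat} (f : 'rV[R]_n -> R) : \bar R :=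
  deltaJ f gauss.

(* Main.v *)
Require Import Defs.
From mathcomp Require Import all_boot all_order all_algebra.
From mathcomp Require Import all_classical all_reals all_analysis.
From mathcomp Require Import measurable_realfun ring lra.
Set Implicit Arguments.
Unset Strict Implicit.
Unset Printing Implicit Defensive.
Import Order.TTheory GRing.Theory Num.Theory.
Import numFieldNormedType.Exports.
Local Open Scope classical_set_scope.
Local Open Scope ring_scope.

(** Write f = exp (- U), J for its integral, q = |grad U|^2 / 2 and Q for the
    integral of q f. Two things have to be shown: the first variation of the
    total mass in the direction of the Gaussian is Q + (ln c_n) J, and this
    number is at least n J + Ent f, with equality for Gaussian profiles only.
    As grad f = - f grad U, the number Q is half of the Fisher information of f.

    First variation. The gradient of the conjugate of U inverts grad U, so the
    Hessian of the conjugate at grad U x is the inverse of the Hessian of U at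
    x; the uniform strict convexity of the conjugate therefore bounds the
    Hessian of U from above by C = c^-1 ([hessian_upper_bound]). Up to the
    constant t ln c_n, the potential of f (+) t . gamma_n is the Moreau envelope
    of U, the infimum over y of U (x - y) + |y|^2 / (2 t). Convexity bounds it
    from below by U - t q, and the bound on the Hessian, used at a suitable
    multiple of the gradient, bounds it from above by U - t q / (1 + t C)
    ([infconv_bounds]). After exponentiation and integration both bounds agree
    to first order in t ([total_mass_asplund_bounds], [cvg_quotJ]); the
    integrals converge because U grows superlinearly while q is at most a
    multiple of U minus its minimum ([grad_sqr_bound]).

    The inequality. The difference of its two sides is the deficit in the
    Gaussian logarithmic Sobolev inequality ([deficit_first_variation]). On the
    real line let T be the monotone map that carries f / J to the standard
    Gaussian. An integration by parts turns the deficit into the integral of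
    f ((U' - T)^2 / 2 + T' - 1 - ln T'), which is nonnegative; if it vanishes,
    then T' = 1 and U' = T, so that U is (x - a)^2 / 2 plus a constant
    ([deficit1_ge0], [deficit1_eq0]). In dimension n + 1 the deficit of f is the
    integral of the deficits of its slices along the first coordinate, plus that
    of its slices along the other ones, plus a relative entropy which vanishes
    only if f is the product of its marginals ([deficit_split]). Induction on
    the dimension gives nonnegativity ([deficit_ge0]). If the deficit is zero,
    then U is the sum of a function of the first coordinate and of a function of
    the other ones, to which the cases 1 and n apply ([deficit_eq0]). *)

(** * Integration on measure spaces and on the real line *)

Section measure_tools.
Context {d : measure_display} {T : measurableType d} {R : realType}.
Variable mu : {measure set T -> \bar R}.
Implicit Types f g : T -> R.

Lemma integrableRD (A : set T) f g : measurable A ->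
  mu.-integrable A (EFin \o f) -> mu.-integrable A (EFin \o g) ->
  mu.-integrable A (EFin \o (fun x => f x + g x)).
Proof. by move=> mA fi gi; exact: (integrableD mA fi gi). Qed.

Lemma integrableRB (A : set T) f g : measurable A ->
  mu.-integrable A (EFin \o f) -> mu.-integrable A (EFin \o g) ->
  mu.-integrable A (EFin \o (fun x => f x - g x)).
Proof. by move=> mA fi gi; exact: (integrableB mA fi gi). Qed.

Lemma integrableRZl (A : set T) (k : R) f : measurable A ->
  mu.-integrable A (EFin \o f) -> mu.-integrable A (EFin \o (fun x => k * f x)).
Proof. by move=> mA fi; exact: (integrableZl mA k fi). Qed.

Lemma integrableRZr (A : set T) (k : R) f : measurable A ->
  mu.-integrable A (EFin \o f) -> mu.-integrable A (EFin \o (fun x => f x * k)).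
Proof. by move=> mA fi; exact: (integrableZr mA k fi). Qed.

Lemma integrable_dominated f g : measurable_fun setT f ->
  (forall x, `|f x| <= g x) -> mu.-integrable setT (EFin \o g) ->
  mu.-integrable setT (EFin \o f).
Proof.
move=> mf fg; apply: le_integrable => //; first exact/measurable_EFinP.
by move=> x _ /=; rewrite lee_fin (le_trans (fg x))// ler_norm.
Qed.

Lemma Rintegral_EFin f : mu.-integrable setT (EFin \o f) ->
  (\int[mu]_x (f x)%:E)%E = (\int[mu]_x f x)%:E.
Proof. by move=> fi; rewrite /Rintegral fineK//; exact: integrable_fin_num. Qed.

Lemma Rintegral_eq0_ae f : mu.-integrable setT (EFin \o f) ->
  (forall x, 0 <= f x) -> \int[mu]_x f x = 0 -> {ae mu, forall x, f x = 0}.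
Proof.
move=> fi f0 If0.
have mf := measurable_int _ fi.
have : (\int[mu]_x `|(EFin \o f) x| = 0)%E.
  transitivity (\int[mu]_x (f x)%:E)%E.
    by apply: eq_integral => x _ /=; rewrite ger0_norm.
  by rewrite Rintegral_EFin// If0.
move/(ae_eq_integral_abs mu measurableT mf).
by apply: filterS => x /(_ I) /= [].
Qed.

Lemma ae_exists (P : T -> Prop) : mu setT != 0 -> {ae mu, forall x, P x} ->
  exists x, P x.
Proof.
move=> muT aeP; apply: contrapT => nP.
case: aeP => A [mA A0 sA]; move/eqP: muT; apply.
suff <- : A = setT by [].
by apply/seteqP; split => // x _; apply: sA => /= Px; apply: nP; exists x.
Qed.

End measure_tools.

Section real_line.
Context {R : realType}.
Notation mu := (@lebesgue_measure R).
Implicit Types (f g D E phi : R -> R).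

Lemma continuous_integrable_segment f (a b : R) : continuous f ->
  mu.-integrable `[a, b] (EFin \o f).
Proof.
move=> cf; apply: continuous_compact_integrable; first exact: segment_compact.
exact: continuous_subspaceT.
Qed.

Lemma is_derive1_continuous f (x df : R) : is_derive x 1 f df ->
  {for x, continuous f}.
Proof. by case=> fx _; apply/differentiable_continuous/derivable1_diffP. Qed.

Lemma ae_eq0_continuous f : continuous f -> {ae mu, forall x, f x = 0} ->
  forall x, f x = 0.
Proof.
move=> cf [A [mA A0 sA]] x; apply: contrapT => fx.
have : \forall y \near x, f y != 0.
  have /cf : nbhs (f x) [set z : R | z != 0].
    by apply: open_nbhs_nbhs; split; [exact: open_neq|exact/eqP].
  by [].
move=> /nbhs_ballP[e /= e0 xe].
have : (mu (ball x e) <= mu A)%E.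
  apply: le_measure; rewrite ?inE//; first exact: measurable_ball.
  by move=> y /xe fy; apply: sA => /= fy0; rewrite fy0 eqxx in fy.
have -> : (mu A = 0)%E by exact: A0.
rewrite lebesgue_measure_ball; last exact: ltW.
by rewrite lee_fin leNgt pmulrn_lgt0 ?e0.
Qed.

Lemma cvg_integral_symm_segment f : (forall x, 0 <= f x) -> continuous f ->
  (\int[mu]_(x in `[(- (n%:R : R))%R, n%:R]) (f x)%:E @[n --> \oo] -->
   \int[mu]_x (f x)%:E)%E.
Proof.
move=> f0 cf.
have -> : [set: R] = \bigcup_n [set` `[- (n%:R : R), n%:R]].
  apply/esym/seteqP; split => // x _.
  exists (Num.bound `|x|) => //=; rewrite in_itv/= -ler_norml.
  exact: ltW (archi_boundP (normr_ge0 x)).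
apply: ge0_nondecreasing_set_cvg_integral.
- move=> m n mn; apply/subsetPset/subset_itv; rewrite bnd_simp.
    by rewrite lerN2 ler_nat.
  by rewrite ler_nat.
- by move=> n; exact: measurable_itv.
- move=> n; apply/measurable_EFinP/measurable_funTS.
  exact: continuous_measurable_fun.
- by move=> n x _; rewrite lee_fin.
Qed.

(** The integrals of D and E over [-n, n] differ by the boundary terms of phi,
    which vanish in the limit. As D is only known to be nonnegative, its
    integrability is obtained at the same time, by monotone convergence, after the
    negative part of E has been moved to the side of D. *)
Lemma integral_null_flux D E phi : continuous D -> continuous E ->
  (forall x, 0 <= D x) -> mu.-integrable setT (EFin \o E) ->
  (forall x : R, is_derive x 1 phi (D x - E x)) ->
  phi x @[x --> +oo] --> 0 -> phi x @[x --> -oo] --> 0 ->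
  mu.-integrable setT (EFin \o D) /\ \int[mu]_x D x = \int[mu]_x E x.
Proof.
move=> cD cE D0 iE dphi phiy phiNy.
have cphi : continuous phi.
  by move=> x; exact: is_derive1_continuous (dphi x).
pose Ep x := Num.max (E x) 0; pose En x := Num.max (- E x) 0.
have EpnE x : E x = Ep x - En x by rewrite /Ep /En; case: (leP (E x) 0); case: (leP (- E x) 0); lra.
have cEp : continuous Ep.
  move=> x; exact: (@continuous_max _ _ E (cst 0) x (cE x) (@cst_continuous _ _ _ _)).
have cEn : continuous En.
  move=> x; have cNE : {for x, continuous (fun x => - E x)} := continuousN (cE x).
  exact: (@continuous_max _ _ (fun x => - E x) (cst 0) x cNE (@cst_continuous _ _ _ _)).
have Ep0 x : 0 <= Ep x by rewrite le_max lexx orbT.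
have En0 x : 0 <= En x by rewrite le_max lexx orbT.
have iEp : mu.-integrable setT (EFin \o Ep).
  apply: (@integrable_dominated _ _ _ mu _ (fun x => `|E x|)).
  - exact: continuous_measurable_fun.
  - move=> x; rewrite ger0_norm// /Ep ge_max ler_norm//=.
  - exact: integrable_norm.
have iEn : mu.-integrable setT (EFin \o En).
  apply: (@integrable_dominated _ _ _ mu _ (fun x => `|E x|)).
  - exact: continuous_measurable_fun.
  - by move=> x; rewrite ger0_norm// /En ge_max -normrN ler_norm/=.
  - exact: integrable_norm.
have seg (n : nat) : (\int[mu]_(x in `[(- (n%:R : R))%R, n%:R]) (D x + En x)%:E =
   \int[mu]_(x in `[(- (n%:R : R))%R, n%:R]) (Ep x)%:E + (phi n%:R - phi (- n%:R))%:E)%E.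
  have [->|n0] := eqVneq n 0%N.
    by rewrite !oppr0 set_itv1 !integral_set1 subrr adde0.
  have -> : (phi n%:R - phi (- n%:R))%:E =
      (\int[mu]_(x in `[(- (n%:R : R))%R, n%:R]) (D x - E x)%:E)%E.
    rewrite (@continuous_FTC2 _ (fun x => D x - E x) phi)//.
    - have : (0 < n%:R :> R) by rewrite ltr0n lt0n.
      lra.
    - apply: continuous_subspaceT => x.
      by apply: continuousB; [exact: cD|exact: cE].
    - split.
      + by move=> x _; case: (dphi x).
      + exact: cvg_at_right_filter (cphi _).
      + exact: cvg_at_left_filter (cphi _).
    - by move=> x _; rewrite derive1E; apply: derive_val.
  rewrite -integralD_EFin//.
  - by apply: eq_integral => x _ /=; congr (_%:E); have := EpnE x; lra.
  - by apply: continuous_integrable_segment.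
  - apply: continuous_integrable_segment => x.
    by apply: continuousB; [exact: cD|exact: cE].
have lhs := @cvg_integral_symm_segment (fun x => D x + En x).
have {}lhs := lhs (fun x => addr_ge0 (D0 x) (En0 x)) (fun x => continuousD (cD x) (cEn x)).
have rhs : (\int[mu]_(x in `[(- (n%:R : R))%R, n%:R]) (Ep x)%:E + (phi n%:R - phi (- n%:R))%:E
   @[n --> \oo] --> \int[mu]_x (Ep x)%:E + 0%:E)%E.
  apply: cvgeD => //.
    by rewrite fin_num_adde_defl.
  - exact: cvg_integral_symm_segment.
  apply: cvg_EFin; first by near=> n.
  rewrite -(subr0 (0:R)); apply: (@cvgB _ R^o).
    exact: (cvg_comp _ _ cvgr_idn phiy).
  apply: (cvg_comp _ _ _ phiNy).
  exact: (cvgNrNy (fun n : nat => n%:R : R)).2 cvgr_idn.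
have key : (\int[mu]_x (D x + En x)%:E = \int[mu]_x (Ep x)%:E)%E.
  rewrite adde0 in rhs.
  move: lhs; under eq_cvg do rewrite seg.
  move=> lhs.
  exact: (cvg_unique _ lhs rhs).
have iDEn : mu.-integrable setT (EFin \o (fun x => D x + En x)).
  apply/integrableP; split.
    apply/measurable_EFinP; apply: continuous_measurable_fun => x.
    exact: (continuousD (cD x) (cEn x)).
  under eq_integral => x _ do rewrite /= ger0_norm ?addr_ge0//.
  by rewrite key Rintegral_EFin// ltry.
have iD : mu.-integrable setT (EFin \o D).
  apply: (@integrable_dominated _ _ _ mu _ (fun x => D x + En x)) => //.
    exact: continuous_measurable_fun.
  by move=> x; rewrite ger0_norm// lerDl.
split=> //.
have : \int[mu]_x (D x + En x) = \int[mu]_x Ep x by rewrite /Rintegral key.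
rewrite RintegralD// => H.
under [RHS]eq_Rintegral => x _ do rewrite EpnE.
by rewrite RintegralB// -H addrK.
Unshelve. all: by end_near. Qed.

End real_line.

(** * Bounds by decaying exponentials *)

Section scalar_bounds.
Context {R : realType}.
Implicit Types x y w b : R.

Lemma sqr1D_le_expR y : 0 <= y -> (1 + y) ^+ 2 <= 16 * expR (y / 2).
Proof.
move=> y0; have -> : y / 2 = y / 4 + y / 4 by lra.
have h : 1 + y <= 4 * expR (y / 4) by have := expR_ge1Dx (y / 4); lra.
rewrite expRD; have := ler_pM (_ : 0 <= 1 + y) (_ : 0 <= 1 + y) h h.
by rewrite expr2 => /(_ _ _)/le_trans -> //; lra.
Qed.

(** In this bound and the next two, y stands for the norm of a point and w for the
    value there of a potential of at least linear growth: the integrands of the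
    deficit are all dominated by exp (- y / 2). *)
Lemma expRN_dominated w y b : 0 <= y -> y - b <= w ->
  expR (- w) <= expR b * expR (- (y / 2)).
Proof. by move=> y0 yw; rewrite -expRD ler_expR; lra. Qed.

Lemma normM_expRN_dominated w y b : 0 <= y -> y - b <= w ->
  `|w| * expR (- w) <= expR b * (2 + `|b|) * expR (- (y / 2)).
Proof.
move=> y0 yw; set z := w + b; have z0 : 0 <= z by rewrite /z; lra.
have wz : `|w| <= z + `|b|.
  rewrite (_ : w = z - b); last by rewrite /z; lra.
  by rewrite (le_trans (ler_normB _ _))// (ger0_norm z0).
have -> : expR (- w) = expR b * expR (- (z / 2)) * expR (- (z / 2)).
  by rewrite -!expRD; congr expR; rewrite /z; lra.
have h1 : z * expR (- (z / 2)) <= 2.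
  rewrite expRN ler_pdivrMr ?expR_gt0//.
  by have := expR_ge1Dx (z / 2); lra.
have h2 : expR (- (z / 2)) <= expR (- (y / 2)) by rewrite ler_expR /z; lra.
have h3 : expR (- (z / 2)) <= 1 by rewrite expR_le1; lra.
have e0 := expR_gt0 (- (z / 2)); have b0 := expR_gt0 b; have nb := normr_ge0 b.
have h4 : `|w| * expR (- (z / 2)) <= 2 + `|b|.
  apply: (@le_trans _ _ ((z + `|b|) * expR (- (z / 2)))).
    by rewrite ler_wpM2r// ltW.
  rewrite mulrDl lerD// -[leRHS]mulr1 ler_wpM2l//.
apply: (@le_trans _ _ (expR b * (2 + `|b|) * expR (- (z / 2)))).
  set B := expR b in b0 *; set e := expR (- (z / 2)) in e0 h4 *.
  rewrite (_ : `|w| * (B * e * e) = B * ((`|w| * e) * e)); last by ring.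
  by rewrite -(mulrA B (2 + `|b|)) ler_wpM2l ?(ltW b0)// ler_wpM2r// ltW.
by rewrite ler_wpM2l// mulr_ge0//; lra.
Qed.

Lemma sqrM_expRN_dominated (A p : R) w y b : 0 <= y -> y - b <= w ->
  `|p| <= A * (1 + y) ->
  p ^+ 2 * expR (- w) <= A ^+ 2 * 16 * expR b * expR (- (y / 2)).
Proof.
move=> y0 yw pA.
have h1 : p ^+ 2 <= A ^+ 2 * (16 * expR (y / 2)).
  rewrite -[p ^+ 2](@ger0_norm _ (p ^+ 2)) ?sqr_ge0// normrX; apply: (@le_trans _ _ ((A * (1 + y)) ^+ 2)).
    by rewrite lerXn2r ?nnegrE ?normr_ge0//; apply: le_trans pA.
  by rewrite exprMn ler_wpM2l ?sqr_ge0// sqr1D_le_expR.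
have h2 : expR (- w) <= expR b * expR (- y) by rewrite -expRD ler_expR; lra.
apply: (le_trans (ler_pM (sqr_ge0 _) (expR_ge0 _) h1 h2)).
rewrite (_ : - (y / 2) = y / 2 + - y); last lra.
rewrite expRD le_eqVlt; apply/orP; left; apply/eqP; ring.
Qed.

Lemma subr1_ln_ge0 (t : R) : 0 < t -> 0 <= t - 1 - ln t.
Proof. by move=> t0; have := @le_ln1Dx _ (t - 1); rewrite addrCA subrr addr0; lra. Qed.

Lemma subr1_ln_eq0 (t : R) : 0 < t -> t - 1 - ln t = 0 -> t = 1.
Proof.
move=> t0 h; apply/eqP; apply: contrapT => /negP t1.
have lt0 : ln t != 0 by rewrite ln_eq0.
by have := expR_gt1Dx lt0; rewrite lnK ?posrE//; lra.
Qed.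

End scalar_bounds.

Section exponential_decay.
Context {R : realType}.
Notation mu := (@lebesgue_measure R).

Lemma continuous_expRN (w : R -> R) : continuous w -> continuous (fun x => expR (- w x)).
Proof.
move=> cw x; apply: (@continuous_comp _ _ _ (fun x => - w x) (@expR R)).
  exact: (continuousN (cw x)).
exact: continuous_expR.
Qed.

Lemma continuous_expRN_norm : continuous (fun x : R => expR (- (`|x| / 2))).
Proof.
apply: continuous_expRN => x.
exact: (continuousM (@norm_continuous _ R^o x) (@cst_continuous _ _ _ _)).
Qed.

Lemma cvg_expRN_norm_pinfty : expR (- (`|x| / 2)) @[x --> +oo] --> (0 : R).
Proof.
have h : x / 2 @[x --> +oo] --> (+oo : set_system R).
  by apply: gt0_cvgMly; [rewrite invr_gt0|exact: cvg_id].
have := cvg_comp _ _ h (@cvgr_expR R).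
apply: cvg_trans; apply: near_eq_cvg; near=> x => /=.
by rewrite ger0_norm//.
Unshelve. all: by end_near. Qed.

Lemma cvg_expRN_norm_ninfty : expR (- (`|x| / 2)) @[x --> -oo] --> (0 : R).
Proof.
apply/cvgNy_compNP; have := cvg_expRN_norm_pinfty.
by under [X in X -> _]eq_cvg do rewrite -normrN.
Qed.

Lemma integrable_expRN_norm :
  mu.-integrable setT (EFin \o (fun x => expR (- (`|x| / 2)))).
Proof.
apply/integrableP; split.
  apply/measurable_EFinP; apply: continuous_measurable_fun; exact: continuous_expRN_norm.
under eq_integral => x _ do rewrite /= ger0_norm ?expR_ge0//.
rewrite (@ge0_symfun_integralT _ (fun x => expR (- (`|x| / 2)))); last 3 first.
- by move=> x; exact: expR_ge0.
- exact: continuous_expRN_norm.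
- by move=> x /=; rewrite normrN.
rewrite (_ : [set x : R | 0 <= x] = [set` `[0, +oo[]); last by rewrite set_itvcy.
have -> : (\int[mu]_(x in `[0%R, +oo[) (expR (- (`|x| / 2)))%:E =
    \int[mu]_(x in `[0%R, +oo[) (expR (- (x / 2)))%:E)%E.
  by apply: eq_integral => x; rewrite inE/= in_itv/= andbT => x0; rewrite ger0_norm.
have dF (x : R) : is_derive x 1 (fun x => - 2 * expR (- (x / 2))) (expR (- (x / 2))).
  apply: is_derive_eq; rewrite /GRing.scale/=; lra.
rewrite (@ge0_continuous_FTC2y _ _ (fun x => - 2 * expR (- (x / 2))) _ 0).
- by rewrite -EFinB -EFinM ltry.
- by move=> x _; exact: expR_ge0.
- apply: continuous_subspaceT; apply: continuous_expRN => x.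
  exact: (continuousM (@cvg_id _ _) (@cst_continuous _ _ _ _)).
- rewrite -[X in _ --> X](mulr0 (-2)); apply: cvgM; first exact: cvg_cst.
  have := cvg_expRN_norm_pinfty.
  apply: cvg_trans; apply: near_eq_cvg; near=> x => /=.
  by rewrite ger0_norm//.
- by move=> x _; case: (dF x).
- by apply: cvg_at_right_filter; exact: is_derive1_continuous (dF 0).
- by move=> x _; rewrite derive1E; exact: derive_val.
Unshelve. all: by end_near. Qed.

End exponential_decay.

(** * Cumulative distribution functions *)

Section cumulative_distribution.
Context {R : realType}.
Notation mu := (@lebesgue_measure R).

Definition cumul (p : R -> R) (x : R) : R := \int[mu]_(t in `]-oo, x]) p t.

Variable p : R -> R.
Hypothesis cp : continuous p.
Hypothesis p0 : forall x, 0 < p x.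
Hypothesis ip : mu.-integrable setT (EFin \o p).
Hypothesis p1 : \int[mu]_x p x = 1.

Let ipS (A : set R) : measurable A -> mu.-integrable A (EFin \o p).
Proof. by move=> mA; apply: integrableS ip. Qed.

Lemma is_derive_cumul (x : R) : is_derive x 1 (cumul p) (p x).
Proof.
have xu : x < x + 1 by rewrite ltrDl.
have iu : mu.-integrable `]-oo, (x + 1)] (EFin \o p) by exact: ipS.
have [dF F'] := continuous_FTC1 xu iu (ltNyr x) (@cp x).
by rewrite -F' derive1E; exact: derivableP.
Qed.

Lemma cumulB x y : x <= y -> cumul p y - cumul p x = \int[mu]_(t in `]x, y]) p t.
Proof.
move=> xy; rewrite /cumul Rintegral_itvB//.
by apply: ipS; exact: measurable_itv.
Qed.

Lemma onem_cumul x : 1 - cumul p x = \int[mu]_(t in `]x, +oo[) p t.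
Proof.
rewrite -p1 -set_itvNyy /cumul Rintegral_itvB//.
by rewrite set_itvNyy.
Qed.

Lemma cumul_homo : {homo cumul p : x y / x < y}.
Proof.
move=> x y xy.
have [||c cxy] := @MVT R (cumul p) p x y xy.
- by move=> z _; exact: is_derive_cumul.
- apply: continuous_subspaceT => z; exact: is_derive1_continuous (is_derive_cumul z).
by rewrite -subr_gt0 => ->; rewrite mulr_gt0// subr_gt0.
Qed.

Lemma cumul_inj : injective (cumul p).
Proof. by apply: inc_inj; apply: le_mono; exact: cumul_homo. Qed.

Lemma cumul_ge0 x : 0 <= cumul p x.
Proof. by apply: Rintegral_ge0 => t _; exact: ltW. Qed.

Lemma cumul_le1 x : cumul p x <= 1.
Proof.
by rewrite -subr_ge0 onem_cumul; apply: Rintegral_ge0 => t _; exact: ltW.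
Qed.

Lemma cumul_gt0 x : 0 < cumul p x.
Proof.
by apply: le_lt_trans (cumul_ge0 (x - 1)) _; apply: cumul_homo; rewrite ltrBlDr ltrDl.
Qed.

Lemma cumul_lt1 x : cumul p x < 1.
Proof.
by apply: lt_le_trans (cumul_le1 (x + 1)); apply: cumul_homo; rewrite ltrDl.
Qed.

Lemma cumul_surj q : 0 < q < 1 -> exists x, cumul p x = q.
Proof.
move=> /andP[q0 q1]; pose e := Num.min q (1 - q).
have e0 : 0 < e by rewrite lt_min q0 subr_gt0.
have := @cvg_integral_symm_segment R p (fun x => ltW (p0 x)) cp.
rewrite Rintegral_EFin// p1 => /fine_cvgP[_ /cvgrPdist_lt/(_ _ e0)[N _ /(_ N.+1)]] /=.
move=> /(_ (leqnSn N)); set I := fine _ => Ie.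
have IE : I = cumul p N.+1%:R - cumul p (- N.+1%:R).
  rewrite cumulB; last by rewrite -subr_ge0 opprK addr_ge0.
  rewrite Rintegral_itv_obnd_cbnd//.
  by apply: ipS; exact: measurable_itv.
have := cumul_le1 N.+1%:R; have := cumul_ge0 (- N.+1%:R).
move: Ie; rewrite ltr_norml lt_min => /andP[_ /andP[]]; rewrite IE => h1 h2 h3 h4.
have [|||c _ <-] := @IVT R (cumul p) (- N.+1%:R) N.+1%:R q; last by exists c.
- by rewrite -subr_ge0 opprK addr_ge0.
- apply: continuous_subspaceT => z; exact: is_derive1_continuous (is_derive_cumul z).
- rewrite min_l ?max_r; lra.
Qed.

(** Chernoff's argument: the weight exp |t| is at least exp s for t beyond s, and
    at least exp (- s) for t below s. *)
Lemma cumul_tails : mu.-integrable setT (EFin \o (fun t => expR `|t| * p t)) ->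
  forall s, (1 - cumul p s) * expR s <= \int[mu]_t (expR `|t| * p t) /\
            cumul p s * expR (- s) <= \int[mu]_t (expR `|t| * p t).
Proof.
move=> iE s.
have mE : forall A : set R, measurable A -> mu.-integrable A (EFin \o (fun t => expR `|t| * p t)).
  by move=> A mA; apply: integrableS iE.
have sub (A : set R) (r : R) : measurable A -> (forall t, A t -> r <= `|t|) ->
    \int[mu]_(t in A) p t * expR r <= \int[mu]_t (expR `|t| * p t).
  move=> mA At.
  have iA : mu.-integrable A (EFin \o p) by exact: ipS.
  rewrite -RintegralZr//.
  apply: (@le_trans _ _ (\int[mu]_(t in A) (expR `|t| * p t))).
    apply: le_Rintegral => //.
    - exact: integrableRZr.
    - exact: mE.
    - by move=> t /At rt; rewrite mulrC ler_wpM2r ?(ltW (p0 _))// ler_expR.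
  rewrite /Rintegral fine_le//.
  - by apply: integrable_fin_num => //; exact: mE.
  - exact: integrable_fin_num.
  - apply: ge0_subset_integral => //.
    + exact: measurable_int iE.
    + by move=> t _; rewrite lee_fin mulr_ge0// ?expR_ge0// ltW.
rewrite onem_cumul; split; apply: sub => //= t; rewrite in_itv/=.
- by rewrite andbT => /ltW st; rewrite (le_trans st)// ler_norm.
- by move=> ts; rewrite -normrN (le_trans _ (ler_norm _))// lerN2.
Qed.

End cumulative_distribution.

(** * The Gaussian logarithmic Sobolev inequality on the real line *)

Section standard_gaussian_density.
Context {R : realType}.
Notation mu := (@lebesgue_measure R).

Let g : R -> R := normal_pdf 0 1.

Lemma normal_pdf01E (x : R) :
  normal_pdf 0 1 x = normal_peak 1 * expR (- (x ^+ 2 / 2)).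
Proof.
rewrite normal_pdfE ?oner_neq0// /normal_fun subr0 expr1n mulNr.
by rewrite -[1 *+ 2]/(2%:R).
Qed.

Lemma normal_peak1_gt0 : 0 < normal_peak (1 : R).
Proof. by rewrite normal_peak_gt0 ?oner_neq0. Qed.

Lemma normal_pdf01_gt0 (x : R) : 0 < normal_pdf 0 1 x.
Proof. by rewrite normal_pdf01E mulr_gt0 ?normal_peak1_gt0 ?expR_gt0. Qed.

Lemma ln_normal_pdf01 (x : R) :
  ln (normal_pdf 0 1 x) = ln (normal_peak 1) - x ^+ 2 / 2.
Proof.
by rewrite normal_pdf01E lnM ?posrE ?normal_peak1_gt0 ?expR_gt0// expRK.
Qed.

Lemma continuous_normal_pdf01 : continuous (normal_pdf 0 1 : R -> R).
Proof. by apply: continuous_normal_pdf; rewrite oner_neq0. Qed.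

Lemma Rintegral_normal_pdf01 : \int[mu]_x normal_pdf 0 1 x = 1.
Proof. by rewrite /Rintegral integral_normal_pdf. Qed.

Lemma integrable_expR_norm_normal_pdf01 :
  mu.-integrable setT (EFin \o (fun t => expR `|t| * normal_pdf 0 1 t)).
Proof.
apply: (@integrable_dominated _ _ _ mu _
    (fun t => normal_peak 1 * expR (9 / 8) * expR (- (`|t| / 2)))).
- apply: measurable_funM; last exact: measurable_normal_pdf.
  by apply: measurableT_comp => //; exact: measurable_normr.
- move=> t; rewrite ger0_norm; last first.
    by rewrite mulr_ge0 ?expR_ge0// ltW// normal_pdf01_gt0.
  rewrite normal_pdf01E mulrCA -mulrA ler_wpM2l ?normal_peak_ge0//.
  rewrite -!expRD ler_expR -real_normK ?num_real//.
  by have := sqr_ge0 (`|t| - 3 / 2); nra.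
- by apply: integrableRZl => //; exact: integrable_expRN_norm.
Qed.

End standard_gaussian_density.

Section log_sobolev_line.
Context {R : realType}.
Notation mu := (@lebesgue_measure R).
Notation gamma := (normal_pdf 0 1 : R -> R).
Notation lnc := (ln (normal_peak 1) : R).

(** For the function exp (- w) of mass J, which need not be 1: half its Fisher
    information, plus J times lnc - 1, minus its entropy. It vanishes for the
    standard Gaussian. *)
Definition deficit1 (w dw : R -> R) : R :=
  \int[mu]_x ((dw x ^+ 2 / 2 + w x) * expR (- w x)) +
  (lnc - 1) * \int[mu]_x expR (- w x) +
  (\int[mu]_x expR (- w x)) * ln (\int[mu]_x expR (- w x)).

Variables w dw : R -> R.
Variables A b : R.
Hypothesis cdw : continuous dw.
Hypothesis dwE : forall x : R, is_derive x 1 w (dw x).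
Hypothesis dwA : forall x, `|dw x| <= A * (1 + `|x|).
Hypothesis wb : forall x, `|x| - b <= w x.

Let cw : continuous w.
Proof. by move=> x; exact: is_derive1_continuous (dwE x). Qed.

Let g x := expR (- w x).
Let J := \int[mu]_x g x.

Let cg : continuous g. Proof. exact: continuous_expRN. Qed.
Let g0 x : 0 < g x. Proof. exact: expR_gt0. Qed.

Let ig : mu.-integrable setT (EFin \o g).
Proof.
apply: (@integrable_dominated _ _ _ mu _ (fun x => expR b * expR (- (`|x| / 2)))).
- exact: continuous_measurable_fun.
- by move=> x; rewrite ger0_norm ?(ltW (g0 x))//; exact: expRN_dominated.
- by apply: integrableRZl => //; exact: integrable_expRN_norm.
Qed.

Let J0 : 0 < J.
Proof.
rewrite lt_neqAle Rintegral_ge0 ?andbT; last by move=> x _; exact: ltW.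
apply/eqP => /esym J0.
have := Rintegral_eq0_ae ig (fun x => ltW (g0 x)) J0.
move=> /(ae_eq0_continuous cg)/(_ 0) h.
by have := g0 0; rewrite h ltxx.
Qed.

Let iwg : mu.-integrable setT (EFin \o (fun x => w x * g x)).
Proof.
apply: (@integrable_dominated _ _ _ mu _
   (fun x => expR b * (2 + `|b|) * expR (- (`|x| / 2)))).
- apply: continuous_measurable_fun => x.
  exact: (continuousM (@cw x) (@cg x)).
- move=> x; rewrite normrM (ger0_norm (ltW (g0 x))).
  exact: normM_expRN_dominated.
- by apply: integrableRZl => //; exact: integrable_expRN_norm.
Qed.

Let idwg : mu.-integrable setT (EFin \o (fun x => dw x ^+ 2 * g x)).
Proof.
apply: (@integrable_dominated _ _ _ mu _
   (fun x => A ^+ 2 * 16 * expR b * expR (- (`|x| / 2)))).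
- apply: continuous_measurable_fun => x.
  exact: (continuousM (continuousM (@cdw x) (@cdw x)) (@cg x)).
- move=> x; rewrite (ger0_norm (mulr_ge0 (sqr_ge0 _) (ltW (g0 x)))).
  exact: sqrM_expRN_dominated.
- exact: (integrableRZl _ measurableT integrable_expRN_norm).
Qed.

Let E x := g x * (dw x ^+ 2 / 2 + w x + (ln J + lnc - 1)).

Let cE : continuous E.
Proof.
move=> x; apply: (continuousM (@cg x)); apply: (@continuousD _ _ _
    (fun x => dw x ^+ 2 / 2 + w x) (cst _)); last exact: cst_continuous.
apply: (@continuousD _ _ _ (fun x => dw x ^+ 2 / 2) w); last exact: cw.
exact: (continuousM (continuousM (@cdw x) (@cdw x)) (@cst_continuous _ _ _ _)).
Qed.

Let EE : E = fun x => 2^-1 * (dw x ^+ 2 * g x) + w x * g x + (ln J + lnc - 1) * g x.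
Proof. by apply/funext => x; rewrite /E; ring. Qed.

Let iE1 : mu.-integrable setT (EFin \o (fun x => 2^-1 * (dw x ^+ 2 * g x) + w x * g x)).
Proof. exact: integrableRD measurableT (integrableRZl _ measurableT idwg) iwg. Qed.

Let iE : mu.-integrable setT (EFin \o E).
Proof. rewrite EE; exact: integrableRD measurableT iE1 (integrableRZl _ measurableT ig). Qed.

Let IE : \int[mu]_x E x = deficit1 w dw.
Proof.
rewrite EE RintegralD//; last exact: integrableRZl _ measurableT ig.
rewrite RintegralZl// -/J /deficit1 -[\int[mu]_x expR (- w x)]/J.
rewrite -[RHS]addrA; congr +%R; last by ring.
by apply: eq_Rintegral => x _; rewrite -/(g x); ring.
Qed.

Let quad_mulg_cvg0 (F : set_system R) (C : R) (q : R -> R) : Filter F ->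
  expR (- (`|x| / 2)) @[x --> F] --> (0 : R) ->
  (forall x, `|q x| <= C * (1 + `|x|) ^+ 2) -> q x * g x @[x --> F] --> (0 : R).
Proof.
move=> FF eF qC.
have CeF : (C * 16 * expR b) * expR (- (`|x| / 2)) @[x --> F] --> (0 : R).
  by rewrite -(mulr0 (C * 16 * expR b)); apply: cvgM => //; exact: cvg_cst.
apply/norm_cvg0P; apply: (@squeeze_cvgr _ _ _ _ (fun=> 0)
    (fun x => (C * 16 * expR b) * expR (- (`|x| / 2)))) => //; last exact: cvg_cst.
near=> x; rewrite normr_ge0 /= normrM (ger0_norm (ltW (g0 x))).
have nx := normr_ge0 x.
have h1 : `|q x| <= C * 16 * expR (`|x| / 2).
  have C0 : 0 <= C.
    have := le_trans (normr_ge0 _) (qC x).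
    by rewrite pmulr_lge0// exprn_gt0//; lra.
  by apply: (le_trans (qC x)); rewrite -mulrA ler_wpM2l// sqr1D_le_expR.
have h2 : g x <= expR b * expR (- `|x|) by rewrite -expRD ler_expR; have := wb x; lra.
apply: (le_trans (ler_pM (normr_ge0 _) (ltW (g0 x)) h1 h2)).
rewrite (_ : - (`|x| / 2) = `|x| / 2 + - `|x|); last lra.
by rewrite expRD le_eqVlt; apply/orP; left; apply/eqP; ring.
Unshelve. all: by end_near. Qed.

(** Here w - k is half the square of w', and E is the opposite of the derivative of
    w' exp (- w), so that its integral is zero. *)
Lemma deficit1_gaussian a k : (forall x, w x = (x - a) ^+ 2 / 2 + k) ->
  deficit1 w dw = 0.
Proof.
move=> wE.
have dwxE x : dw x = x - a.
  have d1 : is_derive x 1 w (x - a).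
    rewrite (_ : w = fun x => (x - a) ^+ 2 / 2 + k); last exact/funext.
    by apply: is_derive_eq; rewrite /GRing.scale/=; field.
  by rewrite -(@derive_val _ _ _ _ _ _ _ (dwE x)) derive_val.
have peak0 := @normal_peak1_gt0 R.
have JE : J = expR (- k) * (normal_peak 1)^-1.
  transitivity (expR (- k) * (normal_peak 1)^-1 * \int[mu]_x normal_pdf a 1 x); last first.
    by rewrite /Rintegral integral_normal_pdf mulr1.
  rewrite -RintegralZl//; last exact: integrable_normal_pdf.
  apply: eq_Rintegral => x _; rewrite normal_pdfE ?oner_neq0//.
  rewrite -(mulrA (expR _)) mulKf ?gt_eqF//.
  rewrite /g wE /normal_fun -expRD; congr expR.
  by rewrite expr1n -[1 *+ 2]/(2%:R); field.
have lnJ : ln J = - k - lnc.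
  rewrite JE lnM; [by rewrite expRK lnV|by rewrite posrE expR_gt0|by rewrite posrE invr_gt0].
have dwquad x : `|dw x| <= `|A| * (1 + `|x|) ^+ 2.
  apply: (le_trans (dwA x)); rewrite (le_trans (ler_norm _))// normrM ler_wpM2l//.
  by rewrite ger0_norm; have := normr_ge0 x; nra.
rewrite -IE.
have [||||||_ <-] := @integral_null_flux R (fun=> 0) E (fun x => dw x * g x) _ cE.
- by move=> x; exact: cst_continuous.
- by [].
- exact: iE.
- move=> x; have dg : is_derive x 1 g (- dw x * g x).
    have := @is_derive1_comp _ expR (fun y => - w y) x _ _ (is_derive_expR (- w x))
      (is_deriveN (dwE x)).
    by rewrite mulrC.
  have ddw : is_derive x 1 dw 1.
    rewrite (_ : dw = fun x => x - a); last exact/funext.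
    by apply: is_derive_eq; rewrite subr0.
  apply: is_derive_eq (is_deriveM ddw dg) _.
  by rewrite /GRing.scale/= /E wE lnJ !dwxE; field.
- exact: quad_mulg_cvg0 cvg_expRN_norm_pinfty dwquad.
- exact: quad_mulg_cvg0 cvg_expRN_norm_ninfty dwquad.
- by rewrite Rintegral_cst// mul0r.
Qed.

Let h x := J^-1 * g x.
Let H := cumul h.
Let Phi := cumul gamma.

Let ch : continuous h.
Proof. move=> x; exact: (continuousM (@cst_continuous _ _ _ _) (@cg x)). Qed.
Let h0 x : 0 < h x. Proof. by rewrite mulr_gt0 ?invr_gt0. Qed.
Let ih : mu.-integrable setT (EFin \o h). Proof. exact: integrableRZl _ measurableT ig. Qed.
Let h1 : \int[mu]_x h x = 1.
Proof. by rewrite RintegralZl// mulVf// gt_eqF. Qed.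

Let igam := @integrable_normal_pdf R 0 1.

Let dPhi (x : R) : is_derive x 1 Phi (gamma x).
Proof. exact: (is_derive_cumul continuous_normal_pdf01 igam). Qed.

Let cPhi : continuous Phi.
Proof. by move=> x; exact: is_derive1_continuous (dPhi x). Qed.

Let dH (x : R) : is_derive x 1 H (h x).
Proof. exact: (is_derive_cumul ch ih). Qed.

Let exT x : exists s, Phi s = H x.
Proof.
apply: (cumul_surj continuous_normal_pdf01 normal_pdf01_gt0 igam Rintegral_normal_pdf01).
by rewrite (cumul_gt0 ch h0 ih) (cumul_lt1 ch h0 ih h1).
Qed.

(** The monotone map that carries the probability density h to the standard
    Gaussian density. *)
Let T x := xget 0 [set s | Phi s = H x].

Let PhiT x : Phi (T x) = H x.
Proof. by rewrite /T; case: xgetP => //= nex; have [s /nex] := exT x. Qed.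

Let Phi_inj : injective Phi.
Proof. exact: (cumul_inj continuous_normal_pdf01 normal_pdf01_gt0 igam). Qed.

Let dT (x : R) : is_derive x 1 T (h x / gamma (T x)).
Proof.
pose Psi q := xget 0 [set s | Phi s = q].
have PsiK : cancel Phi Psi.
  by move=> s; apply: Phi_inj; rewrite /Psi; case: xgetP => //= /(_ s).
have dPsi : is_derive (H x) 1 Psi (gamma (T x))^-1.
  rewrite -PhiT; apply: (@is_derive_inverse _ Phi Psi).
  - by near=> s; exact: PsiK.
  - by near=> s; exact: cPhi.
  - exact: dPhi.
  - by rewrite gt_eqF// normal_pdf01_gt0.
have -> : T = Psi \o H by [].
have := is_derive1_comp dPsi (dH x).
by rewrite mulrC.
Unshelve. all: by end_near. Qed.

Let cT : continuous T.
Proof. by move=> x; exact: is_derive1_continuous (dT x). Qed.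

Let dT0 x : 0 < h x / gamma (T x).
Proof. by rewrite divr_gt0// normal_pdf01_gt0. Qed.

(** T' = h / gamma (T) by the change of variables, so that both terms are
    nonnegative, the second one because ln s <= s - 1. *)
Let D x := g x * ((dw x - T x) ^+ 2 / 2 + (h x / gamma (T x) - 1 - ln (h x / gamma (T x)))).

Let D0 x : 0 <= D x.
Proof.
rewrite mulr_ge0 ?(ltW (g0 x))// addr_ge0 ?subr1_ln_ge0//.
by rewrite divr_ge0// sqr_ge0.
Qed.

Let cD : continuous D.
Proof.
have cTp : continuous (fun x => h x / gamma (T x)).
  move=> x; apply: (continuousM (@ch x)).
  apply: (@continuousV _ _ (gamma \o T)); first by rewrite gt_eqF// normal_pdf01_gt0.
  apply: continuous_comp; first exact: cT.
  exact: continuous_normal_pdf01.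
move=> x; apply: (continuousM (@cg x)).
apply: (@continuousD _ _ _ (fun x => (dw x - T x) ^+ 2 / 2)
   (fun x => h x / gamma (T x) - 1 - ln (h x / gamma (T x)))).
  have c1 := continuousB (@cdw x) (@cT x).
  exact: (continuousM (continuousM c1 c1) (@cst_continuous _ _ _ _)).
apply: (@continuousB _ _ _ (fun x => h x / gamma (T x) - 1)
  (fun x => ln (h x / gamma (T x)))).
  exact: (continuousB (cTp x) (@cst_continuous _ _ _ _)).
apply: (@continuous_comp _ _ _ (fun x => h x / gamma (T x)) (@ln R)); first exact: cTp.
exact: continuous_ln.
Qed.

(** The transport equation expresses ln T' through w and T^2 / 2; the terms in w
    and T^2 then cancel, and what remains is an exact derivative. *)
Let dTg (x : R) : is_derive x 1 (fun x => T x * g x) (D x - E x).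
Proof.
have dg : is_derive x 1 g (- dw x * g x).
  have := @is_derive1_comp _ expR (fun y => - w y) x _ _ (is_derive_expR (- w x))
    (is_deriveN (dwE x)).
  by rewrite mulrC.
apply: is_derive_eq (is_deriveM (dT x) dg) _.
rewrite /GRing.scale/= /D /E.
have -> : ln (h x / gamma (T x)) = - ln J - w x - (lnc - T x ^+ 2 / 2).
  rewrite ln_div ?posrE ?normal_pdf01_gt0// ln_normal_pdf01 /h.
  by rewrite lnM ?posrE ?invr_gt0// lnV ?posrE// expRK.
by move: (h x / _) => q; field.
Qed.

Let K := \int[mu]_t (expR `|t| * gamma t).

Let wub x y : `|y - x| <= 1 -> w y <= `|w 0| + `|A| * (2 + `|x|) ^+ 2.
Proof.
move=> xy.
have yx : `|y| <= 1 + `|x|.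
  by rewrite -[y](subrK x) (le_trans (ler_normD _ _))// lerD2r.
have bnd (s : R) : `|s| <= `|y| -> `|dw s| <= `|A| * (2 + `|x|).
  move=> sy; apply: (le_trans (dwA s)); rewrite (le_trans (ler_norm _))// normrM.
  by rewrite ler_wpM2l// ger0_norm ?addr_ge0//; lra.
suff : `|w y - w 0| <= `|A| * (2 + `|x|) * `|y|.
  move=> h'; have := ler_norm (w 0); have := ler_norm (w y - w 0).
  suff : `|A| * (2 + `|x|) * `|y| <= `|A| * (2 + `|x|) ^+ 2 by lra.
  rewrite expr2 mulrA ler_wpM2l ?mulr_ge0 ?addr_ge0//; lra.
have mvt a c : a < c -> `|a| <= `|y| -> `|c| <= `|y| -> 
    `|w c - w a| <= `|A| * (2 + `|x|) * (c - a).
  move=> ac ay cy; have [|z] := @MVT R w dw a c ac (fun z _ => dwE z).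
    exact: continuous_subspaceT.
  rewrite in_itv/= => /andP[az zc] ->.
  rewrite normrM (ger0_norm (_ : 0 <= c - a)); last by lra.
  rewrite ler_wpM2r//; first by lra.
  apply: bnd; move: ay cy; rewrite !ler_norml => /andP[? ?] /andP[? ?].
  by apply/andP; split; lra.
have [y0|y0|->] := ltgtP y 0.
- have := mvt _ _ y0 (lexx _); rewrite normr0 normr_ge0 => /(_ isT).
  by rewrite distrC (ltr0_norm y0) sub0r.
- have := mvt _ _ y0; rewrite normr0 normr_ge0 => /(_ isT (lexx _)).
  by rewrite (gtr0_norm y0) subr0.
- by rewrite subrr normr0 mulr_ge0 ?mulr_ge0 ?addr_ge0.
Qed.

Let Q (x : R) : R := `|w 0| + `|A| * (2 + `|x|) ^+ 2.

Let tail_lb x (a c : R) : c = a + 1 -> (forall t, t \in `]a, c] -> `|t - x| <= 1) ->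
  J^-1 * expR (- Q x) <= \int[mu]_(t in `]a, c]) h t.
Proof.
move=> ca near_x.
have mac : measurable [set` `]a, c]] by exact: measurable_itv.
have -> : J^-1 * expR (- Q x) = \int[mu]_(t in `]a, c]) (J^-1 * expR (- Q x)).
  rewrite Rintegral_cst// [X in fine X](_ : _ = 1%:E) ?mulr1//.
  apply: (etrans (lebesgue_measure_itv `]a, c])).
  by rewrite /= lte_fin ca ltrDl ltr01 -EFinD/= addrAC subrr add0r.
apply: le_Rintegral => //.
- apply: (@integrableS _ _ _ mu `[a, c]).
  + exact: measurable_itv.
  + by [].
  + by apply: subset_itvr; rewrite bnd_simp.
  + by apply: continuous_integrable_segment => t; exact: cst_continuous.
- by apply: integrableS ih.
- move=> t /near_x tx; rewrite ler_wpM2l ?invr_ge0 ?(ltW J0)// ler_expR lerN2.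
  exact: wub.
Qed.

(** By Chernoff's bound the Gaussian tails beyond T x are at most K exp (- |T x|),
    whereas the corresponding tails of h are at least of the order of exp (- Q x),
    as w grows at most quadratically. Hence T grows at most quadratically as well,
    and T exp (- w) vanishes at infinity. *)
Let Tub x : `|T x| <= ln (J * K) + Q x.
Proof.
have [c1 c2] := cumul_tails normal_pdf01_gt0 igam Rintegral_normal_pdf01
  integrable_expR_norm_normal_pdf01 (T x).
have J'0 : 0 < J^-1 by rewrite invr_gt0.
have k1 : J^-1 * expR (- Q x) <= 1 - H x.
  apply: (@le_trans _ _ (H (x + 1) - H x)).
    rewrite (cumulB ih); last by rewrite lerDl.
    apply: tail_lb => // t; rewrite in_itv/= => /andP[xt tx].
    by rewrite ger0_norm; lra.
  by rewrite lerD2r (cumul_le1 h0 ih h1).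
have k2 : J^-1 * expR (- Q x) <= H x.
  apply: (@le_trans _ _ (H x - H (x - 1))).
    rewrite (cumulB ih); last by rewrite lerBlDr lerDl.
    apply: tail_lb => [|t]; first by rewrite subrK.
    by rewrite in_itv/= => /andP[xt tx]; rewrite ler0_norm; lra.
  by rewrite lerBlDr lerDl (cumul_ge0 h0).
have K0 : 0 < K.
  apply: lt_le_trans c1; rewrite mulr_gt0 ?expR_gt0//.
  by rewrite -/Phi PhiT; apply: lt_le_trans k1; rewrite mulr_gt0 ?expR_gt0.
have fin (s q : R) : J^-1 * expR (- Q x) <= q -> q * expR s <= K -> s <= ln (J * K) + Q x.
  move=> qle sle.
  have : J^-1 * expR (- Q x) * expR s <= K.
    by apply: le_trans sle; rewrite ler_wpM2r ?expR_ge0.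
  rewrite -mulrA ler_pdivrMl// -expRD => le1.
  suff : ln (expR (- Q x + s)) <= ln (J * K) by rewrite expRK; lra.
  by rewrite ler_ln ?posrE ?expR_gt0 ?mulr_gt0.
rewrite ler_norml; apply/andP; split.
  by have := fin (- T x) _ k2; rewrite -PhiT => /(_ c2); lra.
by apply: fin k1 _; rewrite -PhiT.
Qed.

Let ID : mu.-integrable setT (EFin \o D) /\ \int[mu]_x D x = deficit1 w dw.
Proof.
have Tquad x : `|T x| <= (`|ln (J * K)| + `|w 0| + 4 * `|A|) * (1 + `|x|) ^+ 2.
  have nx := normr_ge0 x; apply: (le_trans (Tub x)); rewrite /Q.
  have a1 : (2 + `|x|) ^+ 2 <= 4 * (1 + `|x|) ^+ 2 by nra.
  have a2 : `|A| * (2 + `|x|) ^+ 2 <= `|A| * (4 * (1 + `|x|) ^+ 2).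
    by rewrite ler_wpM2l.
  have := normr_ge0 (ln (J * K)); have := normr_ge0 (w 0); have := ler_norm (ln (J * K)).
  nra.
rewrite -IE; apply: (@integral_null_flux _ D E (fun x => T x * g x)) => //.
- exact: quad_mulg_cvg0 cvg_expRN_norm_pinfty Tquad.
- exact: quad_mulg_cvg0 cvg_expRN_norm_ninfty Tquad.
Qed.

Lemma deficit1_ge0 : 0 <= deficit1 w dw.
Proof. by rewrite -ID.2; apply: Rintegral_ge0 => x _. Qed.

(** The continuous integrand D vanishes identically, which forces w' = T and
    T' = 1. *)
Lemma deficit1_eq0 : deficit1 w dw = 0 ->
  exists a k, forall x, w x = (x - a) ^+ 2 / 2 + k.
Proof.
case: ID => iD <- /(Rintegral_eq0_ae iD D0)/(ae_eq0_continuous cD) Dx0.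
have Dx x : dw x = T x /\ h x / gamma (T x) = 1.
  have /eqP := Dx0 x; rewrite mulf_eq0 gt_eqF//= paddr_eq0; last 2 first.
    by rewrite divr_ge0 ?sqr_ge0.
    exact: subr1_ln_ge0.
  rewrite mulf_eq0 invr_eq0 pnatr_eq0 orbF sqrf_eq0 subr_eq0 => /andP[/eqP -> /eqP].
  by move=> /(subr1_ln_eq0 (dT0 x)).
exists (- T 0), (w 0 - T 0 ^+ 2 / 2) => x.
have TE y : T y = y + T 0.
  have : T y - y = T 0 - 0.
    apply: (@is_derive_0_is_cst _ (fun z => T z - z)) => z.
    have := dT z; rewrite (Dx z).2 => dTz.
    by apply: is_derive_eq (is_deriveB dTz (is_derive_id z 1)) _; rewrite subrr.
  lra.
have : w x - (x + T 0) ^+ 2 / 2 = w 0 - (0 + T 0) ^+ 2 / 2.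
  apply: (@is_derive_0_is_cst _ (fun z => w z - (z + T 0) ^+ 2 / 2)) => z.
  have := dwE z; rewrite (Dx z).1 TE => dwz.
  by apply: is_derive_eq; rewrite /GRing.scale/=; field.
rewrite opprK; lra.
Qed.

End log_sobolev_line.

(** * Marginals and subadditivity of the entropy *)

Section marginals.
Context {d1 d2 : measure_display} {X : measurableType d1} {Y : measurableType d2}.
Context {R : realType}.
Variable m1 : {sigma_finite_measure set X -> \bar R}.
Variable m2 : {sigma_finite_measure set Y -> \bar R}.

Lemma integrable_fubini_G (f : X * Y -> \bar R) :
  (m1 \x m2)%E.-integrable setT f -> m2.-integrable setT (fubini_G m1 f).
Proof.
move=> fi; have mf := measurable_int _ fi.
apply/integrableP; split; first exact: (measurable_fubini_G fi).
have /(integrable21ltyP m1 m2 mf).1 := fi; apply: le_lt_trans.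
apply: ge0_le_integral => //.
- exact: (measurableT_comp _ (measurable_fubini_G fi)).
- apply: (measurable_fun_fubini_tonelli_G (abse \o f)) => //=.
  exact: measurableT_comp.
- move=> y _; apply: le_abse_integral => //.
  exact: measurableT_comp.
Qed.

(** Slices are integrable at every point, and not merely almost everywhere, so that
    the marginal is a real-valued function. *)
Lemma integrable_marginal2 (f : X * Y -> R) :
  (m1 \x m2)%E.-integrable setT (EFin \o f) ->
  (forall y, m1.-integrable setT (EFin \o (fun x => f (x, y)))) ->
  m2.-integrable setT (EFin \o (fun y => \int[m1]_x f (x, y))) /\
  \int[m2]_y \int[m1]_x f (x, y) = \int[(m1 \x m2)%E]_z f z.
Proof.
move=> fi fy.
have fG : EFin \o (fun y => \int[m1]_x f (x, y)) = fubini_G m1 (EFin \o f).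
  by apply/funext => y /=; rewrite -Rintegral_EFin//.
split; first by rewrite fG; exact: integrable_fubini_G.
rewrite /Rintegral; congr fine.
have := integral21_prod_meas1 fi => <-.
by apply: eq_integral => y _; rewrite -fG.
Qed.

Lemma integrable_marginal1 (f : X * Y -> R) :
  (m1 \x m2)%E.-integrable setT (EFin \o f) ->
  (forall x, m2.-integrable setT (EFin \o (fun y => f (x, y)))) ->
  m1.-integrable setT (EFin \o (fun x => \int[m2]_y f (x, y))) /\
  \int[m1]_x \int[m2]_y f (x, y) = \int[(m1 \x m2)%E]_z f z.
Proof.
move=> fi fx.
have fF : EFin \o (fun x => \int[m2]_y f (x, y)) = fubini_F m2 (EFin \o f).
  by apply/funext => x /=; rewrite -Rintegral_EFin//.
split; first by rewrite fF; exact: integrable_fubini_F.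
rewrite /Rintegral; congr fine.
have := integral12_prod_meas1 fi => <-.
by apply: eq_integral => x _; rewrite -fF.
Qed.

(** By Tonelli's theorem, integrability against a weight that depends on one
    variable can be read off from the marginal in that variable. *)
Lemma integrable_weighted2 (f : X * Y -> R) (a : Y -> R) :
  measurable_fun setT f -> (forall z, 0 <= f z) -> measurable_fun setT a ->
  (forall y, m1.-integrable setT (EFin \o (fun x => f (x, y)))) ->
  m2.-integrable setT (EFin \o (fun y => a y * \int[m1]_x f (x, y))) ->
  (m1 \x m2)%E.-integrable setT (EFin \o (fun z => a z.2 * f z)) /\
  \int[(m1 \x m2)%E]_z (a z.2 * f z) = \int[m2]_y (a y * \int[m1]_x f (x, y)).
Proof.
move=> mf f0 ma fy aF.
have maf : measurable_fun setT (fun z : X * Y => a z.2 * f z).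
  by apply: measurable_funM => //; exact: measurableT_comp.
have afi : (m1 \x m2)%E.-integrable setT (EFin \o (fun z => a z.2 * f z)).
  apply/integrable21ltyP; first exact/measurable_EFinP.
  case/integrableP : aF => _; apply: le_lt_trans; rewrite le_eqVlt; apply/orP; left.
  apply/eqP; apply: eq_integral => y _ /=.
  rewrite normrM (ger0_norm (Rintegral_ge0 _ (fun x _ => f0 (x, y)))).
  rewrite EFinM -Rintegral_EFin// -integralZl//; last exact: fy.
  by apply: eq_integral => x _; rewrite normrM (ger0_norm (f0 _)) EFinM.
split=> //.
have [|_ <-] := integrable_marginal2 afi.
  by move=> y; exact: (integrableRZl (a y) measurableT (fy y)).
by apply: eq_Rintegral => y _; rewrite -RintegralZl//; exact: fy.
Qed.

Lemma integrable_weighted1 (f : X * Y -> R) (a : X -> R) :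
  measurable_fun setT f -> (forall z, 0 <= f z) -> measurable_fun setT a ->
  (forall x, m2.-integrable setT (EFin \o (fun y => f (x, y)))) ->
  m1.-integrable setT (EFin \o (fun x => a x * \int[m2]_y f (x, y))) ->
  (m1 \x m2)%E.-integrable setT (EFin \o (fun z => a z.1 * f z)) /\
  \int[(m1 \x m2)%E]_z (a z.1 * f z) = \int[m1]_x (a x * \int[m2]_y f (x, y)).
Proof.
move=> mf f0 ma fx aF.
have maf : measurable_fun setT (fun z : X * Y => a z.1 * f z).
  by apply: measurable_funM => //; exact: measurableT_comp.
have afi : (m1 \x m2)%E.-integrable setT (EFin \o (fun z => a z.1 * f z)).
  apply/integrable12ltyP; first exact/measurable_EFinP.
  case/integrableP : aF => _; apply: le_lt_trans; rewrite le_eqVlt; apply/orP; left.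
  apply/eqP; apply: eq_integral => x _ /=.
  rewrite normrM (ger0_norm (Rintegral_ge0 _ (fun y _ => f0 (x, y)))).
  rewrite EFinM -Rintegral_EFin// -integralZl//; last exact: fx.
  by apply: eq_integral => y _; rewrite normrM (ger0_norm (f0 _)) EFinM.
split=> //.
have [|_ <-] := integrable_marginal1 afi.
  by move=> x; exact: (integrableRZl (a x) measurableT (fx x)).
by apply: eq_Rintegral => x _; rewrite -RintegralZl//; exact: fx.
Qed.

Lemma ae_ae_eq0 (h : X * Y -> R) : measurable_fun setT h -> (forall z, 0 <= h z) ->
  (\int[(m1 \x m2)%E]_z (h z)%:E = 0)%E ->
  {ae m2, forall y, {ae m1, forall x, h (x, y) = 0}}.
Proof.
move=> mh h0.
have mhE : measurable_fun setT (EFin \o h) by exact/measurable_EFinP.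
have h0E z : (0 <= (EFin \o h) z)%E by rewrite lee_fin.
rewrite fubini_tonelli2// => I0.
have : (\int[m2]_y `|fubini_G m1 (EFin \o h) y| = 0)%E.
  rewrite -[RHS]I0; apply: eq_integral => y _.
  by rewrite gee0_abs//; apply: integral_ge0.
move/(ae_eq_integral_abs m2 measurableT (measurable_fun_fubini_tonelli_G _ mhE h0E)).
apply: filterS => y /(_ I) I1.
have mhy : measurable_fun setT (fun x => (h (x, y))%:E).
  by apply/measurable_EFinP; exact: measurableT_comp.
have : (\int[m1]_x `|(h (x, y))%:E| = 0)%E.
  rewrite -[RHS]I1; apply: eq_integral => x _.
  by rewrite gee0_abs// lee_fin.
move/(ae_eq_integral_abs m1 measurableT mhy).
by apply: filterS => x /(_ I) [].
Qed.

End marginals.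

Section entropy_subadditivity.
Context {d1 d2 : measure_display} {X : measurableType d1} {Y : measurableType d2}.
Context {R : realType}.
Variable m1 : {sigma_finite_measure set X -> \bar R}.
Variable m2 : {sigma_finite_measure set Y -> \bar R}.
Notation m := (m1 \x m2)%E.

Variable f : X * Y -> R.
Let F y := \int[m1]_x f (x, y).
Let G x := \int[m2]_y f (x, y).
Let J := \int[m]_z f z.

(** The integrand of the relative entropy of f with respect to the product of its
    marginals, normalised to the same mass; it is expanded into terms that are
    integrable one by one. *)
Definition entropy_gap (z : X * Y) : R :=
  f z * ln (f z) + ln J * f z - ln (F z.2) * f z - ln (G z.1) * f z - f z
  + F z.2 * G z.1 / J.

Hypothesis f0 : forall z, 0 < f z.
Hypothesis F0 : forall y, 0 < F y.
Hypothesis G0 : forall x, 0 < G x.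
Hypothesis J0 : 0 < J.

Let entropy_gapE z : entropy_gap z =
  f z * (F z.2 * G z.1 / (J * f z) - 1 - ln (F z.2 * G z.1 / (J * f z))).
Proof.
have FG0 : 0 < F z.2 * G z.1 by rewrite mulr_gt0.
rewrite ln_div ?posrE ?mulr_gt0// !lnM ?posrE// /entropy_gap.
have fz : f z != 0 by rewrite gt_eqF.
have Jz : J != 0 by rewrite gt_eqF.
move: fz Jz; move: (ln _) (ln _) (ln _) (ln _) => a b c e fz Jz.
by field; apply/andP.
Qed.

Lemma entropy_gap_ge0 z : 0 <= entropy_gap z.
Proof.
rewrite entropy_gapE mulr_ge0 ?(ltW (f0 z))// subr1_ln_ge0//.
by rewrite divr_gt0 ?mulr_gt0.
Qed.

Lemma entropy_gap_eq0 z : entropy_gap z = 0 <-> f z * J = F z.2 * G z.1.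
Proof.
have t0 : 0 < F z.2 * G z.1 / (J * f z) by rewrite divr_gt0 ?mulr_gt0.
have Jf0 : J * f z != 0 by rewrite gt_eqF ?mulr_gt0.
rewrite entropy_gapE; split=> [/eqP|fJ].
  rewrite mulf_eq0 gt_eqF//= => /eqP/(subr1_ln_eq0 t0) t1.
  by rewrite mulrC -[LHS]mul1r -t1 divfK.
have -> : F z.2 * G z.1 / (J * f z) = 1 by rewrite -fJ mulrC (mulrC (f z)) mulVf.
by rewrite ln1 !subrr mulr0.
Qed.

Hypothesis mf : measurable_fun setT f.
Hypothesis fi : m.-integrable setT (EFin \o f).
Hypothesis flnf : m.-integrable setT (EFin \o (fun z => f z * ln (f z))).
Hypothesis fy : forall y, m1.-integrable setT (EFin \o (fun x => f (x, y))).
Hypothesis fx : forall x, m2.-integrable setT (EFin \o (fun y => f (x, y))).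
Hypothesis FlnF : m2.-integrable setT (EFin \o (fun y => F y * ln (F y))).
Hypothesis GlnG : m1.-integrable setT (EFin \o (fun x => G x * ln (G x))).

(** The cross terms integrate to the entropies of the marginals, and the last two
    terms, both of integral J, cancel. *)
Lemma entropy_subadditive :
  m.-integrable setT (EFin \o entropy_gap) /\
  \int[m]_z entropy_gap z = \int[m]_z (f z * ln (f z)) + J * ln J
    - \int[m2]_y (F y * ln (F y)) - \int[m1]_x (G x * ln (G x)).
Proof.
have f_ge0 z : 0 <= f z by exact: ltW.
have [iF IF] := integrable_marginal2 fi fy.
have [iG IG] := integrable_marginal1 fi fx.
have mF : measurable_fun setT F by exact/measurable_EFinP/(measurable_int _ iF).
have mG : measurable_fun setT G by exact/measurable_EFinP/(measurable_int _ iG).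
have [||iFf IFf] := @integrable_weighted2 _ _ _ _ _ m1 m2 f (fun y => ln (F y)) mf f_ge0 _ fy.
- exact: measurableT_comp.
- by apply: eq_integrable FlnF => // y _ /=; rewrite mulrC.
have [||iGf IGf] := @integrable_weighted1 _ _ _ _ _ m1 m2 f (fun x => ln (G x)) mf f_ge0 _ fx.
- exact: measurableT_comp.
- by apply: eq_integrable GlnG => // x _ /=; rewrite mulrC.
have [|||||iFG IFG] := @integrable_weighted2 _ _ _ _ _ m1 m2 (fun z => G z.1) (fun y => F y / J).
- exact: measurableT_comp.
- by move=> z; exact: ltW.
- exact: measurable_funM.
- by move=> y; exact: iG.
- apply: eq_integrable iF => // y _ /=; congr EFin.
  by rewrite [X in _ = _ * X](_ : _ = J); [rewrite divfK// gt_eqF|exact: IG].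
have {}IFG : \int[m]_z (F z.2 / J * G z.1) = J.
  rewrite IFG -[RHS]IF; apply: eq_Rintegral => y _.
  by rewrite [X in _ * X](_ : _ = J); [rewrite divfK// gt_eqF|exact: IG].
have {}IFf : \int[m]_z (ln (F z.2) * f z) = \int[m2]_y (F y * ln (F y)).
  by rewrite IFf; apply: eq_Rintegral => y _; rewrite mulrC.
have {}IGf : \int[m]_z (ln (G z.1) * f z) = \int[m1]_x (G x * ln (G x)).
  by rewrite IGf; apply: eq_Rintegral => x _; rewrite mulrC.
have mT := @measurableT _ (X * Y)%type.
have i1 := integrableRD mT flnf (integrableRZl (ln J) mT fi).
have i2 := integrableRB mT i1 iFf.
have i3 := integrableRB mT i2 iGf.
have i4 := integrableRB mT i3 fi.
have i5 := integrableRD mT i4 iFG.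
have gE : entropy_gap = fun z => f z * ln (f z) + ln J * f z - ln (F z.2) * f z
   - ln (G z.1) * f z - f z + F z.2 / J * G z.1.
  by apply/funext => z; rewrite /entropy_gap mulrAC.
rewrite gE; split=> //.
rewrite RintegralD// RintegralB// RintegralB// RintegralB// RintegralD//; last exact: integrableRZl.
by rewrite RintegralZl// IFG IFf IGf -/J; ring.
Qed.

End entropy_subadditivity.

(** * Rows of real numbers as tuples *)

Lemma continuous_bigsum {R : realType} (T : topologicalType) (I : Type) (s : seq I)
  (F : I -> T -> R) (x : T) : (forall i, {for x, continuous (F i)}) ->
  {for x, continuous (fun y => \sum_(i <- s) F i y)}.
Proof.
move=> cF; elim: s => [|i s ih].
  rewrite (_ : (fun _ => _) = cst 0); first exact: cst_continuous.
  by apply/funext => y; rewrite big_nil.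
rewrite (_ : (fun _ => _) = (fun y => F i y + \sum_(j <- s) F j y)).
  exact: continuousD (cF i) ih.
by apply/funext => y; rewrite big_cons.
Qed.

Section row_vectors.
Context {R : realType}.

Definition rv n (t : n.-tuple (measurableTypeR R)) : 'rV[R]_n := \row_i tnth t i.

Definition consv n (a : R) (x : 'rV[R]_n) : 'rV[R]_n.+1 :=
  \row_i oapp (x 0) a (unlift ord0 i).

(** Of the usual norms this is the one for which exp (- l1norm x / 2) is a product
    of functions of one coordinate. *)
Definition l1norm n (x : 'rV[R]_n) : R := \sum_i `|x 0 i|.

Lemma consv0 n a (x : 'rV[R]_n) : consv a x 0 ord0 = a.
Proof. by rewrite mxE unlift_none. Qed.

Lemma consvS n a (x : 'rV[R]_n) i : consv a x 0 (lift ord0 i) = x 0 i.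
Proof. by rewrite mxE liftK. Qed.

Lemma consv_eta n (x : 'rV[R]_n.+1) : x = consv (x 0 ord0) (\row_i x 0 (lift ord0 i)).
Proof.
apply/rowP => i; case: (unliftP ord0 i) => [j ->|->]; last by rewrite consv0.
by rewrite consvS mxE.
Qed.

Lemma rv_cons n (z : measurableTypeR R * n.-tuple (measurableTypeR R)) :
  rv (cons_pair z) = consv z.1 (rv z.2).
Proof.
apply/rowP => i; rewrite mxE; case: (unliftP ord0 i) => [j ->|->].
  by rewrite consvS mxE (tnth_nth 0) (tnth_nth 0).
by rewrite consv0 (tnth_nth 0).
Qed.

Lemma l1norm_ge0 n (x : 'rV[R]_n) : 0 <= l1norm x.
Proof. exact: sumr_ge0. Qed.

Lemma l1norm_cons n a (x : 'rV[R]_n) : l1norm (consv a x) = `|a| + l1norm x.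
Proof.
by rewrite /l1norm big_ord_recl consv0; congr (_ + _); apply: eq_bigr => i _; rewrite consvS.
Qed.

Lemma nbhs_rowP n (x : 'rV[R]_n) (P : set 'rV[R]_n) :
  nbhs x P <-> exists2 e : R, 0 < e & forall y : 'rV[R]_n, (forall i, `|x 0 i - y 0 i| < e) -> P y.
Proof.
split=> [/nbhs_ballP[e e0 xP]|[e e0 xP]].
  exists e => // y xy; apply: xP; split => // i j.
  by rewrite ord1; exact: xy.
apply/nbhs_ballP; exists e => // y [_ xy]; apply: xP => i; exact: (xy 0 i).
Qed.

Lemma continuous_consv n (a : R) : continuous (@consv n a).
Proof.
move=> x P /nbhs_rowP[e e0 xP]; apply/nbhs_rowP; exists e => // y xy.
apply: xP => i; case: (unliftP ord0 i) => [j ->|->]; first by rewrite !consvS.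
by rewrite !consv0 subrr normr0.
Qed.

Lemma continuous_consv_head n (x : 'rV[R]_n) : continuous (fun a : R => consv a x).
Proof.
move=> a P /nbhs_rowP[e e0 xP]; apply/nbhs_ballP; exists e => // b ab.
apply: xP => i; case: (unliftP ord0 i) => [j ->|->].
  by rewrite !consvS subrr normr0.
by rewrite !consv0; exact: ab.
Qed.

Lemma continuous_l1norm n : continuous (@l1norm n).
Proof.
move=> x; apply: (@continuous_bigsum R _ _ _ (fun i (y : 'rV[R]_n) => `|y 0 i|)) => i.
apply: (@continuous_comp _ _ _ (fun y : 'rV[R]_n => y 0 i) (fun z : R => `|z|)).
  exact: coord_continuous.
exact: norm_continuous.
Qed.

End row_vectors.

Section measurability.
Context {R : realType} {n : nat}.
Notation mtuple := (n.-tuple (measurableTypeR R)).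

Let cell (k : nat) (t : mtuple) : 'rV[int]_n := \row_i Num.floor (tnth t i * k.+1%:R).
Let corner (k : nat) (z : 'rV[int]_n) : 'rV[R]_n := \row_i ((z 0 i)%:~R / k.+1%:R).

Let measurable_cell k z : measurable [set t | cell k t = z].
Proof.
have -> : [set t | cell k t = z] = \bigcap_i ((@tnth n _)^~ i @^-1`
    [set` `[(z 0 i)%:~R / k.+1%:R, ((z 0 i) + 1)%:~R / k.+1%:R[ : interval R]).
  have floorE (t : mtuple) i : (Num.floor (tnth t i * k.+1%:R) = z 0 i) <->
      tnth t i \in `[(z 0 i)%:~R / k.+1%:R, ((z 0 i) + 1)%:~R / k.+1%:R[.
    rewrite in_itv/= ler_pdivrMr ?ltr_pdivlMr ?ltr0n//.
    split; first by move=> <-; rewrite floor_le_tmp floorD1_gt.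
    by move=> h; apply: floor_def.
  apply/seteqP; split=> t /=.
    by move=> tz i _ /=; apply/floorE; rewrite -tz mxE.
  by move=> tz; apply/rowP => i; rewrite mxE; apply/floorE; exact: (tz i).
apply: fin_bigcap_measurable => // i _.
rewrite -[X in measurable X]setTI; apply: measurable_tnth => //.
Qed.

(** A continuous function is the limit of its values at the corners of finer and
    finer cubical cells. These approximations take countably many values, each on a
    union of boxes, which is measurable for the product sigma-algebra. *)
Lemma continuous_measurable_rv (F : 'rV[R]_n -> R) : continuous F ->
  measurable_fun setT (fun t : mtuple => F (rv t)).
Proof.
move=> cF; apply: (@measurable_fun_cvg _ _ _ _ (fun k t => F (corner k (cell k t)))).
  move=> k _ B mB; rewrite setTI.
  have -> : (fun t => F (corner k (cell k t))) @^-1` B =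
      \bigcup_z (if F (corner k z) \in B then [set t | cell k t = z] else set0).
    apply/seteqP; split=> t /=.
      by move=> tB; exists (cell k t) => //; rewrite mem_set.
    by move=> [z _]; case: ifPn => [/set_mem zB /= ->|_ []].
  apply: countable_bigcupT_measurable; first exact: countableP.
  by move=> z; case: ifP => // _; exact: measurable_cell.
move=> t _; apply: cvg_comp; last exact: cF.
move=> P /nbhs_rowP[e e0 tP].
have [N _ hN] := near_infty_natSinv_lt (PosNum e0).
exists N => // k /= Nk; apply: tP => i; rewrite !mxE.
set x := tnth t i; have k0 : 0 < k.+1%:R :> R by rewrite ltr0n.
have : (Num.floor (x * k.+1%:R))%:~R / k.+1%:R <= x < ((Num.floor (x * k.+1%:R) + 1)%:~R / k.+1%:R).
  by rewrite ler_pdivrMr// ltr_pdivlMr// floor_le_tmp floorD1_gt.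
rewrite intrD mulrDl mul1r => /andP[h1 h2].
have aux (y z q : R) : z <= y -> y < z + q -> q < e -> `|y - z| < e.
  by move=> zy yz qe; rewrite ger0_norm; lra.
exact: aux h1 h2 (hN k Nk).
Qed.

End measurability.

(** * Integration of functions with exponential decay *)

Section decaying_functions.
Context {R : realType}.
Notation mR := (measurableTypeR R).
Notation L1 := (@lebesgue_measure R).
Notation L n := (@lebesgue_tuple R n).

Definition decay n (x : 'rV[R]_n) : R := expR (- (l1norm x / 2)).

Lemma decay_gt0 n (x : 'rV[R]_n) : 0 < decay x.
Proof. exact: expR_gt0. Qed.

Lemma decay_cons n a (x : 'rV[R]_n) : decay (consv a x) = expR (- (`|a| / 2)) * decay x.
Proof. by rewrite /decay -expRD l1norm_cons; congr expR; lra. Qed.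

Lemma decay_le1 n (x : 'rV[R]_n) : decay x <= 1.
Proof. by rewrite expR_le1 oppr_le0 divr_ge0// l1norm_ge0. Qed.

Lemma continuous_decay n : continuous (@decay n).
Proof.
move=> x; apply: (@continuous_comp _ _ _ (fun y : 'rV[R]_n => - (l1norm y / 2)) (@expR R)).
  apply: (@continuousN _ _ _ (fun y : 'rV[R]_n => l1norm y / 2)).
  exact: (continuousM (@continuous_l1norm R n x) (@cst_continuous _ _ _ _)).
exact: continuous_expR.
Qed.

Lemma measurable_decay n : measurable_fun setT (fun t => decay (@rv R n t)).
Proof. by apply: continuous_measurable_rv; exact: continuous_decay. Qed.

Lemma integrable_cons n (F : n.+1.-tuple mR -> R) : measurable_fun setT F ->
  (L1 \x L n)%E.-integrable setT (EFin \o (fun z => F (cons_pair z))) ->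
  (L n.+1).-integrable setT (EFin \o F) /\
  \int[L n.+1]_t F t = \int[(L1 \x L n)%E]_z F (cons_pair z).
Proof.
move=> mF iF; split.
  apply: (integrable_pushforward (@measurable_cons_pair R n) (f := EFin \o F)) => //.
  exact/measurable_EFinP.
rewrite /Rintegral; congr fine.
apply: (integral_pushforward (@measurable_cons_pair R n) (f := EFin \o F)) => //.
exact/measurable_EFinP.
Qed.

Lemma measurable_rv_prod n (F : 'rV[R]_n.+1 -> R) : continuous F ->
  measurable_fun setT (fun z : mR * n.-tuple mR => F (consv z.1 (rv z.2))).
Proof.
move=> cF; rewrite (_ : (fun _ => _) = (fun t => F (rv t)) \o (@cons_pair R n)).
  apply: measurableT_comp; first exact: continuous_measurable_rv.
  exact: measurable_cons_pair.
by apply/funext => z /=; rewrite rv_cons.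
Qed.

Lemma integrable_tuple0 (F : 0.-tuple mR -> R) :
  (L 0).-integrable setT (EFin \o F) /\ \int[L 0]_t F t = F [tuple].
Proof.
have -> : F = cst (F [tuple]) by apply/funext => t; rewrite (tuple0 t).
have T1 : L 0 setT = 1%E by exact: diracT.
split; last first.
  by rewrite Rintegral_cst// [X in fine X](_ : _ = 1%E) ?mulr1.
apply/integrableP; split; first exact/measurable_EFinP.
rewrite [X in (X < _)%E](_ : _ = `|F [tuple]|%:E * L 0 setT)%E.
  by rewrite T1 mule1 ltry.
by rewrite -integral_cst//.
Qed.

Lemma integrable_decay n :
  (L n).-integrable setT (EFin \o (fun t => decay (rv t))).
Proof.
elim: n => [|n ih]; first exact: (integrable_tuple0 _).1.
apply: (integrable_cons _ _).1.
  exact: measurable_decay.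
have [|||||] := @integrable_weighted2 _ _ _ _ _ L1 (L n)
    (fun z : mR * n.-tuple mR => expR (- (`|z.1| / 2))) (fun t => decay (rv t)).
- apply: (@measurableT_comp _ _ _ _ _ _ (fun a : mR => expR (- (`|a| / 2)))) => //.
  apply: continuous_measurable_fun; exact: continuous_expRN_norm.
- by move=> z; exact: expR_ge0.
- exact: measurable_decay.
- by move=> t; exact: integrable_expRN_norm.
- exact: (integrableRZr (\int[L1]_a expR (- (`|a| / 2))) measurableT ih).
- move=> h _; apply: eq_integrable h => // z _ /=.
  by rewrite rv_cons decay_cons mulrC.
Qed.

(** Decay at this rate is inherited by all slices, which are therefore integrable:
    Fubini's theorem can be applied at every point. *)
Definition decaying n (F : 'rV[R]_n -> R) : Prop :=
  continuous F /\ exists K, forall x, `|F x| <= K * decay x.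

Lemma decaying_integrable n (F : 'rV[R]_n -> R) : decaying F ->
  (L n).-integrable setT (EFin \o (fun t => F (rv t))).
Proof.
case=> cF [K FK]; apply: (@integrable_dominated _ _ _ _ _ (fun t => K * decay (rv t))).
- exact: continuous_measurable_rv.
- by move=> t; exact: FK.
- exact: (integrableRZl K measurableT (integrable_decay n)).
Qed.

Lemma decaying_slice2 n (F : 'rV[R]_n.+1 -> R) a : decaying F ->
  decaying (fun x => F (consv a x)).
Proof.
case=> cF [K FK]; split.
  by move=> x; apply: continuous_comp; [exact: continuous_consv|exact: cF].
exists K => x; have K0 : 0 <= K.
  by have := le_trans (normr_ge0 _) (FK 0); rewrite pmulr_lge0 ?decay_gt0.
by apply: (le_trans (FK _)); rewrite ler_wpM2l// decay_cons ler_piMl ?(ltW (decay_gt0 _))//.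
Qed.

Lemma continuous_slice1 n (F : 'rV[R]_n.+1 -> R) x : continuous F ->
  continuous (fun a => F (consv a x)).
Proof.
by move=> cF a; apply: continuous_comp; [exact: continuous_consv_head|exact: cF].
Qed.

Lemma decaying_slice1 n (F : 'rV[R]_n.+1 -> R) x : decaying F ->
  L1.-integrable setT (EFin \o (fun a => F (consv a x))).
Proof.
case=> cF [K FK].
apply: (@integrable_dominated _ _ _ L1 _ (fun a => K * decay x * expR (- (`|a| / 2)))).
- by apply: continuous_measurable_fun; exact: continuous_slice1.
- by move=> a; apply: (le_trans (FK _)); rewrite decay_cons mulrCA mulrC.
- exact: (integrableRZl _ measurableT integrable_expRN_norm).
Qed.

Lemma decaying_prod n (F : 'rV[R]_n.+1 -> R) : decaying F ->
  (L1 \x L n)%E.-integrable setT (EFin \o (fun z => F (consv z.1 (rv z.2)))) /\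
  \int[L n.+1]_t F (rv t) = \int[(L1 \x L n)%E]_z F (consv z.1 (rv z.2)).
Proof.
move=> dF; have [cF [K FK]] := dF.
have iF : (L1 \x L n)%E.-integrable setT (EFin \o (fun z => F (consv z.1 (rv z.2)))).
  apply: (@integrable_dominated _ _ _ (L1 \x L n)%E _ (fun z : mR * n.-tuple mR => K * decay (consv z.1 (rv z.2)))).
  - exact: measurable_rv_prod.
  - by move=> z; exact: FK.
  - apply: (integrableRZl K measurableT).
    have [|||||] := @integrable_weighted2 _ _ _ _ _ L1 (L n)
      (fun z : mR * n.-tuple mR => expR (- (`|z.1| / 2))) (fun t => decay (rv t)).
    + apply: (@measurableT_comp _ _ _ _ _ _ (fun a : mR => expR (- (`|a| / 2)))) => //.
      apply: continuous_measurable_fun; exact: continuous_expRN_norm.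
    + by move=> z; exact: expR_ge0.
    + exact: measurable_decay.
    + by move=> t; exact: integrable_expRN_norm.
    + exact: (integrableRZr (\int[L1]_a expR (- (`|a| / 2))) measurableT (integrable_decay n)).
    + move=> h _; apply: eq_integrable h => // z _ /=.
      by rewrite decay_cons mulrC.
split=> //; have [||_ ->] := @integrable_cons n (fun t => F (rv t)).
- exact: continuous_measurable_rv.
- by apply: eq_integrable iF => // z _ /=; rewrite rv_cons.
- by apply: eq_Rintegral => z _; rewrite rv_cons.
Qed.

Lemma decayingD n (F G : 'rV[R]_n -> R) : decaying F -> decaying G ->
  decaying (fun x => F x + G x).
Proof.
case=> cF [K FK] [cG [M GM]]; split.
  by move=> x; exact: (continuousD (cF x) (cG x)).
by exists (K + M) => x; rewrite (le_trans (ler_normD _ _))// mulrDl lerD.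
Qed.

Lemma decayingZ n (k : R) (F : 'rV[R]_n -> R) : decaying F ->
  decaying (fun x => k * F x).
Proof.
case=> cF [K FK]; split.
  by move=> x; exact: (continuousM (@cst_continuous _ _ _ _) (cF x)).
by exists (`|k| * K) => x; rewrite normrM -mulrA ler_wpM2l.
Qed.

Lemma decaying_sum n (I : Type) (s : seq I) (F : I -> 'rV[R]_n -> R) :
  (forall i, decaying (F i)) -> decaying (fun x => \sum_(i <- s) F i x).
Proof.
move=> dF; elim: s => [|i s ih].
  split; first by move=> x; apply: continuous_bigsum => i; have [cF _] := dF i; exact: cF.
  by exists 0 => x; rewrite big_nil normr0 mul0r.
rewrite (_ : (fun _ => _) = (fun y => F i y + \sum_(j <- s) F j y)).
  exact: decayingD.
by apply/funext => y; rewrite big_cons.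
Qed.

Lemma lebesgue_tupleT_neq0 n : (L n setT != 0)%E.
Proof.
elim: n => [|n ih].
  by rewrite [X in X != _](_ : _ = 1%E); [rewrite onee_eq0|exact: diracT].
rewrite [X in X != _](_ : _ = (L1 setT * L n setT)%E).
  rewrite mule_eq0 negb_or ih andbT.
  have := lebesgue_measure_itv (Interval -oo%O +oo%O : interval R); by rewrite set_itvE => ->.
have <- := @product_measure1E _ _ _ _ _ L1 (L n) _ _ measurableT measurableT.
by rewrite setXTT.
Qed.

Lemma Rintegral_gt0 d (T : measurableType d) (mu : {measure set T -> \bar R}) (f : T -> R) :
  mu setT != 0%E -> mu.-integrable setT (EFin \o f) -> (forall x, 0 < f x) ->
  0 < \int[mu]_x f x.
Proof.
move=> muT fi f0; rewrite lt_neqAle Rintegral_ge0 ?andbT; last by move=> x _; exact: ltW.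
apply/eqP => /esym If.
have [x fx] := ae_exists muT (Rintegral_eq0_ae fi (fun x => ltW (f0 x)) If).
by have := f0 x; rewrite fx ltxx.
Qed.

End decaying_functions.

(** * Potentials and their logarithmic Sobolev deficit *)

Section potentials.
Context {R : realType}.
Notation mR := (measurableTypeR R).
Notation L1 := (@lebesgue_measure R).
Notation L n := (@lebesgue_tuple R n).

Lemma consv_addS n a (x : 'rV[R]_n) (i : 'I_n) (s : R) :
  s *: delta_mx 0 (lift ord0 i) + consv a x = consv a (s *: delta_mx 0 i + x).
Proof.
apply/rowP => j; case: (unliftP ord0 j) => [k ->|->].
  by rewrite !mxE !liftK /= !mxE (inj_eq lift_inj).
by rewrite !mxE !unlift_none /= ?(negbTE (neq_lift _ _)) mulr0 add0r.
Qed.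

Lemma consv_add0 n a (x : 'rV[R]_n) (s : R) :
  s *: delta_mx 0 ord0 + consv a x = consv (s + a) x.
Proof.
apply/rowP => j; case: (unliftP ord0 j) => [k ->|->].
  by rewrite !mxE !liftK /= ?(negbTE (neq_lift _ _)) mulr0 add0r.
by rewrite !mxE !unlift_none /= mulr1.
Qed.

(** What the logarithmic Sobolev inequality asks of the exponent: partial
    derivatives p of linear growth make the Fisher information finite, and the
    lower bound makes exp (- w) integrable. All clauses are inherited by slices,
    which is what the induction on the dimension needs. *)
Record potential n (w : 'rV[R]_n -> R) (p : 'I_n -> 'rV[R]_n -> R) : Prop := {
  potential_cont : continuous w;
  potential_dcont : forall i, continuous (p i);
  potential_derive : forall i x, is_derive x (delta_mx 0 i) w (p i x);
  potential_growth : exists A, forall i x, `|p i x| <= A * (1 + l1norm x);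
  potential_coercive : exists b, forall x, l1norm x - b <= w x }.

Arguments potential_cont {n w p} _ _.
Arguments potential_dcont {n w p} _ _ _.

(** A directional derivative only depends on the restriction to a line; this
    carries derivatives back and forth between rows, their slices and the reals. *)
Lemma is_derive_transfer (V1 V2 : normedModType R) (f : V1 -> R) (g : V2 -> R)
    (x v : V1) (y u : V2) (l : R) :
  (forall s : R, f (s *: v + x) = g (s *: u + y)) ->
  is_derive x v f l -> is_derive y u g l.
Proof.
move=> fg [df fl].
have fg0 : f x = g y by have := fg 0; rewrite !scale0r !add0r.
have E : (fun h : R => h^-1 *: ((f \o shift x) (h *: v) - f x)) =
    (fun h : R => h^-1 *: ((g \o shift y) (h *: u) - g y)).
  by apply/funext => h; rewrite /= fg fg0.
split; first by rewrite /derivable -E.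
by rewrite -fl /derive -E.
Qed.

Lemma potential_slice2 n (w : 'rV[R]_n.+1 -> R) p a : potential w p ->
  potential (fun x => w (consv a x)) (fun i x => p (lift ord0 i) (consv a x)).
Proof.
case=> cw cp dw [A Ap] [b wb]; split.
- by move=> x; apply: continuous_comp; [exact: continuous_consv|exact: cw].
- by move=> i x; apply: continuous_comp; [exact: continuous_consv|exact: cp].
- move=> i x; apply: is_derive_transfer (dw (lift ord0 i) (consv a x)) => s.
  by rewrite consv_addS.
- exists (`|A| * (1 + `|a|)) => i x.
  apply: (le_trans (Ap _ _)); rewrite (le_trans (ler_norm _))// normrM -mulrA ler_wpM2l//.
  have := l1norm_ge0 x; have := normr_ge0 a; rewrite l1norm_cons => a0 x0.
  by rewrite ger0_norm; nra.
- exists b => x; apply: le_trans (wb _).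
  by rewrite l1norm_cons; have := normr_ge0 a; lra.
Qed.

Lemma potential_slice1 n (w : 'rV[R]_n.+1 -> R) p x : potential w p ->
  [/\ continuous (fun a => p ord0 (consv a x)),
     forall a : R, is_derive a 1 (fun a => w (consv a x)) (p ord0 (consv a x)),
     exists A, forall a, `|p ord0 (consv a x)| <= A * (1 + `|a|) &
     exists b, forall a, `|a| - b <= w (consv a x)].
Proof.
case=> cw cp dw [A Ap] [b wb]; split.
- by apply: continuous_slice1; exact: cp.
- move=> a; apply: is_derive_transfer (dw ord0 (consv a x)) => s.
  by rewrite consv_add0 /GRing.scale/= mulr1.
- exists (`|A| * (1 + l1norm x)) => a.
  apply: (le_trans (Ap _ _)); rewrite (le_trans (ler_norm _))// normrM -mulrA ler_wpM2l//.
  have := l1norm_ge0 x; have := normr_ge0 a; rewrite l1norm_cons => a0 x0.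
  by rewrite ger0_norm; nra.
- exists b => a; apply: le_trans (wb _).
  by rewrite l1norm_cons; have := l1norm_ge0 x; lra.
Qed.

Section integrands.
Variables (n : nat) (w : 'rV[R]_n -> R) (p : 'I_n -> 'rV[R]_n -> R).
Hypothesis wp : potential w p.

Let continuous_expRN_potential : continuous (fun x => expR (- w x)).
Proof.
move=> x; apply: (@continuous_comp _ _ _ (fun x => - w x) (@expR R)).
  exact: (continuousN (potential_cont wp x)).
exact: continuous_expR.
Qed.

Lemma decaying_exp : decaying (fun x => expR (- w x)).
Proof.
split=> //; have [b wb] := potential_coercive wp.
exists (expR b) => x; rewrite ger0_norm ?expR_ge0//.
exact: expRN_dominated (l1norm_ge0 x) (wb x).
Qed.

Lemma decaying_potential_exp : decaying (fun x => w x * expR (- w x)).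
Proof.
split.
  by move=> x; exact: (continuousM (potential_cont wp x) (@continuous_expRN_potential x)).
have [b wb] := potential_coercive wp.
exists (expR b * (2 + `|b|)) => x; rewrite normrM (ger0_norm (expR_ge0 _)).
exact: normM_expRN_dominated (l1norm_ge0 x) (wb x).
Qed.

Lemma decaying_sqr_exp i : decaying (fun x => p i x ^+ 2 * expR (- w x)).
Proof.
split.
  move=> x; apply: (continuousM _ (@continuous_expRN_potential x)).
  exact: (continuousM (potential_dcont wp i x) (potential_dcont wp i x)).
have [b wb] := potential_coercive wp; have [A pA] := potential_growth wp.
exists (A ^+ 2 * 16 * expR b) => x.
rewrite (ger0_norm (mulr_ge0 (sqr_ge0 _) (expR_ge0 _))).
exact: sqrM_expRN_dominated (l1norm_ge0 x) (wb x) (pA i x).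
Qed.

End integrands.

(** For f = exp (- w), the integrand of half the Fisher information minus f ln f. *)
Definition energy n (w : 'rV[R]_n -> R) (p : 'I_n -> 'rV[R]_n -> R) x : R :=
  ((\sum_i p i x ^+ 2) / 2 + w x) * expR (- w x).

Definition mass n (w : 'rV[R]_n -> R) : R := \int[L n]_t expR (- w (rv t)).

(** Half the Fisher information of exp (- w), plus n times the mass times
    ln (normal_peak 1) - 1, minus the entropy; this is [deficit1] when n = 1. *)
Definition deficit n (w : 'rV[R]_n -> R) (p : 'I_n -> 'rV[R]_n -> R) : R :=
  \int[L n]_t energy w p (rv t) + n%:R * (ln (normal_peak 1) - 1) * mass w
  + mass w * ln (mass w).

Lemma decaying_energy n w p : potential w p -> decaying (@energy n w p).
Proof.
move=> wp.
have -> : energy w p = fun x => 2^-1 * (\sum_i p i x ^+ 2 * expR (- w x)) + w x * expR (- w x).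
  by apply/funext => x; rewrite /energy -mulr_suml; ring.
apply: decayingD; last exact: decaying_potential_exp wp.
by apply: decayingZ; apply: decaying_sum => i; exact: decaying_sqr_exp wp i.
Qed.

Lemma mass_gt0 n w p : @potential n w p -> 0 < mass w.
Proof.
move=> wp; apply: Rintegral_gt0 => //.
- exact: lebesgue_tupleT_neq0.
- exact: decaying_integrable (decaying_exp wp).
- by move=> t; exact: expR_gt0.
Qed.

End potentials.

(** * Splitting the deficit along the first coordinate *)

(** As F is bounded, F ln F is at most a multiple of F. The lower bound - B will
    come from the nonnegativity of the deficits of the slices. *)
Lemma integrable_mulln_bounded d (T : measurableType d) (R : realType)
    (mu : {measure set T -> \bar R}) (F B : T -> R) (M : R) :
  (forall t, 0 < F t) -> (forall t, F t <= M) ->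
  (forall t, - B t <= F t * ln (F t)) ->
  mu.-integrable setT (EFin \o F) -> mu.-integrable setT (EFin \o B) ->
  mu.-integrable setT (EFin \o (fun t => F t * ln (F t))).
Proof.
move=> F0 FM FB iF iB.
have mF : measurable_fun setT F by exact/measurable_EFinP/(measurable_int _ iF).
apply: (@integrable_dominated _ _ _ _ _ (fun t => `|B t| + `|ln M| * F t)).
- by apply: measurable_funM => //; exact: measurableT_comp.
- move=> t; have Ft := F0 t; rewrite ler_norml; apply/andP; split.
    have := FB t; have := ler_norm (B t); have := mulr_ge0 (normr_ge0 (ln M)) (ltW Ft); lra.
  have lnFM : ln (F t) <= `|ln M|.
    apply: le_trans (ler_norm _); rewrite ler_ln ?posrE//.
    exact: lt_le_trans (FM t).
  by have := normr_ge0 (B t); nra.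
- exact: (integrableRD measurableT (integrable_norm iB) (integrableRZl _ measurableT iF)).
Qed.

Section deficit_step.
Context {R : realType}.
Notation mR := (measurableTypeR R).
Notation L1 := (@lebesgue_measure R).
Notation L n := (@lebesgue_tuple R n).
Notation lnc := (ln (normal_peak 1) : R).

Variables (n : nat) (w : 'rV[R]_n.+1 -> R) (p : 'I_n.+1 -> 'rV[R]_n.+1 -> R).
Hypothesis wp : potential w p.

Definition head_deficit (t : n.-tuple mR) : R :=
  deficit1 (fun a => w (consv a (rv t))) (fun a => p ord0 (consv a (rv t))).

Definition tail_deficit (a : R) : R :=
  deficit (fun x => w (consv a x)) (fun i x => p (lift ord0 i) (consv a x)).

Definition density (z : mR * n.-tuple mR) : R := expR (- w (consv z.1 (rv z.2))).

Definition product_gap := entropy_gap L1 (L n) density.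

Hypothesis tail_deficit_ge0 : forall a, 0 <= tail_deficit a.

Let m := (L1 \x L n)%E.
Let F t := \int[L1]_a density (a, t).
Let G a := \int[L n]_t density (a, t).
Let J := \int[m]_z density z.

Let f0 z : 0 < density z. Proof. exact: expR_gt0. Qed.

Let dexp := decaying_exp wp.
Let dwexp := decaying_potential_exp wp.

Let fi : m.-integrable setT (EFin \o density).
Proof. exact: (decaying_prod dexp).1. Qed.

Let massE : mass w = J.
Proof. exact: (decaying_prod dexp).2. Qed.

Let fy t : L1.-integrable setT (EFin \o (fun a => density (a, t))).
Proof. exact: (decaying_slice1 (rv t) dexp). Qed.

Let fx a : (L n).-integrable setT (EFin \o (fun t => density (a, t))).
Proof. exact: (decaying_integrable (decaying_slice2 a dexp)). Qed.

Let L1T : L1 setT != 0%E.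
Proof.
by have := lebesgue_measure_itv (Interval -oo%O +oo%O : interval R); rewrite set_itvE => ->.
Qed.

Let F0 t : 0 < F t.
Proof. by apply: Rintegral_gt0. Qed.

Let G0 a : 0 < G a.
Proof.
by apply: Rintegral_gt0; [exact: lebesgue_tupleT_neq0|exact: fx|move=> t; exact: f0].
Qed.

Let J0 : 0 < J. Proof. by rewrite -massE; exact: mass_gt0 wp. Qed.

Let mf : measurable_fun setT density.
Proof. by apply/measurable_EFinP; exact: (measurable_int _ fi). Qed.

Let E1 x := 2^-1 * (p ord0 x ^+ 2 * expR (- w x)) + w x * expR (- w x).
Let En x := 2^-1 * (\sum_(i < n) p (lift ord0 i) x ^+ 2 * expR (- w x)) + w x * expR (- w x).

Let dE1 : decaying E1.
Proof. apply: decayingD => //; apply: decayingZ; exact: decaying_sqr_exp wp _. Qed.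

Let dEn : decaying En.
Proof.
apply: decayingD => //; apply: decayingZ; apply: decaying_sum => i.
exact: decaying_sqr_exp wp _.
Qed.

Let head_deficitE t : head_deficit t =
  \int[L1]_a E1 (consv a (rv t)) + (lnc - 1) * F t + F t * ln (F t).
Proof.
rewrite /head_deficit /deficit1; congr (_ + _ + _).
by apply: eq_Rintegral => a _; rewrite /E1; ring.
Qed.

Let tail_deficitE a : tail_deficit a =
  \int[L n]_t En (consv a (rv t)) + n%:R * (lnc - 1) * G a + G a * ln (G a).
Proof.
rewrite /tail_deficit /deficit; congr (_ + _ + _).
by apply: eq_Rintegral => t _; rewrite /En /energy -mulr_suml; ring.
Qed.

Lemma head_deficit_ge0 t : 0 <= head_deficit t.
Proof.
have [cdw dw [A dwA] [b wb]] := potential_slice1 (rv t) wp.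
exact: deficit1_ge0 cdw dw dwA wb.
Qed.

Let iE1 := decaying_prod dE1.
Let iEn := decaying_prod dEn.

Let iE1y := integrable_marginal2 iE1.1 (fun t => decaying_slice1 (rv t) dE1).
Let iEnx := integrable_marginal1 iEn.1 (fun a => decaying_integrable (decaying_slice2 a dEn)).
Let iF := integrable_marginal2 fi fy.
Let iG := integrable_marginal1 fi fx.

Let K_decay : exists2 K, 0 <= K & forall x, expR (- w x) <= K * decay x.
Proof.
have [_ [K hK]] := dexp; exists K.
  by have := le_trans (normr_ge0 _) (hK 0); rewrite pmulr_lge0 ?decay_gt0.
by move=> x; have := hK x; rewrite ger0_norm ?expR_ge0.
Qed.

Let FM : exists M, forall t, F t <= M.
Proof.
have [K K0 hK] := K_decay.
exists (\int[L1]_a (K * expR (- (`|a| / 2)))) => t.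
apply: le_Rintegral => //.
- exact: (integrableRZl K measurableT integrable_expRN_norm).
- move=> a _; apply: (le_trans (hK _)); rewrite ler_wpM2l// decay_cons.
  by rewrite ler_piMr ?expR_ge0 ?decay_le1.
Qed.

Let GM : exists M, forall a, G a <= M.
Proof.
have [K K0 hK] := K_decay.
exists (\int[L n]_t (K * decay (rv t))) => a.
apply: le_Rintegral => //.
- exact: (integrableRZl K measurableT (integrable_decay n)).
- move=> t _; apply: (le_trans (hK _)); rewrite ler_wpM2l// decay_cons.
  by rewrite ler_piMl ?(ltW (decay_gt0 _))// expR_le1 oppr_le0 divr_ge0.
Qed.

Let FlnF : (L n).-integrable setT (EFin \o (fun t => F t * ln (F t))).
Proof.
have [M hM] := FM.
pose B t := \int[L1]_a E1 (consv a (rv t)) + (lnc - 1) * F t.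
apply: (@integrable_mulln_bounded _ _ _ _ F B M) => //.
- by move=> t; rewrite -subr_ge0 opprK addrC; have := head_deficit_ge0 t; rewrite head_deficitE.
- exact: iF.1.
- exact: (integrableRD measurableT iE1y.1 (integrableRZl _ measurableT iF.1)).
Qed.

Let GlnG : L1.-integrable setT (EFin \o (fun a => G a * ln (G a))).
Proof.
have [M hM] := GM.
pose B a := \int[L n]_t En (consv a (rv t)) + n%:R * (lnc - 1) * G a.
apply: (@integrable_mulln_bounded _ _ _ L1 G B M) => //.
- by move=> a; rewrite -subr_ge0 opprK addrC; have := tail_deficit_ge0 a; rewrite tail_deficitE.
- exact: iG.1.
- exact: (integrableRD measurableT iEnx.1 (integrableRZl _ measurableT iG.1)).
Qed.

Let iflnf : m.-integrable setT (EFin \o (fun z => density z * ln (density z))).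
Proof.
have dN := decayingZ (-1) dwexp.
apply: eq_integrable (decaying_prod dN).1 => // z _ /=.
by rewrite /density expRK; congr EFin; ring.
Qed.

Let gap := entropy_subadditive f0 G0 J0 mf fi iflnf fy fx FlnF GlnG.

Lemma integrable_head_deficit : (L n).-integrable setT (EFin \o head_deficit).
Proof.
rewrite (_ : head_deficit = fun t => \int[L1]_a E1 (consv a (rv t)) + (lnc - 1) * F t + F t * ln (F t)).
  exact: (integrableRD measurableT (integrableRD measurableT iE1y.1
    (integrableRZl _ measurableT iF.1)) FlnF).
by apply/funext => t; rewrite head_deficitE.
Qed.

Lemma integrable_tail_deficit : L1.-integrable setT (EFin \o tail_deficit).
Proof.
rewrite (_ : tail_deficit = fun a => \int[L n]_t En (consv a (rv t)) +
    n%:R * (lnc - 1) * G a + G a * ln (G a)).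
  exact: (integrableRD measurableT (integrableRD measurableT iEnx.1
    (integrableRZl _ measurableT iG.1)) GlnG).
by apply/funext => a; rewrite tail_deficitE.
Qed.

Lemma product_gap_ge0 z : 0 <= product_gap z.
Proof. exact: entropy_gap_ge0. Qed.

Lemma integrable_product_gap : m.-integrable setT (EFin \o product_gap).
Proof. exact: gap.1. Qed.

Lemma product_gap_eq0 z : product_gap z = 0 <-> density z * J = F z.2 * G z.1.
Proof. exact: entropy_gap_eq0. Qed.

Lemma product_gap_eq0_log z : product_gap z = 0 ->
  w (consv z.1 (rv z.2)) = ln J - ln (F z.2) - ln (G z.1).
Proof.
move=> /product_gap_eq0/(congr1 (@ln R)); rewrite !lnM ?posrE// /density expRK => h.
by rewrite -addrA -opprD -h opprD opprK addrCA subrr addr0.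
Qed.

Lemma product_gap_split (A : R -> R) (B : n.-tuple mR -> R) :
  (forall a t, density (a, t) = A a * B t) -> forall z, product_gap z = 0.
Proof.
move=> fAB z; apply/product_gap_eq0.
have B0 : B z.2 != 0.
  by apply/eqP => B0; have := f0 z; rewrite [z]surjective_pairing fAB B0 mulr0 ltxx.
have A0 : A z.1 != 0.
  by apply/eqP => A0; have := f0 z; rewrite [z]surjective_pairing fAB A0 mul0r ltxx.
have iB : (L n).-integrable setT (EFin \o B).
  apply: eq_integrable (integrableRZl (A z.1)^-1 measurableT (fx z.1)) => // t _ /=.
  by rewrite fAB mulKf.
have Gz : G z.1 = A z.1 * \int[L n]_t B t.
  by rewrite -RintegralZl//; apply: eq_Rintegral => t _; rewrite fAB.
have Ft t : F t = F z.2 / B z.2 * B t.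
  rewrite -mulrA -RintegralZr//.
  by apply: eq_Rintegral => a _; rewrite !fAB -mulrA mulVKf.
have JE : J = F z.2 / B z.2 * \int[L n]_t B t.
  by rewrite -RintegralZl// -[LHS]iF.2; apply: eq_Rintegral => t _; rewrite -Ft.
by rewrite [z in density z]surjective_pairing fAB JE Gz; field.
Qed.

(** The square of the gradient is split between the first coordinate and the other
    ones, and the entropies of the slices of both kinds, once integrated, add up to
    the entropy of exp (- w) plus the integral of the gap. *)
Lemma deficit_split : deficit w p =
  \int[L n]_t head_deficit t + \int[L1]_a tail_deficit a + \int[m]_z product_gap z.
Proof.
rewrite gap.2 /deficit massE.
have -> : \int[L n.+1]_t energy w p (rv t) =
    \int[m]_z E1 (consv z.1 (rv z.2)) + \int[m]_z En (consv z.1 (rv z.2)) +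
    \int[m]_z (density z * ln (density z)).
  rewrite (decaying_prod (decaying_energy wp)).2.
  rewrite -RintegralD//; [|exact: iE1.1|exact: iEn.1].
  rewrite -RintegralD//; last exact: (integrableRD measurableT iE1.1 iEn.1).
  apply: eq_Rintegral => z _; rewrite /density expRK /E1 /En /energy big_ord_recl.
  by rewrite -mulr_suml; ring.
have -> : \int[L n]_t head_deficit t = \int[L n]_t (\int[L1]_a E1 (consv a (rv t)) +
    (lnc - 1) * F t + F t * ln (F t)).
  by apply: eq_Rintegral => t _; rewrite head_deficitE.
have -> : \int[L1]_a tail_deficit a = \int[L1]_a (\int[L n]_t En (consv a (rv t)) +
    n%:R * (lnc - 1) * G a + G a * ln (G a)).
  by apply: eq_Rintegral => a _; rewrite tail_deficitE.
have iF' := integrableRZl (lnc - 1) measurableT iF.1.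
have iG' := integrableRZl (n%:R * (lnc - 1)) measurableT iG.1.
rewrite (RintegralD measurableT (integrableRD measurableT iE1y.1 iF') FlnF).
rewrite (RintegralD measurableT iE1y.1 iF') (RintegralZl _ measurableT iF.1).
rewrite (RintegralD measurableT (integrableRD measurableT iEnx.1 iG') GlnG).
rewrite (RintegralD measurableT iEnx.1 iG') (RintegralZl _ measurableT iG.1).
rewrite iE1y.2 iEnx.2 iF.2 iG.2 -/J -natr1.
by ring.
Qed.

End deficit_step.

(** * The Gaussian logarithmic Sobolev inequality in all dimensions *)

Lemma addr3_eq0 {R : realFieldType} (x y z : R) : 0 <= x -> 0 <= y -> 0 <= z ->
  x + y + z = 0 -> [/\ x = 0, y = 0 & z = 0].
Proof. by move=> ? ? ? ?; split; lra. Qed.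

Section log_sobolev.
Context {R : realType}.
Notation mR := (measurableTypeR R).
Notation L1 := (@lebesgue_measure R).
Notation L n := (@lebesgue_tuple R n).

Lemma rV0_eq (x y : 'rV[R]_0) : x = y.
Proof. by apply/rowP => -[]. Qed.

Lemma deficit0 (w : 'rV[R]_0 -> R) p : deficit w p = 0.
Proof.
rewrite /deficit /mass /energy (integrable_tuple0 _).2 (integrable_tuple0 _).2.
by rewrite big_ord0 expRK; ring.
Qed.

Theorem deficit_ge0 n (w : 'rV[R]_n -> R) p : potential w p -> 0 <= deficit w p.
Proof.
elim: n w p => [|n ih] w p wp; first by rewrite deficit0.
have tl a : 0 <= tail_deficit w p a by apply: ih; exact: potential_slice2.
rewrite (deficit_split wp tl) !addr_ge0//; apply: Rintegral_ge0 => // z _.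
- exact: head_deficit_ge0.
- exact: product_gap_ge0 wp z.
Qed.

Definition quadratic n (x0 : 'rV[R]_n) (k : R) (x : 'rV[R]_n) : R :=
  (\sum_i (x 0 i - x0 0 i) ^+ 2) / 2 + k.

Lemma quadratic_cons n a0 (x0 : 'rV[R]_n) k a x :
  quadratic (consv a0 x0) k (consv a x) = (a - a0) ^+ 2 / 2 + quadratic x0 k x.
Proof.
rewrite /quadratic big_ord_recl !consv0 mulrDl -addrA; congr (_ + (_ / _ + _)).
by apply: eq_bigr => i _; rewrite !consvS.
Qed.

Lemma quadratic_slice n (x0 : 'rV[R]_n.+1) k a x :
  quadratic x0 k (consv a x) =
  quadratic (\row_i x0 0 (lift ord0 i)) ((a - x0 0 ord0) ^+ 2 / 2 + k) x.
Proof. by rewrite {1}(consv_eta x0) quadratic_cons /quadratic addrCA. Qed.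

Lemma deficit_quadratic n (w : 'rV[R]_n -> R) p (x0 : 'rV[R]_n) (k : R) : potential w p ->
  w = quadratic x0 k -> deficit w p = 0.
Proof.
elim: n w p x0 k => [|n ih] w p x0 k wp wE; first by rewrite deficit0.
have tl0 a : tail_deficit w p a = 0.
  apply: (ih _ _ (\row_i x0 0 (lift ord0 i)) ((a - x0 0 ord0) ^+ 2 / 2 + k)).
    exact: potential_slice2.
  by apply/funext => x; rewrite wE quadratic_slice.
have tl a : 0 <= tail_deficit w p a by rewrite tl0.
have hd0 t : head_deficit w p t = 0.
  have [cdw dw [A dwA] [b wb]] := potential_slice1 (rv t) wp.
  apply: (deficit1_gaussian cdw dw dwA wb (a := x0 0 ord0)
    (k := quadratic (\row_i x0 0 (lift ord0 i)) k (rv t))) => a.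
  by rewrite wE {1}(consv_eta x0) quadratic_cons.
have gap0 := @product_gap_split _ _ _ _ wp
  (fun a => expR (- ((a - x0 0 ord0) ^+ 2 / 2)))
  (fun t => expR (- quadratic (\row_i x0 0 (lift ord0 i)) k (rv t))).
rewrite (deficit_split wp tl).
rewrite (@eq_Rintegral _ _ _ _ _ (cst 0)); last by move=> t _; exact: hd0.
rewrite (@eq_Rintegral _ _ _ L1 _ (cst 0)); last by move=> t _; exact: tl0.
rewrite (@eq_Rintegral _ _ _ (L1 \x L n)%E _ (cst 0)); last first.
  move=> z _; apply: gap0 => a t.
  by rewrite /density /= wE {1}(consv_eta x0) quadratic_cons opprD expRD.
by rewrite !Rintegral_cst// !mul0r !addr0.
Qed.

Lemma decaying_eq0 n (F : 'rV[R]_n -> R) : decaying F -> (forall x, 0 <= F x) ->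
  \int[L n]_t F (rv t) = 0 -> forall x, F x = 0.
Proof.
elim: n F => [|n ih] F dF F0.
  by rewrite (integrable_tuple0 _).2 => <- x; congr F; exact: rV0_eq.
have [iF ->] := decaying_prod dF.
have [iG <-] := integrable_marginal1 iF (fun a => decaying_integrable (decaying_slice2 a dF)).
move=> IG0.
have aeF := Rintegral_eq0_ae iG (fun a => Rintegral_ge0 _ (fun t _ => F0 _)) IG0.
move=> x; rewrite (consv_eta x); move: (\row_i _) (x 0 ord0) => y.
apply: ae_eq0_continuous; first by apply: continuous_slice1; case: dF.
apply: filterS aeF => a Ia.
exact: (ih (fun x => F (consv a x)) (decaying_slice2 a dF) (fun x => F0 _) Ia y).
Qed.

(** Truncating F at height 1 and multiplying by a decaying weight gives an
    integrable function with the same zeros. *)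
Lemma ae_eq0_continuous_rV n (F : 'rV[R]_n -> R) : continuous F ->
  {ae L n, forall t, F (rv t) = 0} -> forall x, F x = 0.
Proof.
move=> cF aeF; pose G x := Num.min `|F x| 1 * decay x.
have G0 x : 0 <= G x by rewrite mulr_ge0 ?(ltW (decay_gt0 _))// le_min normr_ge0 ler01.
have dG : decaying G.
  split.
    move=> x; apply: (continuousM _ (@continuous_decay R n x)).
    apply: (@continuous_min _ _ (fun x => `|F x|) (cst 1)); last exact: cst_continuous.
    apply: (@continuous_comp _ _ _ F (fun z : R => `|z|)); first exact: cF.
    exact: norm_continuous.
  exists 1 => x; rewrite ger0_norm// /G ler_wpM2r ?(ltW (decay_gt0 _))//.
have IG : \int[L n]_t G (rv t) = 0.
  have [mG _] := integrableP _ _ _ (decaying_integrable dG).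
  rewrite /Rintegral (@ae_eq_integral _ _ _ (L n) setT (cst 0%E)) ?integral0//.
  by apply: filterS aeF => t Ft _; rewrite /= /G Ft normr0 min_l// mul0r.
move=> x; have := decaying_eq0 dG G0 IG x.
move/eqP; rewrite mulf_eq0 (gt_eqF (decay_gt0 x)) orbF /Num.min.
by case: ifP => _ /eqP; [move/eqP; rewrite normr_eq0 => /eqP|move/eqP; rewrite oner_eq0].
Qed.

(** The three parts of the deficit vanish. By continuity the vanishing gap makes w
    the sum of a function of the first coordinate and a function of the other ones;
    these are determined by one slice of each kind, and slices of zero deficit are
    quadratic. *)
Theorem deficit_eq0 n (w : 'rV[R]_n -> R) p : potential w p -> deficit w p = 0 ->
  exists x0 k, w = quadratic x0 k.
Proof.
elim: n w p => [|n ih] w p wp.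
  move=> _; exists 0, (w 0); apply/funext => x.
  by rewrite /quadratic big_ord0 mul0r add0r; congr w; exact: rV0_eq.
have tl a : 0 <= tail_deficit w p a by apply: deficit_ge0; exact: potential_slice2.
have gap0 := product_gap_ge0 wp.
rewrite (deficit_split wp tl) => d0.
have h1 : 0 <= \int[L n]_t head_deficit w p t.
  by apply: Rintegral_ge0 => t _; exact: head_deficit_ge0.
have h2 : 0 <= \int[L1]_a tail_deficit w p a by exact: Rintegral_ge0.
have h3 : 0 <= \int[(L1 \x L n)%E]_z product_gap w z by apply: Rintegral_ge0.
have [e1 e2 e3] : [/\ \int[L n]_t head_deficit w p t = 0,
    \int[L1]_a tail_deficit w p a = 0 &
    \int[(L1 \x L n)%E]_z product_gap w z = 0] by exact: addr3_eq0.
have ae1 := Rintegral_eq0_ae (integrable_head_deficit wp) (head_deficit_ge0 wp) e1.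
have ae2 := Rintegral_eq0_ae (integrable_tail_deficit wp tl) tl e2.
have igap := integrable_product_gap wp tl.
have mgap : measurable_fun setT (product_gap w).
  by apply/measurable_EFinP; exact: (measurable_int _ igap).
have ae3 : {ae L n, forall t, {ae L1, forall a, product_gap w (a, t) = 0}}.
  by apply: ae_ae_eq0 => //; rewrite Rintegral_EFin// e3.
have L1T : L1 setT != 0%E.
  by have := lebesgue_measure_itv (Interval -oo%O +oo%O : interval R); rewrite set_itvE => ->.
(* The slice through t0 has zero deficit and almost everywhere zero gap: t0 is the
   base point of the splitting of w, and its slice is the summand that depends on
   the first coordinate. *)
have [t0 [hd0 sl0]] : exists t, head_deficit w p t = 0 /\
    {ae L1, forall a, product_gap w (a, t) = 0}.
  apply: (ae_exists (lebesgue_tupleT_neq0 n)).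
  by apply: filterS2 ae1 ae3 => t; split.
have [a0 tl0] := ae_exists L1T ae2.
have sep x a : w (consv a x) = w (consv a (rv t0)) + (w (consv a0 x) - w (consv a0 (rv t0))).
  have cw := potential_cont wp.
  pose D y := w (consv a y) - w (consv a (rv t0)) - (w (consv a0 y) - w (consv a0 (rv t0))).
  suff : D x = 0 by rewrite /D; clear ih; lra.
  move: x; apply: ae_eq0_continuous_rV.
    have cs b : continuous (fun y => w (consv b y)) := potential_cont (potential_slice2 b wp).
    move=> y; apply: (@continuousB _ _ _ (fun y => w (consv a y) - w (consv a (rv t0)))
       (fun y => w (consv a0 y) - w (consv a0 (rv t0)))).
      exact: (continuousB (cs a y) (@cst_continuous _ _ _ _)).
    exact: (continuousB (cs a0 y) (@cst_continuous _ _ _ _)).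
  apply: filterS ae3 => t slt.
  have [c hc] : exists c, forall a, w (consv a (rv t)) - w (consv a (rv t0)) - c = 0.
    pose F t := \int[L1]_a density w (a, t).
    exists (ln (F t0) - ln (F t)).
    apply: ae_eq0_continuous.
      move=> b; apply: (@continuousB _ _ _ (fun b => w (consv b (rv t)) - w (consv b (rv t0)))
         (cst _)); last exact: cst_continuous.
      have ch s : continuous (fun b => w (consv b (rv s))) by apply: continuous_slice1.
      exact: (continuousB (ch t b) (ch t0 b)).
    apply: filterS2 slt sl0 => b /(product_gap_eq0_log wp)/= -> /(product_gap_eq0_log wp)/= ->.
    by rewrite -/(F t) -/(F t0); ring.
  by have := hc a; have := hc a0; rewrite /D; clear ih; lra.
have [cdw dw [A dwA] [b wb]] := potential_slice1 (rv t0) wp.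
have [x00 [k1 head]] := deficit1_eq0 cdw dw dwA wb hd0.
have [x0' [k2 tail]] := ih _ _ (potential_slice2 a0 wp) tl0.
exists (consv x00 x0'), (k1 + k2 - w (consv a0 (rv t0))).
apply/funext => x; rewrite (consv_eta x); move: (\row_i _) (x 0 ord0) => y a.
rewrite quadratic_cons (sep y a) (head a).
have -> : w (consv a0 y) = quadratic x0' k2 y by rewrite -tail.
by rewrite /quadratic; clear ih; lra.
Qed.

End log_sobolev.

(** * Dot product and first-order expansions *)

Section dot_product.
Context {R : realType} {n : nat}.
Implicit Types x y v : 'rV[R]_n.

Lemma dotpE x y : dotp x y = \sum_i x 0 i * y 0 i.
Proof. by rewrite /dotp mxE; apply: eq_bigr => i _; rewrite mxE. Qed.

Lemma dotpC x y : dotp x y = dotp y x.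
Proof. by rewrite !dotpE; apply: eq_bigr => i _; rewrite mulrC. Qed.

Lemma dotpDl x y v : dotp (x + y) v = dotp x v + dotp y v.
Proof. by rewrite /dotp mulmxDl mxE. Qed.

Lemma dotpZl (a : R) x v : dotp (a *: x) v = a * dotp x v.
Proof. by rewrite /dotp -scalemxAl mxE. Qed.

Lemma dotpDr x y v : dotp v (x + y) = dotp v x + dotp v y.
Proof. by rewrite dotpC dotpDl !(dotpC v). Qed.

Lemma dotpZr (a : R) x v : dotp v (a *: x) = a * dotp v x.
Proof. by rewrite dotpC dotpZl dotpC. Qed.

Lemma dotpNl x v : dotp (- x) v = - dotp x v.
Proof. by rewrite -scaleN1r dotpZl mulN1r. Qed.

Lemma dotpNr x v : dotp v (- x) = - dotp v x.
Proof. by rewrite dotpC dotpNl dotpC. Qed.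

Lemma dotpBl x y v : dotp (x - y) v = dotp x v - dotp y v.
Proof. by rewrite dotpDl dotpNl. Qed.

Lemma dotpp_ge0 x : 0 <= dotp x x.
Proof. by rewrite dotpE; apply: sumr_ge0 => i _; rewrite -expr2 sqr_ge0. Qed.

Lemma enorm_sqr x : enorm x ^+ 2 = dotp x x.
Proof. by rewrite sqr_sqrtr// dotpp_ge0. Qed.

Lemma dotp_eq0 x : dotp x x = 0 -> x = 0.
Proof.
rewrite dotpE => /eqP; rewrite psumr_eq0; last by move=> i _; rewrite -expr2 sqr_ge0.
move=> /allP h; apply/rowP => i; rewrite mxE; apply/eqP.
by have := h i; rewrite mem_index_enum -expr2 sqrf_eq0 => /(_ isT).
Qed.

Lemma dotp_delta x i : dotp x (delta_mx 0 i) = x 0 i.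
Proof.
rewrite dotpE (bigD1 i)//= big1 ?addr0; first by rewrite mxE !eqxx mulr1.
by move=> j ji; rewrite mxE (negbTE ji) andbF mulr0.
Qed.

Lemma cauchy_schwarz x y : dotp x y ^+ 2 <= dotp x x * dotp y y.
Proof.
have h := dotpp_ge0 (dotp y y *: x - dotp x y *: y).
have E : dotp (dotp y y *: x - dotp x y *: y) (dotp y y *: x - dotp x y *: y) =
    dotp y y * (dotp x x * dotp y y - dotp x y ^+ 2).
  by rewrite dotpBl !dotpZl !(dotpC _ (_ - _)) !dotpBl !dotpZl (dotpC y x); ring.
rewrite E in h; have := dotpp_ge0 y; rewrite le_eqVlt => /predU1P[y0|y0].
  rewrite -y0 mulr0 (dotp_eq0 (esym y0)).
  by rewrite -(scale0r x) dotpZr mul0r expr2 mul0r.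
by move: h; rewrite pmulr_rge0// subr_ge0.
Qed.

Lemma dotp_le_enorm x y : `|dotp x y| <= enorm x * enorm y.
Proof.
rewrite -ler_sqr ?nnegrE ?mulr_ge0 ?sqrtr_ge0// real_normK ?num_real//.
by rewrite exprMn !enorm_sqr cauchy_schwarz.
Qed.

Lemma dotp_le_l1norm x y : `|dotp x y| <= l1norm x * l1norm y.
Proof.
rewrite dotpE /l1norm mulr_suml; apply: (le_trans (ler_norm_sum _ _ _)).
apply: ler_sum => i _; rewrite normrM ler_wpM2l//.
by rewrite (bigD1 i)//= lerDl sumr_ge0.
Qed.

Lemma coord_le_l1norm x i : `|x 0 i| <= l1norm x.
Proof. by rewrite /l1norm (bigD1 i)//= lerDl sumr_ge0. Qed.

Lemma coord_le_enorm x i : `|x 0 i| <= enorm x.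
Proof.
rewrite -ler_sqr ?nnegrE ?sqrtr_ge0// enorm_sqr real_normK ?num_real// dotpE.
rewrite (bigD1 i)//= -expr2 lerDl sumr_ge0// => j _; by rewrite -expr2 sqr_ge0.
Qed.

Lemma l1norm_le_enorm x : l1norm x <= n%:R * enorm x.
Proof.
apply: (@le_trans _ _ (\sum_(i < n) enorm x)).
  by apply: ler_sum => i _; exact: coord_le_enorm.
by rewrite sumr_const card_ord mulr_natl.
Qed.

Lemma l1normZ (a : R) x : l1norm (a *: x) = `|a| * l1norm x.
Proof.
by rewrite /l1norm mulr_sumr; apply: eq_bigr => i _; rewrite mxE normrM.
Qed.

Lemma l1norm_eq0 x : l1norm x = 0 -> x = 0.
Proof.
move=> x0; apply/rowP => i; rewrite mxE; apply/eqP.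
by rewrite -normr_le0 -x0 coord_le_l1norm.
Qed.

Lemma enorm_ge0 x : 0 <= enorm x.
Proof. exact: sqrtr_ge0. Qed.

Lemma continuous_dotp y : continuous (fun x => dotp x y).
Proof.
move=> x; rewrite (_ : (fun x => dotp x y) = fun x => \sum_i x 0 i * y 0 i); last first.
  by apply/funext => z; rewrite dotpE.
apply: (@continuous_bigsum R _ _ _ (fun i (x : 'rV[R]_n) => x 0 i * y 0 i)) => i.
exact: (continuousM (@coord_continuous R 1 n 0 i x) (@cst_continuous _ _ _ _)).
Qed.

End dot_product.

Section first_order.
Context {R : realType} {n : nat}.
Variables (w : 'rV[R]_n -> R) (p : 'I_n -> 'rV[R]_n -> R).
Hypothesis dw : forall i x, is_derive x (delta_mx 0 i) w (p i x).
Hypothesis cp : forall i, continuous (p i).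

Let mvt_coord i (y : 'rV[R]_n) (s : R) : exists2 th, `|th| <= `|s| &
  w (y + s *: delta_mx 0 i) - w y = s * p i (y + th *: delta_mx 0 i).
Proof.
pose g (r : R) := w (y + r *: delta_mx 0 i).
have dg (r : R) : is_derive r 1 g (p i (y + r *: delta_mx 0 i)).
  apply: is_derive_transfer (dw i (y + r *: delta_mx 0 i)) => q.
  by rewrite /g /GRing.scale/= mulr1 addrCA -scalerDl addrC.
have cg : continuous g by move=> r; exact: is_derive1_continuous (dg r).
have g0 : g 0 = w y by rewrite /g scale0r addr0.
rewrite -/(g s) -g0; have [s0|s0|->] := ltgtP s 0.
- have [c] := MVT s0 (fun r _ => dg r) (continuous_subspaceT cg).
  rewrite in_itv/= => /andP[sc c0] E; exists c.
    by rewrite !ltr0_norm// lerN2 ltW.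
  by rewrite -[LHS]opprB E sub0r mulrN opprK mulrC.
- have [c] := MVT s0 (fun r _ => dg r) (continuous_subspaceT cg).
  rewrite in_itv/= => /andP[c0 cs] E; exists c.
    by rewrite !gtr0_norm// ltW.
  by rewrite E subr0 mulrC.
- by exists 0; rewrite ?subrr ?mul0r.
Qed.

Let trunc (k : nat) (h : 'rV[R]_n) : 'rV[R]_n := \row_i (if (i < k)%N then h 0 i else 0).

Let truncS (i : 'I_n) h : trunc i.+1 h = trunc i h + h 0 i *: delta_mx 0 i.
Proof.
apply/rowP => j; rewrite !mxE eqxx /= ltnS leq_eqVlt.
have [->|ji] := eqVneq j i; first by rewrite eqxx ltnn mulr1 add0r.
by rewrite (inj_eq val_inj) (negbTE ji) mulr0 addr0.
Qed.

(** Changing the coordinates one at a time reduces the expansion to the mean value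
    theorem on the real line. *)
Lemma first_order_expansion (x : 'rV[R]_n) (e : R) : 0 < e -> exists2 d : R, 0 < d &
  forall h : 'rV[R]_n, (forall i, `|h 0 i| < d) ->
  `|w (x + h) - w x - \sum_i h 0 i * p i x| <= e * l1norm h.
Proof.
move=> e0.
have /nbhs_rowP[d d0 xd] : \forall y \near x, forall i, `|p i x - p i y| < e.
  apply: (@filter_forall _ _ (fun i (y : 'rV[R]_n) => `|p i x - p i y| < e) (nbhs x)) => i.
  by have /cvgrPdist_lt/(_ _ e0) := @cp i x.
exists d => // h hd.
have -> : w (x + h) - w x = \sum_(i < n) (w (x + trunc i.+1 h) - w (x + trunc i h)).
  have := @telescope_sumr _ 0 n (fun i => w (x + trunc i h)) (leq0n n).
  rewrite big_mkord => ->.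
  have -> : trunc n h = h by apply/rowP => i; rewrite mxE ltn_ord.
  by have -> : trunc 0 h = 0 by [apply/rowP => i; rewrite !mxE]; rewrite addr0.
rewrite -sumrB /l1norm mulr_sumr; apply: (le_trans (ler_norm_sum _ _ _)).
apply: ler_sum => i _; rewrite truncS addrA.
have [th ths ->] := mvt_coord i (x + trunc i h) (h 0 i).
rewrite -mulrBr normrM mulrC ler_wpM2r//.
rewrite distrC ltW//; apply: xd => j; rewrite !mxE eqxx /=.
rewrite -addrA opprD addrA subrr add0r normrN.
have [->|ji] := eqVneq j i; first by rewrite ltnn add0r mulr1 (le_lt_trans ths).
by rewrite mulr0 addr0; case: ifP => _; rewrite ?normr0.
Qed.

Lemma is_derive_direction (x v : 'rV[R]_n) : is_derive x v w (\sum_i v 0 i * p i x).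
Proof.
set l := \sum_i _.
have cvg_l : (fun h : R => h^-1 *: ((w \o shift x) (h *: v) - w x)) @ 0^' --> l.
  apply/cvgrPdist_le => e e0.
  pose e' := e / (l1norm v + 1).
  have e'0 : 0 < e' by rewrite divr_gt0// ltr_wpDl// l1norm_ge0.
  have [d d0 hd] := first_order_expansion x e'0.
  have d'0 : 0 < d / (l1norm v + 1) by rewrite divr_gt0// ltr_wpDl// l1norm_ge0.
  apply/nbhs_ballP; exists (d / (l1norm v + 1)) => //= s.
  rewrite /ball/= sub0r normrN => sd /= s0.
  have sn0 : 0 < `|s| by rewrite normr_gt0.
  have vn := l1norm_ge0 v.
  have := hd (s *: v) _; rewrite l1normZ.
  have -> : \sum_i (s *: v) 0 i * p i x = s * l.
    by rewrite mulr_sumr; apply: eq_bigr => i _; rewrite mxE mulrA.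
  move=> /(_ _) H.
  have {}H : `|w (x + s *: v) - w x - s * l| <= e' * (`|s| * l1norm v).
    apply: H => i; rewrite mxE normrM.
    apply: (@le_lt_trans _ _ (`|s| * (l1norm v + 1))).
      by rewrite ler_wpM2l//; have := coord_le_l1norm v i; lra.
    by move: sd; rewrite ltr_pdivlMr//; lra.
  rewrite /= (addrC _ x) /GRing.scale/= distrC.
  have -> : s^-1 * (w (x + s *: v) - w x) - l = s^-1 * (w (x + s *: v) - w x - s * l).
    by rewrite [RHS]mulrBr mulKf.
  rewrite normrM normfV ler_pdivrMl//; apply: (le_trans H).
  rewrite mulrCA ler_wpM2l// /e' -mulrA ler_piMr ?(ltW e0)//.
  by rewrite ler_pdivrMl ?mulr1//; lra.
by split; [apply/cvg_ex; exists l|exact: cvg_lim cvg_l].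
Qed.

End first_order.

(** * The gradient of a smooth convex function *)

Lemma taylor2_le {R : realType} (phi psi chi : R -> R) (M : R) :
  (forall s : R, is_derive s 1 phi (psi s)) ->
  (forall s : R, is_derive s 1 psi (chi s)) -> (forall s, chi s <= M) ->
  phi 1 <= phi 0 + psi 0 + M / 2.
Proof.
move=> dphi dpsi chiM.
have cpsi : continuous psi by move=> s; exact: is_derive1_continuous (dpsi s).
have psiM s : 0 < s -> psi s - psi 0 <= M * s.
  move=> s0; have [c _ ->] := MVT s0 (fun r _ => dpsi r) (continuous_subspaceT cpsi).
  by rewrite subr0 ler_wpM2r// ltW.
pose g s := phi s - (psi 0 * s + M / 2 * s ^+ 2).
have dg (s : R) : is_derive s 1 g (psi s - (psi 0 + M * s)).
  have d1 : is_derive s 1 (fun s => psi 0 * s + M / 2 * s ^+ 2) (psi 0 + M * s).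
    by apply: is_derive_eq; rewrite /GRing.scale/=; field.
  exact: is_deriveB (dphi s) d1.
have cg : continuous g by move=> s; exact: is_derive1_continuous (dg s).
have [c] := MVT ltr01 (fun r _ => dg r) (continuous_subspaceT cg).
rewrite in_itv/= => /andP[c0 c1]; rewrite /g subr0 mulr1 => E.
have := psiM c c0; rewrite expr1n expr0n/= in E; lra.
Qed.

Section smooth_convex.
Context {R : realType} {n : nat}.
Variable U : 'rV[R]_n -> R.
Hypothesis C2U : C2 U.

Notation qform A v := ((v *m A *m v^T) 0 0).

Lemma is_derive_partial i x : is_derive x (delta_mx 0 i) U (partial i U x).
Proof. by case: C2U => -[_ /(_ i)[dU _]] _; exact: derivableP. Qed.

Lemma continuous_partial i : continuous (partial i U).
Proof. by case: C2U => -[_ /(_ i)[_ cU]] _. Qed.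

Lemma is_derive_partial2 i j x :
  is_derive x (delta_mx 0 i) (partial j U) (partial i (partial j U) x).
Proof. by case: C2U => _ /(_ j)[_ /(_ i)[dU _]]; exact: derivableP. Qed.

Lemma continuous_partial2 i j : continuous (partial i (partial j U)).
Proof. by case: C2U => _ /(_ j)[_ /(_ i)[_ cU]]. Qed.

Lemma qformE (A : 'M[R]_n) (v : 'rV[R]_n) :
  qform A v = \sum_j v 0 j * \sum_i v 0 i * A i j.
Proof.
rewrite mxE; apply: eq_bigr => j _; rewrite !mxE mulrC; congr (_ * _).
Qed.

Lemma dotp_gradE v x : dotp v (grad U x) = \sum_i v 0 i * partial i U x.
Proof. by rewrite dotpE; apply: eq_bigr => i _; rewrite mxE. Qed.

Lemma is_derive_line x v (s : R) :
  is_derive s 1 (fun s => U (x + s *: v)) (dotp v (grad U (x + s *: v))).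
Proof.
rewrite dotp_gradE.
apply: is_derive_transfer (is_derive_direction is_derive_partial continuous_partial _ v) => q.
by rewrite /GRing.scale/= mulr1 addrCA -scalerDl addrC.
Qed.

Lemma is_derive_grad_line x v (s : R) :
  is_derive s 1 (fun s => dotp v (grad U (x + s *: v))) (qform (hessian U (x + s *: v)) v).
Proof.
have d j : is_derive s 1 (fun s : R => partial j U (x + s *: v))
    (\sum_i v 0 i * hessian U (x + s *: v) i j).
  under eq_bigr => i _ do rewrite mxE.
  apply: is_derive_transfer (is_derive_direction (is_derive_partial2 ^~ j)
    (continuous_partial2 ^~ j) _ v) => q.
  by rewrite /GRing.scale/= mulr1 addrCA -scalerDl addrC.
rewrite qformE.
have -> : (fun s : R => dotp v (grad U (x + s *: v))) =
    \sum_j (v 0 j *: (fun s : R => partial j U (x + s *: v))).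
  by apply/funext => r; rewrite dotp_gradE fct_sumE; apply: eq_bigr.
apply: is_derive_sum.
Qed.

Lemma semiconcave_upper_bound (C : R) (x v : 'rV[R]_n) :
  (forall x v : 'rV[R]_n, qform (hessian U x) v <= C * dotp v v) ->
  U (x + v) <= U x + dotp v (grad U x) + C / 2 * dotp v v.
Proof.
move=> HC; have := taylor2_le (is_derive_line x v) (is_derive_grad_line x v)
  (fun s => HC (x + s *: v) v).
by rewrite scale1r scale0r addr0; lra.
Qed.

Hypothesis HPD : forall x, positive_definite (hessian U x).

Let qform_ge0 (x v : 'rV[R]_n) : 0 <= qform (hessian U x) v.
Proof.
have [->|v0] := eqVneq v 0; first by rewrite mul0mx mul0mx mxE.
exact: ltW (HPD x v0).
Qed.

Lemma tangent_lower_bound (x v : 'rV[R]_n) : U x + dotp v (grad U x) <= U (x + v).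
Proof.
have := @taylor2_le R (fun s => - U (x + s *: v)) (fun s => - dotp v (grad U (x + s *: v)))
  (fun s => - qform (hessian U (x + s *: v)) v) 0 _ _ _.
rewrite scale1r scale0r addr0 mul0r addr0 => H.
suff : - U (x + v) <= - U x - dotp v (grad U x) by lra.
apply: H => s.
- exact: is_deriveN (is_derive_line x v s).
- exact: is_deriveN (is_derive_grad_line x v s).
- by rewrite oppr_le0.
Qed.

Lemma grad_monotone_line (x v : 'rV[R]_n) (s t : R) : s <= t ->
  dotp v (grad U (x + s *: v)) <= dotp v (grad U (x + t *: v)).
Proof.
rewrite le_eqVlt => /predU1P[->//|st].
have cg : continuous (fun s : R => dotp v (grad U (x + s *: v))).
  by move=> r; exact: is_derive1_continuous (is_derive_grad_line x v r).
have [c _ E] := MVT st (fun r _ => is_derive_grad_line x v r) (continuous_subspaceT cg).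
by rewrite -subr_ge0 E mulr_ge0// subr_ge0 ltW.
Qed.

Lemma grad_strict_monotone (x v : 'rV[R]_n) : v != 0 ->
  dotp v (grad U x) < dotp v (grad U (x + v)).
Proof.
move=> v0.
have cg : continuous (fun s : R => dotp v (grad U (x + s *: v))).
  by move=> r; exact: is_derive1_continuous (is_derive_grad_line x v r).
have [c _] := MVT ltr01 (fun r _ => is_derive_grad_line x v r) (continuous_subspaceT cg).
by rewrite scale1r scale0r addr0 -subr_gt0 => ->; rewrite subr0 mulr1; exact: HPD.
Qed.

Lemma grad_inj : injective (grad U).
Proof.
move=> x y xy; apply/eqP; apply: contrapT => /negP nxy.
have yx : y - x != 0 by rewrite subr_eq0 eq_sym.
by have := grad_strict_monotone x yx; rewrite addrCA subrr addr0 xy ltxx.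
Qed.

Hypothesis superlinear : forall B : R, exists M, forall x : 'rV[R]_n, M < enorm x -> B * enorm x <= U x.

(** Superlinear growth gives U minus the linear form of y a minimum, and the
    gradient of U is y there. *)
Lemma grad_surj (y : 'rV[R]_n) : exists x, grad U x = y.
Proof.
have cU : continuous U by case: C2U => -[].
pose V x := U x - dotp x y.
have cV : continuous V by move=> x; exact: (continuousB (cU x) (@continuous_dotp R n y x)).
have [M hM] := superlinear (enorm y + 1).
pose r := Num.max M `|V 0|.
(* n.+1 rather than n keeps the denominator positive in dimension 0 *)
have out x : r < l1norm x / n.+1%:R -> V 0 <= V x.
  move=> rx; have xr : r < enorm x.
    apply: (lt_le_trans rx); rewrite ler_pdivrMr ?ltr0n//.
    apply: (le_trans (l1norm_le_enorm x)); rewrite mulrC ler_wpM2l ?enorm_ge0//.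
    by rewrite ler_nat.
  have Mx : M < enorm x by apply: le_lt_trans xr; rewrite le_max lexx.
  have Vx : `|V 0| < enorm x by apply: le_lt_trans xr; rewrite le_max lexx orbT.
  have := hM x Mx; have := dotp_le_enorm x y; have := ler_norm (dotp x y).
  have := ler_norm (V 0); rewrite /V; nra.
pose K := [set x : 'rV[R]_n | l1norm x <= r * n.+1%:R].
have r0 : 0 <= r by rewrite le_max normr_ge0 orbT.
have K0 : K 0.
  by rewrite /K/= (_ : l1norm 0 = 0) ?mulr_ge0// /l1norm big1// => i _; rewrite mxE normr0.
have cK : compact K.
  apply: bounded_closed_compact.
    exists (r * n.+1%:R); split; first exact: num_real.
    move=> M' rM' x Kx /=; rewrite [X in X <= _]mx_normrE.
    apply/bigmax_leP; split => [|[i j] _ /=].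
      by apply: ltW; apply: le_lt_trans rM'; rewrite mulr_ge0.
    by rewrite ord1; apply: (le_trans (coord_le_l1norm x j)); apply: ltW; apply: le_lt_trans rM'.
  apply: (@closed_comp _ _ (@l1norm R n) [set z | z <= r * n.+1%:R]).
    by move=> z _; exact: continuous_l1norm.
  exact: closed_le.
have [x Kx xmin] := EVT_min_rV (ex_intro _ 0 K0) cK (continuous_subspaceT cV).
have gmin z : V x <= V z.
  have [Kz|rz] := leP (l1norm z) (r * n.+1%:R); first by apply: xmin; rewrite inE.
  apply: (@le_trans _ _ (V 0)); first by apply: xmin; rewrite inE.
  by apply: out; rewrite ltr_pdivlMr ?ltr0n.
exists x; apply/rowP => i; rewrite mxE.
pose g (s : R) := V (x + s *: delta_mx 0 i).
have dg (s : R) : is_derive s 1 g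
    (dotp (delta_mx 0 i) (grad U (x + s *: delta_mx 0 i)) - y 0 i).
  have d1 := is_derive_line x (delta_mx 0 i) s.
  have d2 : is_derive s 1 (fun s : R => dotp (x + s *: delta_mx 0 i) y) (y 0 i).
    have -> : (fun s : R => dotp (x + s *: delta_mx 0 i) y) = fun s => dotp x y + s * y 0 i.
      by apply/funext => q; rewrite dotpDl dotpZl (dotpC (delta_mx _ _)) dotp_delta.
    by apply: is_derive_eq; rewrite /GRing.scale/=; ring.
  exact: is_deriveB d1 d2.
have lt11 : -1 < 1 :> R by lra.
have d0 : is_derive (0 : R) 1 g 0.
  apply: (@derive1_at_min R g (-1) 1 0 (ltW lt11)).
  - by move=> s _; case: (dg s).
  - by rewrite in_itv/=; lra.
  - by move=> s _; rewrite /g scale0r addr0; exact: gmin.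
have := @derive_val _ _ _ _ _ _ _ (dg 0).
rewrite (@derive_val _ _ _ _ _ _ _ d0) scale0r addr0 dotpC dotp_delta mxE => /esym/eqP.
by rewrite subr_eq0 => /eqP.
Qed.

End smooth_convex.

(** * The Hessian of the conjugate function *)

Section local_lemmas.
Context {R : realType} {n : nat}.

Lemma is_derive_increment (f : 'rV[R]_n -> R) (x v : 'rV[R]_n) (l : R) :
  (forall e : R, 0 < e -> exists2 d : R, 0 < d & forall s : R, `|s| < d ->
    `|f (x + s *: v) - f x - s * l| <= e * `|s|) ->
  is_derive x v f l.
Proof.
move=> H.
have cvg_l : (fun h : R => h^-1 *: ((f \o shift x) (h *: v) - f x)) @ 0^' --> l.
  apply/cvgrPdist_le => e e0; have [d d0 hd] := H e e0.
  apply/nbhs_ballP; exists d => //= s.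
  rewrite /ball/= sub0r normrN => sd /= s0.
  have sn0 : 0 < `|s| by rewrite normr_gt0.
  rewrite /= (addrC _ x) [_^-1 *: _]/GRing.scale/= distrC.
  have -> : s^-1 * (f (x + s *: v) - f x) - l = s^-1 * (f (x + s *: v) - f x - s * l).
    by rewrite [RHS]mulrBr mulKf.
  by rewrite normrM normfV ler_pdivrMl// (mulrC `|s|); exact: hd.
by split; [apply/cvg_ex; exists l|exact: cvg_lim cvg_l].
Qed.

Notation qform A v := ((v *m A *m v^T) 0 0).

Lemma qformZ (A : 'M[R]_n) (a : R) (v : 'rV[R]_n) : qform A (a *: v) = a ^+ 2 * qform A v.
Proof. by rewrite linearZ/= -scalemxAl -scalemxAl -scalemxAr !mxE mulrA expr2. Qed.

Lemma continuous_qform (A : 'M[R]_n) : continuous (fun v : 'rV[R]_n => qform A v).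
Proof.
move=> v; rewrite (_ : (fun v : 'rV[R]_n => qform A v) =
  fun v => \sum_j v 0 j * \sum_i v 0 i * A i j); last first.
  by apply/funext => z; rewrite qformE.
apply: (@continuous_bigsum R _ _ _ (fun j (v : 'rV[R]_n) => v 0 j * \sum_i v 0 i * A i j)) => j.
apply: (continuousM (@coord_continuous R 1 n 0 j v)).
apply: (@continuous_bigsum R _ _ _ (fun i (v : 'rV[R]_n) => v 0 i * A i j)) => i.
exact: (continuousM (@coord_continuous R 1 n 0 i v) (@cst_continuous _ _ _ _)).
Qed.

(** The constant is the minimum of the form on the l1 unit sphere, which is
    compact. *)
Lemma positive_definite_coercive (A : 'M[R]_n) : positive_definite A ->
  exists2 lam : R, 0 < lam & forall v : 'rV[R]_n, lam * l1norm v ^+ 2 <= qform A v.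
Proof.
move=> PD; pose S := [set v : 'rV[R]_n | l1norm v = 1].
have scaled v : v != 0 -> S ((l1norm v)^-1 *: v).
  move=> v0; rewrite /S/= l1normZ ger0_norm ?invr_ge0 ?l1norm_ge0// mulVf//.
  by apply: contra_neq v0; exact: l1norm_eq0.
have [S0|nS] := pselect (S !=set0); last first.
  exists 1 => // v; have [->|v0] := eqVneq v 0; last by case: nS; exists ((l1norm v)^-1 *: v); exact: scaled.
  by rewrite -(scale0r (0 : 'rV[R]_n)) l1normZ qformZ normr0 mul0r expr0n/= !mulr0 mul0r.
have cS : compact S.
  apply: bounded_closed_compact.
    exists 1; split; first exact: num_real.
    move=> M' rM' x Sx /=; rewrite [X in X <= _]mx_normrE.
    apply/bigmax_leP; split => [|[i j] _ /=]; first by apply: ltW; apply: lt_trans rM'.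
    by rewrite ord1; apply: (le_trans (coord_le_l1norm x j)); rewrite Sx ltW.
  apply: (@closed_comp _ _ (@l1norm R n) [set z | z = 1]).
    by move=> z _; exact: continuous_l1norm.
  exact: closed_eq.
have [c Sc cmin] := EVT_min_rV S0 cS (continuous_subspaceT (@continuous_qform A)).
rewrite inE in Sc.
exists (qform A c).
  apply: PD; apply/eqP => c0; move: Sc; rewrite /S/= c0.
  by rewrite -(scale0r (0 : 'rV[R]_n)) l1normZ normr0 mul0r => /esym/eqP; rewrite oner_eq0.
move=> v; have [->|v0] := eqVneq v 0.
  by rewrite -(scale0r (0 : 'rV[R]_n)) l1normZ qformZ normr0 mul0r expr0n/= !mulr0 mul0r.
have l0 : l1norm v != 0 by apply: contra_neq v0; exact: l1norm_eq0.
have -> : qform A v = l1norm v ^+ 2 * qform A ((l1norm v)^-1 *: v).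
  by rewrite qformZ mulrA -exprMn divff// expr1n mul1r.
by rewrite mulrC ler_wpM2l ?sqr_ge0// cmin// inE; exact: scaled.
Qed.

Lemma positive_definite_unit (A : 'M[R]_n) : positive_definite A -> A \in unitmx.
Proof.
move=> PD; rewrite -row_free_unit -kermx_eq0; apply/rowV0P => v /sub_kermxP vA.
apply/eqP; apply: contrapT => /negP v0.
by have := PD v v0; rewrite vA mul0mx mxE ltxx.
Qed.

Lemma l1norm_delta (i : 'I_n) : l1norm (delta_mx 0 i : 'rV[R]_n) = 1.
Proof.
rewrite /l1norm (bigD1 i)//= big1 ?addr0; first by rewrite mxE !eqxx normr1.
by move=> j ji; rewrite mxE (negbTE ji) andbF normr0.
Qed.

Lemma coord_mulmx_le (v : 'rV[R]_n) (A : 'M[R]_n) j :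
  `|(v *m A) 0 j| <= l1norm v * \sum_i \sum_k `|A i k|.
Proof.
rewrite mxE /l1norm mulr_suml; apply: (le_trans (ler_norm_sum _ _ _)).
apply: ler_sum => i _; rewrite normrM ler_wpM2l//.
rewrite (bigD1 i)//= (bigD1 j)//= -addrA lerDl addr_ge0 ?sumr_ge0// => k _.
by rewrite sumr_ge0.
Qed.

End local_lemmas.

Section conjugate_hessian.
Context {R : realType} {n : nat}.
Variable U : 'rV[R]_n -> R.
Hypothesis C2U : C2 U.
Hypothesis HPD : forall x, positive_definite (hessian U x).
Hypothesis superlinear : forall B : R, exists M, forall x : 'rV[R]_n, M < enorm x -> B * enorm x <= U x.

Notation qform A v := ((v *m A *m v^T) 0 0).

Lemma grad_expansion (x : 'rV[R]_n) (e : R) : 0 < e -> exists2 d : R, 0 < d &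
  forall h : 'rV[R]_n, l1norm h < d ->
  l1norm (grad U (x + h) - grad U x - h *m hessian U x) <= e * l1norm h.
Proof.
move=> e0; pose e' := e / n.+1%:R.
have e'0 : 0 < e' by rewrite divr_gt0.
have Hj j : \forall h \near nbhs (0 : 'rV[R]_n), `|partial j U (x + h) - partial j U x -
    \sum_i h 0 i * partial i (partial j U) x| <= e' * l1norm h.
  have [d d0 hd] := first_order_expansion ((is_derive_partial2 C2U) ^~ j)
    ((continuous_partial2 C2U) ^~ j) x e'0.
  apply/nbhs_rowP; exists d => // h hh; apply: hd => i.
  by have := hh i; rewrite mxE sub0r normrN.
have Hn : nbhs (0 : 'rV[R]_n) (fun h => forall j, `|partial j U (x + h) - partial j U x -
    \sum_i h 0 i * partial i (partial j U) x| <= e' * l1norm h) by exact: filter_forall _ Hj.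
have /nbhs_rowP[d d0 hd] := Hn; exists d => // h hd'.
apply: (@le_trans _ _ (\sum_(j < n) e' * l1norm h)).
  apply: ler_sum => j _.
  have := hd h; rewrite !mxE => /(_ _ j).
  have -> : \sum_i h 0 i * hessian U x i j = \sum_i h 0 i * partial i (partial j U) x.
    by apply: eq_bigr => i _; rewrite mxE.
  apply=> i; rewrite mxE sub0r normrN.
  exact: le_lt_trans (coord_le_l1norm h i) hd'.
rewrite sumr_const card_ord -mulr_natl mulrA ler_wpM2r ?l1norm_ge0//.
by rewrite /e' mulrCA ler_piMr ?(ltW e0)// ler_pdivrMr// mul1r ler_nat.
Qed.

(** Near x the increment of the gradient is close to the one given by the Hessian
    at x; further away it is at least as large, in the direction of z - x, as at
    distance r, because the gradient is monotone along lines. This makes the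
    inverse of the gradient locally Lipschitz. *)
Lemma grad_local_coercive (x : 'rV[R]_n) : exists lam r : R, [/\ 0 < lam, 0 < r &
  forall z, lam * Num.min (l1norm (z - x)) r <= l1norm (grad U z - grad U x)].
Proof.
have [lam lam0 hlam] := positive_definite_coercive (HPD x).
have lam20 : 0 < lam / 2 by rewrite divr_gt0.
have [d d0 hd] := grad_expansion x lam20.
have near_x h : l1norm h < d ->
    lam / 2 * l1norm h ^+ 2 <= dotp h (grad U (x + h) - grad U x).
  move=> hhd; have := hd h hhd.
  set D := grad U (x + h) - grad U x; set Q := h *m hessian U x => DQ.
  have -> : dotp h D = dotp h (D - Q) + dotp h Q by rewrite -dotpDr subrK.
  have q1 : lam * l1norm h ^+ 2 <= dotp h Q by rewrite dotpC; exact: hlam.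
  have q2 : `|dotp h (D - Q)| <= l1norm h * l1norm (D - Q) by exact: dotp_le_l1norm.
  have q3 : l1norm h * l1norm (D - Q) <= l1norm h * (lam / 2 * l1norm h).
    by rewrite ler_wpM2l// l1norm_ge0.
  have := ler_norm (- dotp h (D - Q)); rewrite normrN; nra.
pose r := d / 2; have r0 : 0 < r by rewrite divr_gt0.
have rd : r < d by rewrite /r; lra.
exists (lam / 2), r; split=> // z; set h := z - x.
have -> : z = x + h by rewrite /h addrCA subrr addr0.
have hz : dotp h (grad U (x + h) - grad U x) <= l1norm h * l1norm (grad U (x + h) - grad U x).
  exact: le_trans (ler_norm _) (dotp_le_l1norm _ _).
have [hr|rh] := leP (l1norm h) r.
  have [h0|h0] := eqVneq (l1norm h) 0; first by rewrite h0 mulr0 l1norm_ge0.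
  have hp : 0 < l1norm h by rewrite lt_neqAle eq_sym h0 l1norm_ge0.
  have := near_x h (le_lt_trans hr rd).
  move/le_trans/(_ hz); rewrite expr2 mulrA mulrC ler_pM2l//.
have hp : 0 < l1norm h by apply: lt_trans rh.
pose t := r / l1norm h.
have t0 : 0 < t by rewrite divr_gt0.
have t1 : t <= 1 by rewrite ler_pdivrMr// mul1r ltW.
have th : l1norm (t *: h) = r by rewrite l1normZ gtr0_norm// divfK ?gt_eqF.
have := near_x (t *: h); rewrite th => /(_ rd).
rewrite dotpZl => n1.
have mono := grad_monotone_line C2U HPD x h t1; rewrite scale1r in mono.
have n2 : dotp h (grad U (x + t *: h) - grad U x) <= dotp h (grad U (x + h) - grad U x).
  by rewrite !dotpDr lerD2r.
have n3 : lam / 2 * r ^+ 2 <= t * (l1norm h * l1norm (grad U (x + h) - grad U x)).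
  apply: (le_trans n1); rewrite ler_wpM2l ?(ltW t0)//.
  exact: le_trans n2 hz.
move: n3; rewrite mulrA /t divfK ?gt_eqF// expr2 mulrA mulrC.
by rewrite ler_pM2l// mulrC.
Qed.

Definition grad_inv (y : 'rV[R]_n) : 'rV[R]_n := xget 0 [set x | grad U x = y].

Lemma grad_invK y : grad U (grad_inv y) = y.
Proof.
rewrite /grad_inv; case: xgetP => //= nx.
by have [x /nx] := grad_surj C2U superlinear y.
Qed.

Lemma gradK x : grad_inv (grad U x) = x.
Proof. by apply: (grad_inj C2U HPD); rewrite grad_invK. Qed.

Lemma grad_inv_lipschitz y : exists L r : R, [/\ 0 <= L, 0 < r &
  forall z, l1norm (z - y) < r -> l1norm (grad_inv z - grad_inv y) <= L * l1norm (z - y)].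
Proof.
have [lam [r [lam0 r0 H]]] := grad_local_coercive (grad_inv y).
exists lam^-1, (lam * r); split; rewrite ?invr_ge0 ?(ltW lam0) ?mulr_gt0// => z zy.
have := H (grad_inv z); rewrite !grad_invK.
have [h1|h1] := leP (l1norm (grad_inv z - grad_inv y)) r.
  by rewrite ler_pdivlMl.
by move=> h2; have := le_lt_trans h2 zy; rewrite ltxx.
Qed.

Let u x := (U x)%:E.
Let V := fine \o conjugate u.

Lemma conjugateE y : V y = dotp (grad_inv y) y - U (grad_inv y).
Proof.
rewrite /V/= /conjugate (_ : ereal_sup _ = (dotp (grad_inv y) y - U (grad_inv y))%:E)//.
apply/eqP; rewrite eq_le; apply/andP; split.
  apply: ge_ereal_sup => _ [x _ <-]; rewrite -EFinB lee_fin.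
  have := tangent_lower_bound C2U HPD (grad_inv y) (x - grad_inv y).
  by rewrite grad_invK addrCA subrr addr0 dotpBl; lra.
by apply: ereal_sup_ubound; exists (grad_inv y).
Qed.

Lemma conjugate_increment y k : dotp (grad_inv y) k <= V (y + k) - V y <= dotp (grad_inv (y + k)) k.
Proof.
have H a b : V a + dotp (grad_inv a) (b - a) <= V b.
  rewrite !conjugateE.
  have := tangent_lower_bound C2U HPD (grad_inv b) (grad_inv a - grad_inv b).
  rewrite grad_invK addrCA subrr addr0 dotpBl dotpDr dotpNr; lra.
have := H y (y + k); have := H (y + k) y.
have -> : y + k - y = k by rewrite addrAC subrr add0r.
have -> : y - (y + k) = - k by rewrite opprD addrA subrr add0r.
rewrite dotpNr.
by move=> h1 h2; apply/andP; split; lra.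
Qed.

(** The two bounds of [conjugate_increment] agree to first order, as grad_inv is
    locally Lipschitz. *)
Lemma is_derive_conjugate j y : is_derive y (delta_mx 0 j) V (grad_inv y 0 j).
Proof.
apply: is_derive_increment => e e0.
have [L [r [L0 r0 H]]] := grad_inv_lipschitz y.
exists (Num.min r (e / (L + 1))); first by rewrite lt_min r0 divr_gt0//; lra.
move=> s; rewrite lt_min => /andP[sr se].
have /andP[i1 i2] := conjugate_increment y (s *: delta_mx 0 j).
rewrite !dotpZr !dotp_delta in i1 i2.
have := H (y + s *: delta_mx 0 j).
rewrite [y + _ - y]addrAC subrr add0r l1normZ l1norm_delta mulr1 => /(_ sr) Hs.
have Xj := le_trans (coord_le_l1norm _ j) Hs; rewrite !mxE in Xj.
set X1 := grad_inv (y + s *: delta_mx 0 j) 0 j in i2 Xj *.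
set X0 := grad_inv y 0 j in i1 Xj *.
set Q := V _ - V y in i1 i2 *.
have b1 : `|Q - s * X0| <= `|s| * `|X1 - X0|.
  by rewrite -normrM mulrBr !ger0_norm; lra.
apply: (le_trans b1); rewrite mulrC ler_wpM2r//; apply: (le_trans Xj).
have : `|s| * (L + 1) < e by rewrite -ltr_pdivlMr//; lra.
have := normr_ge0 s; nra.
Qed.

(** If h is the increment of grad_inv for an increment k of the argument and H is
    the Hessian of U, then k - h H is negligible with respect to h by
    [grad_expansion], and h is at most of the order of k. *)
Lemma is_derive_grad_inv i j y : is_derive y (delta_mx 0 i) (fun z => grad_inv z 0 j)
  (invmx (hessian U (grad_inv y)) i j).
Proof.
set x := grad_inv y; set H := hessian U x.
have uH : H \in unitmx := positive_definite_unit (@HPD x).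
apply: is_derive_increment => e e0.
have [L [r [L0 r0 HL]]] := grad_inv_lipschitz y.
pose M := \sum_i \sum_k `|invmx H i k|.
have M0 : 0 <= M by apply: sumr_ge0 => ? _; apply: sumr_ge0.
pose e' := e / (L + 1) / (M + 1).
have e'0 : 0 < e' by rewrite !divr_gt0//; lra.
have [d d0 hd] := grad_expansion x e'0.
exists (Num.min r (d / (L + 1))); first by rewrite lt_min r0 divr_gt0//; lra.
move=> s; rewrite lt_min => /andP[sr sd].
pose k : 'rV[R]_n := s *: delta_mx 0 i.
pose h := grad_inv (y + k) - x.
have sn := normr_ge0 s.
have hL : l1norm h <= L * `|s|.
  have := HL (y + k); rewrite [y + _ - y]addrAC subrr add0r l1normZ l1norm_delta mulr1.
  exact.
have hdd : l1norm h < d.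
  apply: (le_lt_trans hL).
  have : `|s| * (L + 1) < d by rewrite -ltr_pdivlMr//; lra.
  nra.
have := hd h hdd.
have -> : x + h = grad_inv (y + k) by rewrite /h addrCA subrr addr0.
rewrite !grad_invK [y + k - y]addrAC subrr add0r => kh.
have E : grad_inv (y + k) 0 j - grad_inv y 0 j - s * invmx H i j =
    - ((k - h *m H) *m invmx H) 0 j.
  rewrite mulmxBl mulmxK// -scalemxAl -rowE !mxE; ring.
rewrite E normrN; apply: (le_trans (coord_mulmx_le _ _ _)).
apply: (@le_trans _ _ (e' * l1norm h * M)); first by rewrite ler_wpM2r.
apply: (@le_trans _ _ (e' * ((L + 1) * `|s|) * (M + 1))).
  have a1 : e' * l1norm h <= e' * ((L + 1) * `|s|) by rewrite ler_pM2l//; nra.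
  have a2 : 0 <= e' * l1norm h by rewrite mulr_ge0 ?(ltW e'0)// l1norm_ge0.
  have a3 : M <= M + 1 by lra.
  exact: ler_pM a2 M0 a1 a3.
rewrite le_eqVlt; apply/orP; left; apply/eqP; rewrite /e'; field.
by apply/andP; split; rewrite gt_eqF//; lra.
Qed.

Lemma hessian_conjugate y : hessian V y = invmx (hessian U (grad_inv y)).
Proof.
apply/matrixP => i j; rewrite mxE /partial.
have -> : (fun x => 'D_(delta_mx 0 j) V x) = fun z => grad_inv z 0 j.
  by apply/funext => z; apply: derive_val; exact: is_derive_conjugate.
by apply: derive_val; exact: is_derive_grad_inv.
Qed.

(** Evaluating the lower bound for the inverse of the Hessian H at the vector v H
    gives c |v H|^2 <= <v H, v>, and the Cauchy-Schwarz inequality concludes. *)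
Lemma hessian_upper_bound (c : R) : 0 < c ->
  (forall y, loewner_le c%:M (hessian V y)) ->
  forall x v, qform (hessian U x) v <= c^-1 * dotp v v.
Proof.
move=> c0 Vc x v; set H := hessian U x.
have uH : H \in unitmx := positive_definite_unit (@HPD x).
have := Vc (grad U x) (v *m H); rewrite hessian_conjugate gradK -/H.
rewrite mulmxK// mul_mx_scalar -scalemxAl mxE.
rewrite -/(dotp (v *m H) (v *m H)) -/(dotp v (v *m H)) dotpC -/(dotp (v *m H) v).
set q := dotp (v *m H) v; set a := dotp (v *m H) (v *m H) => ca.
have cs : q ^+ 2 <= a * dotp v v by exact: cauchy_schwarz.
have vv := dotpp_ge0 v.
have [q0|q0] := leP q 0.
  by apply: (le_trans q0); rewrite mulr_ge0// invr_ge0 ltW.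
rewrite ler_pdivlMl//.
have : c * q ^+ 2 <= q * dotp v v.
  apply: (@le_trans _ _ (c * (a * dotp v v))); first by rewrite ler_wpM2l// ltW.
  by rewrite mulrA ler_wpM2r.
by rewrite expr2 mulrCA ler_pM2l.
Qed.

End conjugate_hessian.

(** * Growth of a potential with bounded Hessian *)

Lemma expR_le_quadratic {R : realType} (z : R) : expR z <= 1 + z + z ^+ 2 * expR `|z|.
Proof.
have [z0|z0] := leP 0 z.
  rewrite ger0_norm//; have e0 := expR_gt0 z.
  have [z1|z1] := leP 1 z.
    have z2 : 1 <= z ^+ 2 by nra.
    by have := ler_wpM2r (ltW e0) z2; rewrite mul1r; lra.
  have : expR z * (1 - z) <= 1.
    have := expR_ge1Dx (- z); rewrite expRN => h.
    have : expR z * (1 - z) <= expR z * (expR z)^-1 by rewrite ler_wpM2l// ltW.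
    by rewrite divff// gt_eqF.
  have z1' : 0 <= 1 + z by lra.
  by move=> /(ler_wpM2r z1'); rewrite mul1r; nra.
have ez : expR z * (1 - z) <= 1.
  have := expR_ge1Dx (- z); rewrite expRN => h.
  have : expR z * (1 - z) <= expR z * (expR z)^-1 by rewrite ler_wpM2l// expR_ge0.
  by rewrite divff// gt_eqF// expR_gt0.
have e1 : 1 <= expR `|z| by rewrite -expR0 ler_expR.
have e0 := expR_gt0 z.
have : expR z <= 1 + z + z ^+ 2.
  rewrite -(ler_pM2r (_ : 0 < 1 - z)); last by lra.
  apply: (le_trans ez); have : z ^+ 3 <= 0 by rewrite -oppr_ge0 -mulN1r; nra.
  by rewrite (_ : (1 + z + z ^+ 2) * (1 - z) = 1 - z ^+ 3); [lra|ring].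
have := sqr_ge0 z; nra.
Qed.

(** The scalar part of the proof that U grows at most quadratically: l stands for
    the norm of a point, e and d for the first-order term and the square of the
    distance in the quadratic upper bound of U around the origin. *)
Lemma quadratic_growth {R : realFieldType} (C a b g l U0 d e m z : R) :
  0 < C -> 0 <= a -> 0 <= b -> 0 <= g -> 0 <= l -> U0 <= a -> - m <= b ->
  e <= l * g -> d <= l ^+ 2 -> z <= U0 + e + C / 2 * d ->
  z - m <= (a + b + g + C) * (1 + l) ^+ 2.
Proof.
move=> C0 a0 b0 g0 l0 Ua mb el dl zU.
have d2 : C / 2 * d <= C / 2 * l ^+ 2 by rewrite ler_wpM2l// divr_ge0// ltW.
have := mulr_ge0 a0 l0; have := mulr_ge0 b0 l0.
have := mulr_ge0 g0 l0; have := mulr_ge0 (ltW C0) l0.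
have := mulr_ge0 g0 (sqr_ge0 l); have := mulr_ge0 a0 (sqr_ge0 l).
have := mulr_ge0 b0 (sqr_ge0 l); have := mulr_ge0 (ltW C0) (sqr_ge0 l).
lra.
Qed.

(** The integral of a nonnegative function is a supremum over the simple functions
    below it, hence monotone. This is meant for the function f (+) t . g, which is
    defined by an infimum over uncountably many points. *)
Lemma ge0_le_integral_any d (T : measurableType d) (R : realType)
    (mu : {measure set T -> \bar R}) (f g : T -> \bar R) :
  (forall x, 0 <= f x)%E -> (forall x, f x <= g x)%E ->
  (\int[mu]_x f x <= \int[mu]_x g x)%E.
Proof.
move=> f0 fg; have g0 x : (0 <= g x)%E by apply: le_trans (f0 x) (fg x).
rewrite !ge0_integralTE//; apply: le_ereal_sup => _ [h hf <-].
by exists h => // x; apply: le_trans (hf x) (fg x).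
Qed.

Section growth.
Context {R : realType} {n : nat}.
Variable U : 'rV[R]_n -> R.
Hypothesis C2U : C2 U.
Hypothesis HPD : forall x, positive_definite (hessian U x).
Hypothesis superlinear : forall B : R, exists M, forall x : 'rV[R]_n, M < enorm x -> B * enorm x <= U x.
Variable C : R.
Hypothesis C0 : 0 < C.
Hypothesis HC : forall x v : 'rV[R]_n, (v *m hessian U x *m v^T) 0 0 <= C * dotp v v.

Lemma potential_bounded_below : exists m, forall x, m <= U x.
Proof.
have [x0 gx0] := grad_surj C2U superlinear 0.
exists (U x0) => x; have := tangent_lower_bound C2U HPD x0 (x - x0).
by rewrite gx0 -(scale0r (0 : 'rV[R]_n)) dotpZr mul0r addr0 addrCA subrr addr0.
Qed.

Lemma coercive_l1norm (k : R) : 0 <= k -> exists b, forall x, k * l1norm x - b <= U x.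
Proof.
move=> k0; have [m Um] := potential_bounded_below.
have [M hM] := superlinear (k * n%:R).
exists (k * (n%:R * `|M|) + `|m|) => x.
have := l1norm_le_enorm x; have := Um x => mx lx.
have [Mx|xM] := ltP M (enorm x).
  have := hM x Mx; have : 0 <= k * (n%:R * `|M|) + `|m| by rewrite addr_ge0// !mulr_ge0.
  have : k * l1norm x <= k * (n%:R * enorm x) by rewrite ler_wpM2l.
  by rewrite mulrA; lra.
have : k * l1norm x <= k * (n%:R * `|M|).
  rewrite ler_wpM2l//; apply: (le_trans lx); rewrite ler_wpM2l//.
  by apply: (le_trans xM); exact: ler_norm.
have := ler_norm (- m); rewrite normrN; lra.
Qed.

(** The quadratic upper bound of U at the point x - C^-1 grad U x is at least m. *)
Lemma grad_sqr_bound m : (forall x, m <= U x) ->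
  forall x, dotp (grad U x) (grad U x) <= 2 * C * (U x - m).
Proof.
move=> Um x; set g := grad U x.
have := semiconcave_upper_bound C2U x (- (C^-1) *: g) HC.
rewrite dotpZl dotpZl dotpZr => h; have := le_trans (Um _) h.
set q := dotp g g => h'.
have : q * (C / 2 * C^-1 * C^-1 - C^-1) + (U x - m) >= 0 by move: h'; nra.
have -> : C / 2 * C^-1 * C^-1 - C^-1 = - (2 * C)^-1 by field; rewrite gt_eqF.
rewrite mulrN addrC subr_ge0 ler_pdivrMr ?mulr_gt0// mulrC//.
Qed.

Lemma potential_of_C2 : potential U (fun i => partial i U).
Proof.
have [m Um] := potential_bounded_below.
split.
- by case: C2U => -[].
- exact: continuous_partial C2U.
- exact: is_derive_partial C2U.
- pose K := `|U 0| + `|m| + l1norm (grad U 0) + C.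
  have K0 : 0 <= K by rewrite /K !addr_ge0 ?l1norm_ge0// ltW.
  exists (1 + 2 * C * K) => i x.
  have lx := l1norm_ge0 x.
  have UK : U x - m <= K * (1 + l1norm x) ^+ 2.
    have Ux := semiconcave_upper_bound C2U 0 x HC; rewrite add0r in Ux.
    apply: quadratic_growth Ux => //.
    - exact: l1norm_ge0.
    - exact: ler_norm.
    - by rewrite -normrN ler_norm.
    - exact: le_trans (ler_norm _) (dotp_le_l1norm _ _).
    - by rewrite expr2; apply: le_trans (ler_norm _) (dotp_le_l1norm _ _).
  have p2 : partial i U x ^+ 2 <= 2 * C * K * (1 + l1norm x) ^+ 2.
    have := grad_sqr_bound Um x; have := coord_le_enorm (grad U x) i.
    rewrite mxE => h1 h2.
    have : `|partial i U x| ^+ 2 <= enorm (grad U x) ^+ 2 by rewrite lerXn2r// nnegrE enorm_ge0.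
    rewrite real_normK ?num_real// enorm_sqr => h3.
    apply: (le_trans h3); apply: (le_trans h2).
    by rewrite -[leRHS]mulrA ler_wpM2l// mulr_ge0// ltW.
  have D0 : 0 <= 2 * C * K by rewrite !mulr_ge0// ltW.
  rewrite -ler_sqr ?nnegrE ?mulr_ge0//; [|lra|lra].
  rewrite real_normK ?num_real// exprMn; apply: (le_trans p2).
  by rewrite ler_wpM2r ?sqr_ge0//; nra.
- have [b hb] := coercive_l1norm (@ler01 R).
  by exists b => x; rewrite -[l1norm x]mul1r.
Qed.

Definition half_sqr_grad x : R := dotp (grad U x) (grad U x) / 2.

Lemma half_sqr_grad_ge0 x : 0 <= half_sqr_grad x.
Proof. by rewrite divr_ge0// dotpp_ge0. Qed.

Lemma half_sqr_gradE x : half_sqr_grad x = 2^-1 * \sum_i partial i U x ^+ 2.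
Proof.
rewrite /half_sqr_grad dotpE mulrC; congr (_ * _).
by apply: eq_bigr => i _; rewrite !mxE expr2.
Qed.

Lemma continuous_half_sqr_grad : continuous half_sqr_grad.
Proof.
rewrite (_ : half_sqr_grad = fun x => 2^-1 * \sum_i partial i U x ^+ 2); last first.
  by apply/funext => x; rewrite half_sqr_gradE.
move=> x; apply: (continuousM (@cst_continuous _ _ _ _)).
apply: (@continuous_bigsum R _ _ _ (fun i x => partial i U x ^+ 2)) => i.
exact: (continuousM (@continuous_partial _ _ _ C2U i x) (@continuous_partial _ _ _ C2U i x)).
Qed.

Lemma decaying_half_sqr_grad : decaying (fun x => half_sqr_grad x * expR (- U x)).
Proof.
rewrite (_ : (fun _ => _) = fun x => 2^-1 * \sum_i partial i U x ^+ 2 * expR (- U x)).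
  by apply: decayingZ; apply: decaying_sum => i; exact: decaying_sqr_exp potential_of_C2 i.
by apply/funext => x; rewrite half_sqr_gradE -mulrA mulr_suml.
Qed.

(** This dominates the second-order remainder of the first variation for all
    t <= (2 C)^-1. As half_sqr_grad is at most C (U - m), the additional exponential
    factor uses up no more than half of the decay of exp (- U). *)
Lemma decaying_half_sqr_grad_exp :
  decaying (fun x => half_sqr_grad x ^+ 2 * expR (- U x + (2 * C)^-1 * half_sqr_grad x)).
Proof.
split.
  move=> x; apply: (continuousM (continuousM (@continuous_half_sqr_grad x) (@continuous_half_sqr_grad x))).
  apply: (@continuous_comp _ _ _ (fun x => - U x + (2 * C)^-1 * half_sqr_grad x) (@expR R)).
    have cU := @potential_cont _ _ _ _ potential_of_C2 x.
    exact: (continuousD (continuousN cU) (continuousM (@cst_continuous _ _ _ _) (@continuous_half_sqr_grad x))).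
  exact: continuous_expR.
have [m Um] := potential_bounded_below.
have [b Ub] := coercive_l1norm (ler0n R 4).
exists (C ^+ 2 * 64 * expR (- m) * expR ((m + b) / 4)) => x.
have qz : half_sqr_grad x <= C * (U x - m).
  by rewrite /half_sqr_grad; have := grad_sqr_bound Um x; lra.
have q0 := half_sqr_grad_ge0 x; have := Um x => mU.
set q := half_sqr_grad x in qz q0 *; set z := U x - m in qz *.
have z0 : 0 <= z by rewrite /z; lra.
rewrite (ger0_norm (mulr_ge0 (sqr_ge0 _) (expR_ge0 _))).
have q2 : q ^+ 2 <= C ^+ 2 * z ^+ 2.
  by rewrite -exprMn lerXn2r// nnegrE// mulr_ge0// ltW.
have zexp : z ^+ 2 <= 64 * expR (z / 4).
  have -> : z / 4 = z / 8 + z / 8 by lra.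
  rewrite expRD; have := expR_ge1Dx (z / 8); nra.
have e1 : expR (- U x + (2 * C)^-1 * q) <= expR (- m) * expR (- (z / 2)).
  rewrite -expRD ler_expR.
  have : (2 * C)^-1 * q <= (2 * C)^-1 * (C * z) by rewrite ler_wpM2l// invr_ge0 mulr_ge0// ltW.
  have -> : (2 * C)^-1 * (C * z) = z / 2 by field; rewrite gt_eqF.
  by rewrite /z; lra.
have e2 : expR (z / 4) * expR (- (z / 2)) <= expR ((m + b) / 4) * decay x.
  rewrite /decay -!expRD ler_expR; have := Ub x; have := l1norm_ge0 x; rewrite /z; lra.
have em := expR_ge0 (- m).
have s1 : q ^+ 2 * expR (- U x + (2 * C)^-1 * q) <=
    (C ^+ 2 * (64 * expR (z / 4))) * (expR (- m) * expR (- (z / 2))).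
  apply: ler_pM; rewrite ?sqr_ge0 ?expR_ge0//.
  by apply: (le_trans q2); rewrite ler_wpM2l// sqr_ge0.
apply: (le_trans s1).
rewrite (_ : _ * _ = (C ^+ 2 * 64 * expR (- m)) * (expR (z / 4) * expR (- (z / 2)))); last by ring.
by rewrite -[leRHS]mulrA ler_wpM2l// mulr_ge0// mulr_ge0// sqr_ge0.
Qed.

End growth.

(** * The first variation of the total mass *)

Section gauss_constant.
Context {R : realType}.

Lemma gauss_cst_gt0 n : 0 < gauss_cst R n.
Proof. by rewrite powR_gt0// mulr_gt0// pi_gt0. Qed.

Lemma ln_gauss_cst n : ln (gauss_cst R n) = n%:R * ln (normal_peak (1 : R)).
Proof.
have p0 : 0 < 2 * pi :> R by rewrite mulr_gt0// pi_gt0.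
have -> : normal_peak (1 : R) = ((2 * pi) `^ (2^-1))^-1.
  by rewrite powR12_sqrt ?(ltW p0)// /normal_peak expr1n mul1r mulr_natl.
by rewrite ln_powR lnV ?posrE ?powR_gt0// ln_powR; field.
Qed.

Lemma neg_log_gauss n (x : 'rV[R]_n) :
  neg_log gauss x = (enorm x ^+ 2 / 2 - ln (gauss_cst R n))%:E.
Proof.
have c0 := gauss_cst_gt0 n.
rewrite /neg_log /gauss lne_EFin ?mulr_gt0 ?expR_gt0//.
by rewrite lnM ?posrE ?expR_gt0// expRK -EFinN; congr EFin; ring.
Qed.

End gauss_constant.

(** The scalar part of the first variation: e1 stands for exp (t l), s for
    t / (1 + t C) and M for the total mass at time t. *)
Lemma first_variation_remainder {R : realFieldType} (t l e e1 s C J Q K M : R) :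
  0 < t <= 1 -> 0 <= C -> 0 <= J -> 0 <= Q -> 0 <= K -> 0 <= e ->
  1 + t * l <= e1 <= 1 + t * l + t ^+ 2 * e ->
  t - t ^+ 2 * C <= s <= t -> 0 <= s ->
  e1 * (J + s * Q) <= M <= e1 * (J + t * Q + t ^+ 2 * K) ->
  `|M - J - t * (Q + l * J)| <=
    t ^+ 2 * (K + `|l| * (Q + K) + e * (J + Q + K) + C * Q + `|l| * Q).
Proof.
move=> /andP[t0 t1] C0 J0 Q0 K0 e0 /andP[e1l e1u] /andP[sl su] s0 /andP[Ml Mu].
have t2 : 0 <= t ^+ 2 by rewrite sqr_ge0.
have al := normr_ge0 l; have l1 := ler_norm l.
have l2 : - l <= `|l| by rewrite -normrN ler_norm.
have t2t : t ^+ 2 <= t by rewrite expr2 ler_piMl// ltW.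
rewrite ler_norml; apply/andP; split.
  have h1 : (1 + t * l) * (J + s * Q) <= M.
    apply: le_trans Ml; rewrite ler_wpM2r// addr_ge0// mulr_ge0//.
  have h2 : (t - t ^+ 2 * C) * Q <= s * Q by rewrite ler_wpM2r.
  have h3 : - (t ^+ 2 * (`|l| * Q)) <= t * l * (s * Q).
    have : t * (s * Q) * (- l) <= t * (s * Q) * `|l| by rewrite ler_wpM2l// !mulr_ge0// ltW.
    have : t * (s * Q) * `|l| <= t * (t * Q) * `|l|.
      by rewrite ler_wpM2r// ler_wpM2l ?(ltW t0)// ler_wpM2r.
    lra.
  have h4 : 0 <= t ^+ 2 * (K + `|l| * (Q + K) + e * (J + Q + K)).
    by rewrite mulr_ge0// !addr_ge0// mulr_ge0// !addr_ge0.
  lra.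
have B0 : 0 <= J + t * Q + t ^+ 2 * K by rewrite !addr_ge0// mulr_ge0// ltW.
have h1 : M <= (1 + t * l + t ^+ 2 * e) * (J + t * Q + t ^+ 2 * K).
  by apply: (le_trans Mu); rewrite ler_wpM2r.
have QK : t * Q + t ^+ 2 * K <= t * (Q + K) by rewrite mulrDr lerD2l ler_wpM2r.
have QK0 : 0 <= t * Q + t ^+ 2 * K by rewrite addr_ge0// mulr_ge0// ltW.
have h2 : t * l * (t * Q + t ^+ 2 * K) <= t ^+ 2 * (`|l| * (Q + K)).
  have a1 : t * l * (t * Q + t ^+ 2 * K) <= t * `|l| * (t * Q + t ^+ 2 * K).
    by rewrite ler_wpM2r// ler_wpM2l// ltW.
  have a2 : t * `|l| * (t * Q + t ^+ 2 * K) <= t * `|l| * (t * (Q + K)).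
    by rewrite ler_wpM2l// mulr_ge0// ltW.
  lra.
have h3 : t ^+ 2 * e * (J + t * Q + t ^+ 2 * K) <= t ^+ 2 * (e * (J + Q + K)).
  rewrite -mulrA ler_wpM2l// ler_wpM2l//.
  have : t * (Q + K) <= 1 * (Q + K) by rewrite ler_wpM2r// addr_ge0.
  lra.
have h4 : 0 <= t ^+ 2 * (C * Q + `|l| * Q) by rewrite mulr_ge0// addr_ge0// mulr_ge0.
lra.
Qed.

Section first_variation.
Context {R : realType} {n : nat}.
Variable U : 'rV[R]_n -> R.
Hypothesis C2U : C2 U.
Hypothesis HPD : forall x, positive_definite (hessian U x).
Hypothesis superlinear : forall B : R, exists M, forall x : 'rV[R]_n, M < enorm x -> B * enorm x <= U x.
Variable C : R.
Hypothesis C0 : 0 < C.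
Hypothesis HC : forall x v : 'rV[R]_n, (v *m hessian U x *m v^T) 0 0 <= C * dotp v v.

Notation L := (@lebesgue_tuple R n).
Let u x := (U x)%:E.
Let f := exp_neg u.
Let l := ln (gauss_cst R n).
Let q := half_sqr_grad U.

Let wp := potential_of_C2 C2U HPD superlinear C0 HC.

Lemma exp_neg_EFin x : exp_neg u x = expR (- U x).
Proof. by []. Qed.

Lemma neg_log_exp_neg : neg_log f = u.
Proof.
apply/funext => x; rewrite /neg_log /f exp_neg_EFin lne_EFin ?expR_gt0// expRK.
by rewrite -EFinN opprK.
Qed.

Lemma rscale_gauss (t : R) (y : 'rV[R]_n) : 0 < t ->
  rscale (neg_log gauss) t y = (dotp y y / (2 * t) - t * l)%:E :> \bar R.
Proof.
move=> t0; rewrite /rscale gt_eqF// neg_log_gauss -EFinM enorm_sqr dotpZl dotpZr.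
by rewrite -/l; congr EFin; field; rewrite gt_eqF.
Qed.

(** The infimum is that of U (x - y) + |y|^2 / (2 t) over y. The tangent at x and a
    completed square give the lower bound; the upper bound is the value at the y
    which would be optimal if the Hessian of U were equal to C everywhere. *)
Lemma infconv_bounds (t : R) (x : 'rV[R]_n) : 0 < t ->
  ((U x - t * q x - t * l)%:E <= infconv u (rscale (neg_log gauss) t) x <=
   (U x - t / (1 + t * C) * q x - t * l)%:E)%E.
Proof.
move=> t0; have tC : 0 < 1 + t * C by rewrite addr_gt0// mulr_gt0.
apply/andP; split.
  apply: le_ereal_inf_tmp => _ [y _ <-]; rewrite rscale_gauss// -EFinD lee_fin.
  have := tangent_lower_bound C2U HPD x (- y); rewrite dotpNl.
  have := dotpp_ge0 (y - t *: grad U x).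
  rewrite dotpBl !dotpZl !(dotpC _ (_ - _)) !dotpBl !dotpZl (dotpC (grad U x) y).
  rewrite /q /half_sqr_grad.
  set g := dotp (grad U x) (grad U x); set d := dotp y (grad U x); set yy := dotp y y.
  move=> h0 h1; have h2 : 0 <= (yy - 2 * t * d + t ^+ 2 * g) / (2 * t).
    by rewrite divr_ge0// ?mulr_ge0 ?(ltW t0)//; move: h0; lra.
  have : (yy - 2 * t * d + t ^+ 2 * g) / (2 * t) = yy / (2 * t) - d + t * g / 2.
    by field; rewrite gt_eqF.
  by move=> h3; rewrite h3 in h2; lra.
pose y := (t / (1 + t * C)) *: grad U x.
apply: (@le_trans _ _ (u (x - y) + rscale (neg_log gauss) t y)%E).
  by apply: ereal_inf_lbound; exists y.
rewrite rscale_gauss// /u -EFinD lee_fin.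
have := semiconcave_upper_bound C2U x (- y) HC.
rewrite dotpNl dotpNl dotpNr opprK /y !dotpZl !dotpZr /q /half_sqr_grad.
set g := dotp (grad U x) (grad U x) => h.
have : - (t / (1 + t * C) * g) + C / 2 * (t / (1 + t * C) * (t / (1 + t * C) * g)) +
   t / (1 + t * C) * (t / (1 + t * C) * g) / (2 * t) = - (t / (1 + t * C) * (g / 2)).
  by field; rewrite !gt_eqF.
by move: h; lra.
Qed.

Lemma asplund_bounds (t : R) (x : 'rV[R]_n) : 0 < t ->
  expR (t * l) * expR (- U x + t / (1 + t * C) * q x) <= asplund f t gauss x <=
  expR (t * l) * expR (- U x + t * q x).
Proof.
move=> t0; rewrite /asplund neg_log_exp_neg /exp_neg.
have := infconv_bounds x t0.
case: (infconv _ _ x) => [r| |] /andP[h1 h2]; last 2 first.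
- by move: h2; rewrite leNgt ltry.
- by move: h1; rewrite leNgt ltNyr.
rewrite lee_fin in h1; rewrite lee_fin in h2.
by rewrite /= -!expRD !ler_expR; apply/andP; split; lra.
Qed.

Let J := mass U.
Let Q := \int[L]_t (q (rv t) * expR (- U (rv t))).
Let K := \int[L]_t (q (rv t) ^+ 2 * expR (- U (rv t) + (2 * C)^-1 * q (rv t))).

Let dJ := decaying_exp wp.
Let dQ := decaying_half_sqr_grad C2U HPD superlinear C0 HC.
Let dK := decaying_half_sqr_grad_exp C2U HPD superlinear C0 HC.

Lemma total_massE : total_mass f = J%:E.
Proof.
rewrite /total_mass /int_Rn -Rintegral_EFin//.
exact: decaying_integrable dJ.
Qed.

(** The bound exp z >= 1 + z is used from below, and [expR_le_quadratic] from
    above. *)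
Lemma total_mass_asplund_bounds (t : R) : 0 < t <= (2 * C)^-1 ->
  ((expR (t * l) * (J + t / (1 + t * C) * Q))%:E <= total_mass (asplund f t gauss) <=
   (expR (t * l) * (J + t * Q + t ^+ 2 * K))%:E)%E.
Proof.
move=> /andP[t0 tC].
have dec1 (s : R) := decayingZ (expR (t * l)) (decayingD dJ (decayingZ s dQ)).
have E1 (s : R) : \int[L]_z (expR (t * l) * (expR (- U (rv z)) + s * (q (rv z) * expR (- U (rv z)))))
    = expR (t * l) * (J + s * Q).
  have i1 := decaying_integrable dJ; have i2 := decaying_integrable dQ.
  rewrite RintegralZl//; last exact: decaying_integrable (decayingD dJ (decayingZ s dQ)).
  by rewrite (RintegralD measurableT i1 (integrableRZl s measurableT i2)) (RintegralZl _ measurableT i2).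
have q0 x : 0 <= q x by exact: half_sqr_grad_ge0.
apply/andP; split.
  rewrite -E1 -Rintegral_EFin; last exact: decaying_integrable (dec1 _).
  apply: ge0_le_integral_any => z; rewrite lee_fin.
    have s0 : 0 <= t / (1 + t * C).
      by rewrite divr_ge0 ?(ltW t0)// addr_ge0// mulr_ge0// ltW.
    have qe : 0 <= q (rv z) * expR (- U (rv z)) by rewrite mulr_ge0 ?expR_ge0.
    by rewrite mulr_ge0 ?expR_ge0// addr_ge0 ?expR_ge0// mulr_ge0.
  have /andP[h _] := asplund_bounds (rv z) t0.
  apply: le_trans h; rewrite ler_wpM2l ?expR_ge0// expRD.
  have := ler_wpM2l (expR_ge0 (- U (rv z))) (expR_ge1Dx (t / (1 + t * C) * q (rv z))).
  lra.
have dec2 := decayingZ (expR (t * l)) (decayingD (decayingD dJ (decayingZ t dQ)) (decayingZ (t ^+ 2) dK)).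
have E2 : \int[L]_z (expR (t * l) * (expR (- U (rv z)) + t * (q (rv z) * expR (- U (rv z)))
     + t ^+ 2 * (q (rv z) ^+ 2 * expR (- U (rv z) + (2 * C)^-1 * q (rv z)))))
    = expR (t * l) * (J + t * Q + t ^+ 2 * K).
  have i1 := decaying_integrable dJ; have i2 := decaying_integrable dQ.
  have i3 := decaying_integrable dK.
  rewrite RintegralZl//; last exact: decaying_integrable (decayingD (decayingD dJ (decayingZ t dQ)) (decayingZ (t ^+ 2) dK)).
  rewrite (RintegralD measurableT (integrableRD measurableT i1 (integrableRZl t measurableT i2))
    (integrableRZl (t ^+ 2) measurableT i3)) (RintegralZl _ measurableT i3).
  by rewrite (RintegralD measurableT i1 (integrableRZl t measurableT i2)) (RintegralZl _ measurableT i2).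
rewrite -E2 -Rintegral_EFin; last exact: decaying_integrable dec2.
apply: ge0_le_integral_any => z; rewrite lee_fin; have /andP[h1 h2] := asplund_bounds (rv z) t0.
  by apply: le_trans h1; apply: mulr_ge0; exact: expR_ge0.
apply: (le_trans h2); rewrite ler_wpM2l ?expR_ge0// !expRD.
have qz := q0 (rv z).
have b1 := expR_le_quadratic (t * q (rv z)).
have tq0 : 0 <= t * q (rv z) by apply: mulr_ge0 => //; exact: ltW.
rewrite (ger0_norm tq0) in b1.
have b2 : expR (t * q (rv z)) <= expR ((2 * C)^-1 * q (rv z)) by rewrite ler_expR ler_wpM2r.
have a0 := expR_ge0 (- U (rv z)).
have b3 : (t * q (rv z)) ^+ 2 * expR (t * q (rv z)) <=
    (t * q (rv z)) ^+ 2 * expR ((2 * C)^-1 * q (rv z)) by rewrite ler_wpM2l// sqr_ge0.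
have := ler_wpM2l a0 (le_trans b1 (lerD (lexx _) b3)).
by rewrite exprMn; lra.
Qed.

Lemma quotJ_bound : exists K3 : R, 0 <= K3 /\ forall t, 0 < t <= Num.min 1 (2 * C)^-1 ->
  exists2 r, quotJ f gauss t = r%:E & `|r - (Q + l * J)| <= K3 * t.
Proof.
have J0 : 0 <= J by exact: ltW (mass_gt0 wp).
have Q0 : 0 <= Q.
  by apply: Rintegral_ge0 => z _; rewrite mulr_ge0 ?expR_ge0// half_sqr_grad_ge0.
have K0 : 0 <= K.
  by apply: Rintegral_ge0 => z _; rewrite mulr_ge0 ?expR_ge0// sqr_ge0.
pose e := l ^+ 2 * expR `|l|.
have e0 : 0 <= e by rewrite mulr_ge0 ?sqr_ge0 ?expR_ge0.
exists (K + `|l| * (Q + K) + e * (J + Q + K) + C * Q + `|l| * Q); split.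
  have l0 := normr_ge0 l; have C0' := ltW C0.
  have p a b : 0 <= a -> 0 <= b -> 0 <= a * b :> R by exact: mulr_ge0.
  have s a b : 0 <= a -> 0 <= b -> 0 <= a + b :> R by exact: addr_ge0.
  by apply: (s) (p _ _ l0 Q0); apply: (s) (p _ _ C0' Q0);
     apply: (s) (p _ _ e0 (s _ _ (s _ _ J0 Q0) K0)); apply: (s) K0 (p _ _ l0 (s _ _ Q0 K0)).
move=> t; rewrite le_min => /andP[t0 /andP[t1 tC]].
have := @total_mass_asplund_bounds t; rewrite t0 tC => /(_ isT).
case E : (total_mass _) => [M| |]; last 2 first.
- by move=> /andP[_]; rewrite leNgt ltry.
- by move=> /andP[]; rewrite leNgt ltNyr.
rewrite !lee_fin => MB.
exists ((M - J) / t); first by rewrite /quotJ E total_massE -EFinB -EFinM.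
have tC1 : 0 < 1 + t * C by rewrite addr_gt0// mulr_gt0.
have := @first_variation_remainder R t l e (expR (t * l)) (t / (1 + t * C)) C J Q K M.
rewrite t0 t1 MB => /(_ isT (ltW C0) J0 Q0 K0 e0 _ _ _ isT) H.
have {}H := H _ _ _.
have -> : (M - J) / t - (Q + l * J) = (M - J - t * (Q + l * J)) / t.
  by field; rewrite gt_eqF.
rewrite normrM (gtr0_norm (_ : 0 < t^-1)) ?invr_gt0// ler_pdivrMr//.
set K3 := (X in _ <= X * t * t) in H *.
have -> : K3 * t * t = t ^+ 2 * K3 by rewrite -mulrA -expr2 mulrC.
apply: H.
- rewrite expR_ge1Dx/=; apply: (le_trans (expR_le_quadratic _)).
  rewrite lerD2l exprMn /e -mulrA !ler_wpM2l ?sqr_ge0// ler_expR normrM gtr0_norm//.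
  by rewrite ler_piMl.
- rewrite ler_pdivlMr// ler_pdivrMr//; apply/andP; split.
    have : 0 <= t * (t * C) ^+ 2 by rewrite mulr_ge0 ?sqr_ge0 ?ltW.
    lra.
  by rewrite ler_peMr ?(ltW t0)// lerDl mulr_ge0 ?ltW.
- by rewrite divr_ge0 ?ltW.
Qed.

Lemma cvg_quotJ : quotJ f gauss t @[t --> 0^'+] --> (Q + l * J)%:E.
Proof.
have [K3 [K30 H]] := quotJ_bound.
pose t0 := Num.min 1 (2 * C)^-1.
have t00 : 0 < t0 by rewrite lt_min ltr01 invr_gt0 mulr_gt0.
have near_t0 : \forall t \near (0 : R)^'+, 0 < t <= t0.
  near=> t; apply/andP; split; first by near: t; exact: nbhs_right_gt.
  by near: t; exact: nbhs_right_le.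
apply/fine_cvgP; split.
  by apply: filterS near_t0 => t /H[r -> _].
apply/cvgrPdist_le => e e0.
near=> t; have /H[r /= -> hr] : 0 < t <= t0 by near: t.
rewrite distrC; apply: (le_trans hr).
have : t * (K3 + 1) <= e.
  rewrite -ler_pdivlMr; last by lra.
  near: t; apply: nbhs_right_le; rewrite divr_gt0//; lra.
have tt : 0 <= t by apply: ltW; near: t; exact: nbhs_right_gt.
by have := mulr_ge0 K30 tt; lra.
Unshelve. all: by end_near. Qed.

End first_variation.

(** * Perimeter, Fisher information and entropy *)

Section gibbs_functionals.
Context {R : realType} {n : nat}.
Variable U : 'rV[R]_n -> R.
Hypothesis C2U : C2 U.
Hypothesis HPD : forall x, positive_definite (hessian U x).
Hypothesis superlinear : forall B : R, exists M, forall x : 'rV[R]_n, M < enorm x -> B * enorm x <= U x.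
Variable C : R.
Hypothesis C0 : 0 < C.
Hypothesis HC : forall x v : 'rV[R]_n, (v *m hessian U x *m v^T) 0 0 <= C * dotp v v.

Notation L := (@lebesgue_tuple R n).
Let f := exp_neg (fun x => (U x)%:E).
Let wp := potential_of_C2 C2U HPD superlinear C0 HC.
Let Q := \int[L]_t (half_sqr_grad U (rv t) * expR (- U (rv t))).
Let S := \int[L]_t (U (rv t) * expR (- U (rv t))).

Lemma grad_exp_neg x : grad f x = - f x *: grad U x.
Proof.
apply/rowP => i; rewrite !mxE.
have dl := is_derive_line C2U x (delta_mx 0 i) 0.
have := @is_derive1_comp R expR (fun s => - U (x + s *: delta_mx 0 i)) 0 _ _
  (is_derive_expR _) (is_deriveN dl).
rewrite scale0r addr0 => d.
have : is_derive x (delta_mx 0 i) f (expR (- U x) * - dotp (delta_mx 0 i) (grad U x)).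
  apply: is_derive_transfer d => s.
  by rewrite /f exp_neg_EFin /= [_%:A]/GRing.scale/= mulr1 addr0 addrC.
move=> [_]; rewrite /partial => ->.
by rewrite dotpC dotp_delta mxE mulrN mulNr.
Qed.

Lemma Fisher_information_exp_neg :
  int_Rn (fun x => (enorm (grad f x) ^+ 2 / f x)%:E) = (2 * Q)%:E.
Proof.
have i := decaying_integrable (decaying_half_sqr_grad C2U HPD superlinear C0 HC).
rewrite /int_Rn -(RintegralZl _ measurableT i) -Rintegral_EFin; last first.
  exact: (integrableRZl _ measurableT i).
apply: eq_integral => t _; congr EFin.
rewrite -/(rv t) enorm_sqr grad_exp_neg dotpZl dotpZr /half_sqr_grad /f exp_neg_EFin.
by field; rewrite gt_eqF ?expR_gt0.
Qed.

Lemma Ent_exp_neg : Ent f = (- S - mass U * ln (mass U))%:E.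
Proof.
have i := decaying_integrable (decaying_potential_exp wp).
rewrite /Ent (total_massE C2U HPD superlinear C0 HC) lne_EFin; last exact: mass_gt0 wp.
rewrite -EFinM EFinB; congr (_ - _)%E.
rewrite -mulN1r -(RintegralZl _ measurableT i) -Rintegral_EFin; last first.
  exact: (integrableRZl _ measurableT i).
apply: eq_integral => t _; congr EFin.
by rewrite -/(rv t) /f exp_neg_EFin expRK; ring.
Qed.

Lemma deficit_first_variation :
  deficit U (fun i => partial i U) =
  Q + ln (gauss_cst R n) * mass U - (n%:R * mass U + (- S - mass U * ln (mass U))).
Proof.
have i1 := decaying_integrable (decaying_half_sqr_grad C2U HPD superlinear C0 HC).
have i2 := decaying_integrable (decaying_potential_exp wp).
have E : \int[L]_t energy U (fun i => partial i U) (rv t) = Q + S.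
  rewrite -(RintegralD measurableT i1 i2); apply: eq_Rintegral => t _.
  by rewrite /energy half_sqr_gradE; ring.
by rewrite /deficit E ln_gauss_cst; ring.
Qed.

Lemma quadratic_gauss (x0 : 'rV[R]_n) k :
  U = quadratic x0 k <->
  forall x, f x = expR (- k) / gauss_cst R n * gauss (x - x0).
Proof.
have c0 := gauss_cst_gt0 (R := R) n.
have E x : expR (- k) / gauss_cst R n * gauss (x - x0) = expR (- quadratic x0 k x).
  rewrite /gauss mulrA divfK ?gt_eqF// -expRD; congr expR.
  rewrite /quadratic enorm_sqr dotpE opprD addrC; congr (- (_ / _) - _).
  by apply: eq_bigr => i _; rewrite !mxE expr2.
split=> [UE x|h]; first by rewrite E /f exp_neg_EFin UE.
by apply/funext => x; apply: oppr_inj; apply: expR_inj; rewrite -E -h.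
Qed.

Lemma deficit_eq0_gauss : deficit U (fun i => partial i U) = 0 <->
  exists (x0 : 'rV[R]_n) (lam : R), 0 < lam /\ forall x, f x = lam * gauss (x - x0).
Proof.
have c0 := gauss_cst_gt0 (R := R) n.
split=> [/(deficit_eq0 wp)[x0 [k /quadratic_gauss h]]|[x0 [lam [lam0 h]]]].
  by exists x0, (expR (- k) / gauss_cst R n); rewrite divr_gt0 ?expR_gt0.
apply: (deficit_quadratic (x0 := x0) (k := - ln (lam * gauss_cst R n)) wp).
apply/quadratic_gauss => x.
by rewrite opprK lnK ?posrE ?mulr_gt0// mulfK ?gt_eqF.
Qed.

End gibbs_functionals.

Lemma superlinear_of_cvg (R : realType) (n : nat) (U : 'rV[R]_n -> R) :
  (fun x => (U x)%:E * ((enorm x)^-1)%:E)%E @ norm_infty --> +oo%E ->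
  forall B, exists M, forall x, M < enorm x -> B * enorm x <= U x.
Proof.
move=> h B.
have [M [_ HM]] : norm_infty (fun x : 'rV[R]_n => (B%:E < (U x)%:E * ((enorm x)^-1)%:E)%E).
  by apply: (h [set y | (B%:E < y)%E]); apply: nbhs_open_ereal_pinfty.
exists (Num.max 0 (M + 1)) => x; rewrite gt_max => /andP[x0 Mx].
have := HM (M + 1) _ _ Mx; rewrite ltrDl ltr01 => /(_ isT).
by rewrite -EFinM lte_fin ltr_pdivlMr// => /ltW.
Qed.

Theorem proposition6p2 (R : realType) (n : nat) (n_ge1 : (1 <= n)%N)
    (f : 'rV[R]_n -> R) (u : 'rV[R]_n -> \bar R)
    (hu : classL' u) (hf : f = exp_neg u)
    (hphi : uniformly_strictly_convex (fine \o conjugate u)) :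
  [/\ cvg (quotJ f gauss t @[t --> 0^'+]),
      perimeter f =
        ((2^-1)%:E * int_Rn (fun x => (enorm (grad f x) ^+ 2 / f x)%:E)
         + (ln (gauss_cst R n))%:E * total_mass f)%E,
      (n%:R%:E * total_mass f + Ent f <= perimeter f)%E
    & perimeter f = (n%:R%:E * total_mass f + Ent f)%E <->
      exists (x0 : 'rV[R]_n) (lam : R),
        0 < lam /\ forall x, f x = lam * gauss (x - x0) ].
Proof.
case: hu => _ domu; set U := fine \o u.
have uE : u = fun x => (U x)%:E.
  apply/funext => x; rewrite /U /= fineK//.
  by have : dom u x by rewrite domu.
rewrite uE in hf hphi * => C2U HPD /superlinear_of_cvg sup.
case: hphi => c c0 hc.
have HC := hessian_upper_bound C2U HPD sup c0 hc.
have C0 : 0 < c^-1 by rewrite invr_gt0.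
have cq := cvg_quotJ C2U HPD sup C0 HC; rewrite -hf in cq.
have PE : perimeter f = _ := cvg_lim (@ereal_hausdorff R) cq.
have FE := Fisher_information_exp_neg C2U HPD sup C0 HC.
have TE := total_massE C2U HPD sup C0 HC.
have EE := Ent_exp_neg C2U HPD sup C0 HC.
have DE := deficit_first_variation C2U HPD sup C0 HC.
have GE := deficit_eq0_gauss C2U HPD sup C0 HC.
rewrite -hf in FE TE EE GE.
have D0 := deficit_ge0 (potential_of_C2 C2U HPD sup C0 HC).
split.
- by apply/cvg_ex; eexists; exact: cq.
- by rewrite PE FE TE -!EFinM -EFinD mulKf.
- by rewrite PE TE EE -EFinM -EFinD lee_fin -subr_ge0 -DE.
- rewrite -GE DE PE TE EE -EFinM -EFinD; split=> [[->]|/eqP]; first by rewrite subrr.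
  by rewrite subr_eq0 => /eqP ->.
Qed.
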